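(* Assume that $\mu$ satisfies a Poincaré inequality with constant $C_P$. Suppose the following. $(H_\eta)$ $\eta$ is a $C^2$ non-negative function defined on $\mathbb{R}^+$ such that $\lim_{u\to+\infty}\eta(u)/u=+\infty$; there exists $b>0$ such that $\eta''(u)>0$ for $u>b$; $\eta$ is non-decreasing on $[b,+\infty)$ and $\eta''$ is non-increasing on $[b,+\infty)$. Fix $a>\max(2,b)$ and define $\psi$ on $\mathbb{R}^+$ by $$\psi''(u)=\frac{\eta''(u)}{\eta''(a)}\ \text{ if } u\ge a,\qquad \psi''(u)=1\ \text{ otherwise},\qquad \psi'(u)=\int_{1/2}^u\psi''(v)\,dv,\qquad \psi(u)=\int_1^u\psi'(v)\,dv .$$ $(H_F)$ There exist $\rho>1$ and a non-decreasing function $F$, positive on $(a,+\infty)$, such that - for all measurable $A$ with $0<\mu(A)<1/2$, $\ \mu(A)\,F(1/\mu(A))\le Cap_\mu(A)$; - there exists a constant $C_{cap}$ such that for all $u>a$, $$\frac{\eta(\rho u)}{u^2\,\eta''(u)\,F(u)}\le C_{cap}.$$ Then $\mu$ satisfies an $\mathcal{I}_\psi$-inequality, i.e. there is a constant $C_\psi>0$ such that $$\int\psi(h)\,d\mu\le C_\psi\int\psi''(h)\,\Gamma(h)\,d\mu$$ for every nice density of probability $h$; hence $I_\psi(t,h)\le e^{-t/2C_\psi}\,I_\psi(h)$. In particular there exist constants $M_\eta$ and $C_\eta$ such that for every density of probability $h$ and every $t\ge0$, $$\|P_t^*(h\mu)-\mu\|_{TV}\le M_\eta\,e^{-t/4C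_\eta}\left(1+\int\eta(h)\,d\mu\right).$$
   Context: Setting: $(X_t,\mathbb{P}_x)$ is a time-continuous Markov process with a unique ergodic invariant probability measure $\mu$, infinitesimal generator $L$, semi-group $P_t$ and dual (adjoint) semi-group $P_t^*$, so that for a density of probability $h$ w.r.t. $\mu$, $P_t^*h\,d\mu$ is the law of $X_t$ with initial law $h\,d\mu$; this law is also denoted $P_t^*(h\mu)$. It is assumed that there is an algebra of uniformly continuous and bounded functions, containing the constants, which is a core for $L$ and on which a carré du champ $\Gamma$ exists: $L(fg)=fLg+gLf+\Gamma(f,g)$. One writes $\Gamma(f)=\Gamma(f,f)$ (note the normalization: $\Gamma(f)=|\nabla f|^2$ when $L=\frac12\Delta$). Moreover $\Gamma$ comes from a derivation: $\Gamma(fg,h)=f\Gamma(g,h)+g\Gamma(f,h)$. Consequently, for smooth $\Psi$, $L\Psi(f)=\Psi'(f)Lf+\frac12\Psi''(f)\Gamma(f)$ and $\Gamma(\Psi(f))=(\Psi'(f))^2\Gamma(f)$. Replacing $L$ by $L^*$ does not change $\Gamma$. Poincaré inequality with constant $C_P$: $\mathrm{Var}_\mu(f)=\int f^2d\mu-(\int f\,d\mu)^2\le C_P\int\Gamma(f)\,d\mu$ for all $f$ in the domain. Capacity: for $A\subset\Omega$ with $\mu(\Omega)\le1/2$, $Cap_\mu(A,\Omega)=\inf\{\int\Gamma(f)\,d\mu\,;\ \mathbf{1}_A\le f\le\mathbf{1}_\Omega\}$, the infimum being over functions in the domain of the Dirichlet form $\mathcal{E}(f)=\int\Gamma(f)\,d\mu$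 ($+\infty$ if there is none). For $\mu(A)<1/2$, $Cap_\mu(A)=\inf\{Cap_\mu(A,\Omega)\,;\ A\subset\Omega,\ \mu(\Omega)\le1/2\}$. Notation: $I_\psi(t,h)=\int\psi(P_t^*h)\,d\mu$, $I_\psi(h)=I_\psi(0,h)$. ''Nice density of probability'' means a nonnegative $h$ with $\int h\,d\mu=1$ belonging to the domain of the Dirichlet form. Total variation is normalized as $\|g\mu-\mu\|_{TV}=\int|g-1|\,d\mu$. *)

(* Defs.v *)
From HB Require Import structures.
From mathcomp Require Import all_boot all_order all_algebra.
From mathcomp Require Import all_classical all_reals all_analysis.

Set Implicit Arguments.
Unset Strict Implicit.
Unset Printing Implicit Defensive.
Import Order.TTheory GRing.Theory Num.Theory.
Import numFieldNormedType.Exports.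

Local Open Scope classical_set_scope.
Local Open Scope ring_scope.

(** ** Markov processes *)

Definition borel (E : ptopologicalType) := g_sigma_algebraType (@open E).

Section markov_process.
Context {R : realType} {dE dO : measure_display}.
Context {E : measurableType dE} {Om : measurableType dO}.
Variables (X : R -> Om -> E) (Px : R.-pker E ~> Om).

Definition natural_filtration (s : R) : set (set Om) :=
  <<s [set X u @^-1` B | u in [set u | 0 <= u <= s] & B in measurable] >>.

Definition transition (t : R) (x : E) (B : set E) : \bar R :=
  Px x (X t @^-1` B).

Record markov_process : Prop := MarkovProcess {
  process_measurable : forall t : R, 0 <= t -> measurable_fun [set: Om] (X t) ;
  process_start : forall x B, measurable B -> transition 0 x B = \d_x B ;
  process_markov : forall x (s t : R) C B, 0 <= s -> 0 <= t ->
    natural_filtration s C -> measurable B ->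
    Px x (C `&` X (s + t) @^-1` B) =
      (\int[Px x]_(w in C) transition t (X s w) B)%E }.

Definition semigroup (t : R) (f : E -> R) : E -> R :=
  fun x => \int[Px x]_w f (X t w).

Definition invariant_measure (nu : probability E R) : Prop :=
  forall (t : R) B, 0 <= t -> measurable B ->
    (\int[nu]_x transition t x B)%E = nu B.

Definition ergodic (mu : probability E R) : Prop :=
  forall B, measurable B ->
    (forall t : R, 0 <= t ->
       {ae mu, forall x, transition t x B = (\1_B x)%:E}) ->
    mu B = 0%E \/ mu B = 1%E.

Definition unique_ergodic_invariant (mu : probability E R) : Prop :=
  [/\ invariant_measure mu,
      forall nu : probability E R, invariant_measure nu ->
        forall B, measurable B -> nu B = mu B
    & ergodic mu].

End markov_process.

(** ** Generators and the Dirichlet form in [L^2(mu)] *)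

Section l2_theory.
Context {R : realType} {d : measure_display} {T : measurableType d}.
Variable mu : probability T R.
Implicit Types (S : R -> (T -> R) -> T -> R) (f g h : T -> R).

Definition lp_cvg (p : \bar R) {I : Type} (F : set_system I)
    (u : I -> T -> R) f : Prop :=
  'N[mu]_p [EFin \o (u i \- f)%R]%E @[i --> F] --> 0%E.

Definition strongly_continuous S : Prop :=
  forall f, f \in Lfun mu 2%:E -> lp_cvg 2%:E 0^'+ (fun t => S t f) f.

Definition is_generator S f g : Prop :=
  [/\ f \in Lfun mu 2%:E, g \in Lfun mu 2%:E &
      lp_cvg 2%:E 0^'+ (fun t x => (S t f x - f x) / t) g].

Definition generator_dom S : set (T -> R) :=
  [set f | exists g, is_generator S f g].

(* A version of the class [L f]; it is determined up to a mu-null set, and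
   is meaningful on [generator_dom S] only. *)
Definition generator S f : T -> R := xget (cst 0) [set g | is_generator S f g].

(* Taking for [f] the indicator of B, the identity below says that
   [Sd t h dmu] is the law at time t of the process with initial law [h dmu]. *)
Definition adjoint_semigroup S Sd : Prop :=
  forall (t : R) h, 0 <= t -> h \in Lfun mu 1%E ->
    Sd t h \in Lfun mu 1%E /\
    forall f, measurable_fun [set: T] f -> (exists M : R, forall x, `|f x| <= M) ->
      \int[mu]_x (f x * Sd t h x) = \int[mu]_x (S t f x * h x).

Definition is_core S (A : set (T -> R)) : Prop :=
  A `<=` generator_dom S /\
  forall f, generator_dom S f ->
    exists fn : nat -> T -> R,
      [/\ forall n, A (fn n), lp_cvg 2%:E \oo fn f &
          lp_cvg 2%:E \oo (fun n => generator S (fn n)) (generator S f)].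

Definition function_algebra (A : set (T -> R)) : Prop :=
  [/\ forall c, A (cst c),
      forall f g, A f -> A g -> A (f \+ g) &
      forall f g, A f -> A g -> A (f \* g)].

(* The carre du champ [Gamma(f, g)] of two elements of the algebra, read off
   from L(fg) = f Lg + g Lf + Gamma(f, g). *)
Definition core_carre S f g : T -> R :=
  fun x => generator S (f \* g) x - f x * generator S g x
           - g x * generator S f x.

Record carre_du_champ_algebra S Sd (A : set (T -> R)) : Prop := {
  carre_algebra : function_algebra A ;
  carre_core : is_core S A ;
  carre_derivation : forall f g h, A f -> A g -> A h ->
    {ae mu, forall x, core_carre S (f \* g) h x =
                      f x * core_carre S g h x + g x * core_carre S f h x} ;
  carre_adjoint_dom : A `<=` generator_dom Sd ;
  carre_adjoint : forall f g, A f -> A g ->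
    {ae mu, forall x, core_carre Sd f g x = core_carre S f g x} }.

(* The Dirichlet form is the closure of [f |-> \int Gamma(f) dmu] on the
   algebra, and [Gamma(f)] for f in its domain is the L^1 limit of the
   [Gamma(fn)] along approximating sequences. *)
Definition is_carre S (A : set (T -> R)) f (G : T -> R) : Prop :=
  [/\ f \in Lfun mu 2%:E, G \in Lfun mu 1%E &
  exists fn : nat -> T -> R,
    [/\ forall n, A (fn n),
        lp_cvg 2%:E \oo fn f,
        (\int[mu]_x (core_carre S (fn p.1 \- fn p.2) (fn p.1 \- fn p.2) x)%:E)%E
          @[p --> filter_prod \oo \oo] --> 0%E &
        lp_cvg 1%E \oo (fun n => core_carre S (fn n) (fn n)) G]].

Definition dirichlet_dom S A : set (T -> R) :=
  [set f | exists G, is_carre S A f G].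

Definition carre S A f : T -> R := xget (cst 0) [set G | is_carre S A f G].

Definition energy S A f : \bar R := (\int[mu]_x (carre S A f x)%:E)%E.

Definition poincare S A (CP : R) : Prop :=
  forall f, dirichlet_dom S A f ->
    (\int[mu]_x (f x ^+ 2)%:E - (\int[mu]_x (f x)%:E) ^+ 2
       <= CP%:E * energy S A f)%E.

Definition capacity_in S A (B Om : set T) : \bar R :=
  ereal_inf [set energy S A f | f in
    [set f | dirichlet_dom S A f /\ forall x, \1_B x <= f x <= \1_Om x]].

Definition capacity S A (B : set T) : \bar R :=
  ereal_inf [set capacity_in S A B Om | Om in
    [set Om | [/\ measurable Om, B `<=` Om & (mu Om <= (2^-1)%:E)%E]]].

Definition density h : Prop :=
  [/\ measurable_fun [set: T] h, forall x, 0 <= h x &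
      (\int[mu]_x (h x)%:E = 1)%E].

Definition nice_density S A h : Prop := density h /\ dirichlet_dom S A h.

(* Total variation distance between [g dmu] and [mu]. *)
Definition tv_dist g : \bar R := (\int[mu]_x (`|g x - 1|)%:E)%E.

Definition I_functional (Sd : R -> (T -> R) -> T -> R) (psi : R -> R)
    (t : R) h : \bar R :=
  (\int[mu]_x (psi (Sd t h x))%:E)%E.

End l2_theory.

(** ** The standing assumptions *)

Record diffusion_setting (R : realType) (E : pseudoPMetricType R)
    (dO : measure_display) (Om : measurableType dO)
    (X : R -> Om -> borel E) (Px : R.-pker (borel E) ~> Om)
    (mu : probability (borel E) R)
    (Pstar : R -> (borel E -> R) -> borel E -> R)
    (A : set (borel E -> R)) : Prop := {
  setting_markov : markov_process X Px ;
  setting_invariant : unique_ergodic_invariant X Px mu ;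
  setting_continuous : strongly_continuous mu (semigroup X Px) ;
  setting_adjoint : adjoint_semigroup mu (semigroup X Px) Pstar ;
  setting_bounded : forall f, A f -> exists M : R, forall x, `|f x| <= M ;
  setting_unif_continuous :
    forall f, A f -> unif_continuous (f : E -> R) ;
  setting_carre : carre_du_champ_algebra mu (semigroup X Px) Pstar A }.

(** ** The functions [eta] and [psi] *)

Section eta_psi.
Context {R : realType}.

(* C^2 on [0, +oo[, with one-sided derivatives at 0. *)
Definition C2_Rplus (f : R -> R) : Prop :=
  [/\ {within `[0, +oo[, continuous f},
      forall u : R, 0 < u ->
        [/\ derivable f u 1, derivable (derive1 f) u 1 &
            derive1n 2 f x @[x --> u] --> derive1n 2 f u],
      cvg (derive1 f x @[x --> 0^'+]) &
      cvg (derive1n 2 f x @[x --> 0^'+])].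

Record H_eta (eta : R -> R) (b : R) : Prop := {
  eta_C2 : C2_Rplus eta ;
  eta_ge0 : forall u : R, 0 <= u -> 0 <= eta u ;
  eta_superlinear : eta u / u @[u --> +oo] --> +oo ;
  eta_b_gt0 : 0 < b ;
  eta_convex : forall u, b < u -> 0 < derive1n 2 eta u ;
  eta_nondecreasing :
    {in `[b, +oo[ &, {homo eta : u v / u <= v}} ;
  eta_d2_nonincreasing :
    {in `[b, +oo[ &, {homo (derive1n 2 eta) : u v /~ u <= v}} }.

(* The integral from x to y, with sign. *)
Definition oriented_integral (x y : R) (f : R -> R) : R :=
  if x <= y then \int[@lebesgue_measure R]_(z in `[x, y]) f z
  else - \int[@lebesgue_measure R]_(z in `[y, x]) f z.

Definition psi2 (eta : R -> R) (a u : R) : R :=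
  if a <= u then derive1n 2 eta u / derive1n 2 eta a else 1.

Definition psi1 (eta : R -> R) (a u : R) : R :=
  oriented_integral 2^-1 u (psi2 eta a).

Definition psi (eta : R -> R) (a u : R) : R :=
  oriented_integral 1 u (psi1 eta a).

End eta_psi.

(* The function F is only ever evaluated at positive reals. *)
Definition H_F (R : realType) (d : measure_display) (T : measurableType d)
    (mu : probability T R) (S : R -> (T -> R) -> T -> R)
    (A : set (T -> R)) (eta : R -> R) (a : R) : Prop :=
  exists (rho : R) (F : R -> R),
    [/\ 1 < rho,
        {in `]0, +oo[ &, {homo F : u v / u <= v}},
        forall u, a < u -> 0 < F u,
        forall B, measurable B -> (0 < mu B < (2^-1)%:E)%E ->
          (mu B * (F ((fine (mu B))^-1))%:E <= capacity mu S A B)%E &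
        exists Ccap : R, forall u, a < u ->
          eta (rho * u) / (u ^+ 2 * derive1n 2 eta u * F u) <= Ccap].

(* Main.v *)
Require Import Defs.
From HB Require Import structures.
From mathcomp Require Import all_boot all_order all_algebra.
From mathcomp Require Import all_classical all_reals all_analysis.
From mathcomp Require Import measurable_realfun ring lra.
Import Order.TTheory GRing.Theory Num.Theory.
Import numFieldNormedType.Exports.
Local Open Scope classical_set_scope.
Local Open Scope ring_scope.
Set Implicit Arguments.
Unset Strict Implicit.
Unset Printing Implicit Defensive.

(** The entropy of a density h is the integral of psi(h). As h has mass 1, psi may
    be replaced by [chi], its difference with the tangent at 1, which is
    nonnegative. The proof has three parts.

    The functional inequality. Put a_k = a rho^k. Where h <= a_1, the entropy is
    at most (h - 1)^2 / 2, and the Poincare inequality applies to a truncation of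
    h. Above a_1 the range of h is cut into layers between consecutive levels. The
    truncation of h to such a layer, normalised to have height 1, is a competitor
    for the capacity of the set B where h >= a_(k+1). By Markov's inequality
    mu(B) <= 1 / a_(k+1), so the lower bound of the capacity by F and the bound of
    eta by F give eta(a_(k+2)) mu(B) <= C psi''(a_(k+1)) E_k, where E_k is the
    energy of the truncation ([level_capacity]). The left-hand sides add up to
    more than a multiple of the entropy above a_1, because chi is dominated by
    eta ([high_part_bound]). As psi'' is nonincreasing, the right-hand sides add
    up to at most the integral of psi''(h) Gamma(h) ([entropy_energy]).

    The decay. The derivative of the entropy along the adjoint semigroup should be
    minus half the right-hand side of the functional inequality, but the density
    at time t is not known to lie in the Dirichlet domain. The inequality is
    therefore stated for arbitrary upper bounds of the relaxed energies of the
    truncations ([layered_inequality]), and these bounds come from convexity: for a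
    nondecreasing 1-Lipschitz function Theta, Jensen's inequality for the transition
    kernels and invariance compare the increments of Theta(f) under the semigroup
    with the pairing of Theta(f) with the increment of f under the adjoint one
    ([adjoint_dissipation]). Small increments bound the relaxed energy
    ([relaxed_energy_of_increments]): time averages are in the domain of the
    generator, hence approximated in the core. Since the pairing is linear and
    monotone in Theta, the bounds for the layers add up to at most twice the one
    for psi', which is the dissipation of entropy ([production_sum_le]). For h in
    the algebra the error in this differentiation is uniform in time, as the
    adjoint semigroup commutes with itself, and an Euler scheme yields exponential
    decay ([entropy_decay_evolution]). Square integrable densities are limits of
    densities in the algebra ([entropy_decay]).

    Total variation. For every s in ]0, 1/2] one has |u - 1| <= s + chi(u) / s
    ([abs_le_chi]). Taking s of the order of the square root of the entropy at time
    t gives half the rate of decay. A density h with eta(h) integrable is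
    truncated, and the entropy of the truncation is at most a multiple of
    1 + int eta(h) dmu, as psi <= C (1 + eta) ([tv_decay]). *)

(** * Primitives on the real line *)

Section primitives.
Context {R : realType}.
Implicit Types f df : R -> R.

Definition has_derivative f df := forall z : R, is_derive z (1 : R) f (df z).

Lemma mean_value f df (x y : R) : has_derivative f df -> x < y ->
  exists2 c, x < c < y & f y - f x = df c * (y - x).
Proof.
move=> fd xy.
have cf : {within `[x, y], continuous f}.
  by apply: derivable_within_continuous => z _; have [] := fd z.
have [c cxy e] := MVT xy (fun z _ => fd z) cf.
by exists c => //; rewrite !(itvP cxy).
Qed.

Lemma nondecreasing_primitive f df : has_derivative f df ->
  (forall z, 0 <= df z) -> {homo f : x y / x <= y}.
Proof.
move=> fd df0 x y; rewrite le_eqVlt => /predU1P[->//|xy].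
have [c _ e] := mean_value fd xy.
by rewrite -subr_ge0 e mulr_ge0// subr_ge0 ltW.
Qed.

Lemma lipschitz_primitive f df K : has_derivative f df ->
  (forall z, `|df z| <= K) -> forall x y, `|f x - f y| <= K * `|x - y|.
Proof.
move=> fd dfK; suff H (x y : R) : x < y -> `|f x - f y| <= K * `|x - y|.
  move=> x y; have [/H//|/H|->] := ltgtP x y; last by rewrite !subrr normr0 mulr0.
  by rewrite distrC (distrC y).
move=> xy; have [c _ e] := mean_value fd xy.
by rewrite distrC e normrM (distrC x) ler_wpM2r.
Qed.

(** The function decreases before q and increases after it. *)
Lemma derive_sign_min f df (q : R) : has_derivative f df ->
  (forall z, 0 <= df z * (z - q)) -> forall p, f q <= f p.
Proof.
move=> fd dfq p; have [qp|pq|->//] := ltgtP q p.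
- have [c /andP[qc _] e] := mean_value fd qp.
  rewrite -subr_ge0 e mulr_ge0 ?subr_ge0 ?(ltW qp)//.
  by rewrite -(@pmulr_lge0 _ (c - q)) ?subr_gt0.
- have [c /andP[_ cq] e] := mean_value fd pq.
  rewrite -subr_le0 e mulr_le0_ge0 ?subr_ge0 ?(ltW pq)//.
  by rewrite -(@nmulr_lge0 _ (c - q)) ?subr_lt0.
Qed.

Lemma has_derivative_continuous f df : has_derivative f df -> continuous f.
Proof.
move=> fd x; apply: differentiable_continuous; apply/derivable1_diffP.
by have [] := fd x.
Qed.

(** The base point may lie on either side, so the integral is taken from a point
    to the left of both. *)
Lemma is_derive_oriented_integral f c : continuous f ->
  has_derivative (oriented_integral c ^~ f) f.
Proof.
move=> cf u.
pose K := Num.min c u - 1.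
have Kc : K < c by rewrite /K ltrBlDr (@le_lt_trans _ _ c) ?ge_min ?lexx// ltrDl.
have Ku : K < u.
  by rewrite /K ltrBlDr (@le_lt_trans _ _ u) ?ge_min ?lexx ?orbT// ltrDl.
have intf x y : (@lebesgue_measure R).-integrable `[x, y] (EFin \o f).
  apply: continuous_compact_integrable; first exact: segment_compact.
  by apply: continuous_subspaceT => z; exact: cf.
pose F v := \int[@lebesgue_measure R]_(t in `[K, v]) f t.
have FB (x y : R) : K <= x -> x <= y ->
    \int[@lebesgue_measure R]_(t in `[x, y]) f t = F y - F x.
  move=> Kx xy; rewrite /F Rintegral_itvB//.
  rewrite Rintegral_itv_obnd_cbnd//.
  by apply: integrableS (intf x y) => //; exact: subset_itv_oc_cc.
have near_eqF : \near u, (F + cst (- F c)) u = oriented_integral c u f.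
  near=> v; have Kv : K <= v by near: v; exact: lt_le_nbhsr.
  rewrite /oriented_integral; case: ifPn => cv /=.
    by rewrite FB// ltW.
  by rewrite FB// ?opprB// ltW// ltNge.
apply: (near_eq_is_derive near_eqF).
rewrite -[f u]addr0; apply: is_deriveD.
have uu1 : u < u + 1 by rewrite ltrDl.
have [dF F'] := continuous_FTC1_closed uu1 (intf _ _) Ku (cf u).
apply: DeriveDef; first exact: dF.
by rewrite -derive1E.
Unshelve. all: by end_near. Qed.

Lemma oriented_integralxx f c : oriented_integral c c f = 0.
Proof. by rewrite /oriented_integral lexx set_itv1 Rintegral_set1. Qed.

Lemma has_derivativeD f df g dg : has_derivative f df -> has_derivative g dg ->
  has_derivative (fun x => f x + g x) (fun x => df x + dg x).
Proof. by move=> fd gd z; apply: is_deriveD. Qed.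

Lemma has_derivativeZ (k : R) f df : has_derivative f df ->
  has_derivative (fun x => k * f x) (fun x => k * df x).
Proof. by move=> fd z; have fz := fd z; apply: is_deriveZ. Qed.

Lemma has_derivative_affine (k c : R) :
  has_derivative (fun x => k * x + c) (cst k).
Proof.
move=> z; rewrite -[cst k z]addr0; apply: is_deriveD.
by rewrite -[cst k z]mulr1; have idz := is_derive_id z (1 : R); exact: is_deriveZ.
Qed.

Lemma has_derivative_half_sq :
  has_derivative (fun x : R => (x - 1) ^+ 2 / 2) (fun x => x - 1).
Proof.
move=> x.
have H : is_derive x 1 (fun x : R => x - 1) 1.
  have -> : (fun x : R => x - 1) = (fun x => 1 * x + -1) by apply/funext => y; lra.
  exact: has_derivative_affine.
have -> : (fun x : R => (x - 1) ^+ 2 / 2) = (fun x => 2^-1 * ((x - 1) * (x - 1))).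
  by apply/funext => y; rewrite expr2 mulrC.
have -> : x - 1 = 2^-1 * ((x - 1) *: (1 : R) + (x - 1) *: 1) by rewrite !scaler1; lra.
exact/is_deriveZ/is_deriveM.
Qed.

Lemma constant_primitive (f df : R -> R) (x y : R) : has_derivative f df -> x <= y ->
  (forall z, x < z < y -> df z = 0) -> f y = f x.
Proof.
move=> fD; rewrite le_eqVlt => /predU1P[->//|xy df0].
have [c cxy] := mean_value fD xy.
by rewrite (df0 c cxy) mul0r => /eqP; rewrite subr_eq0 => /eqP.
Qed.

Lemma mean_value_pos (f df : R -> R) (x y : R) :
  (forall z : R, 0 < z -> is_derive z 1 f (df z)) -> 0 < x -> x < y ->
  exists2 c, x < c < y & f y - f x = df c * (y - x).
Proof.
move=> fd x0 xy.
have cf : {within `[x, y], continuous f}.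
  apply: derivable_within_continuous => z; rewrite in_itv /= => /andP[xz _].
  by have [] := fd z (lt_le_trans x0 xz).
have fd' (z : R) : z \in `]x, y[ -> is_derive z 1 f (df z).
  by rewrite in_itv /= => /andP[xz _]; apply: fd; exact: lt_trans xz.
have [c cxy e] := MVT xy fd' cf.
by exists c => //; rewrite !(itvP cxy).
Qed.

Lemma lipschitz_continuous (f : R -> R) (K : R) :
  (forall x y, `|f x - f y| <= K * `|x - y|) -> continuous f.
Proof.
move=> fK x; apply/cvgrPdist_le => e e0; near=> y.
rewrite (le_trans (fK _ _))//; apply: (@le_trans _ _ ((`|K| + 1) * `|x - y|)).
  by rewrite ler_wpM2r// (le_trans (ler_norm K))// lerDl.
rewrite mulrC -ler_pdivlMr ?ltr_wpDl//; near: y.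
apply: cvgr_dist_le; first exact: cvg_id.
by rewrite divr_gt0// ltr_wpDl.
Unshelve. all: by end_near. Qed.

Lemma lipschitz_max0 (x y : R) : `|Num.max 0 x - Num.max 0 y| <= `|x - y|.
Proof.
case: (leP 0 x) => h1; case: (leP 0 y) => h2; rewrite ?subrr ?normr0// ?sub0r ?subr0 ?normrN.
  by rewrite ger0_norm// (le_trans _ (ler_norm _))//; lra.
by rewrite distrC ger0_norm// (le_trans _ (ler_norm _))//; lra.
Qed.

Lemma lipschitz_min (x x' y y' K : R) : `|x - x'| <= K -> `|y - y'| <= K ->
  `|Num.min x y - Num.min x' y'| <= K.
Proof.
move=> /ler_normlP[h1 h2] /ler_normlP[h3 h4]; apply/ler_normlP.
by case: (leP x y) => h5; case: (leP x' y') => h6; split; lra.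
Qed.

Lemma clamp_continuous (m M : R) : continuous (fun x : R => Num.max m (Num.min M x)).
Proof.
move=> x; apply: (@continuous_max R R (cst m) (fun x => Num.min M x)).
  exact: cvg_cst.
by apply: (@continuous_min R R (cst M) idfun); [exact: cvg_cst|exact: cvg_id].
Qed.

Lemma clamp_norm (n x : R) : 0 <= n -> `|Num.max (- n) (Num.min n x)| <= n.
Proof.
move=> n0; apply/ler_normlP; case: (leP n x) => h1.
  by case: (leP (- n) n) => h2; split; lra.
by case: (leP (- n) x) => h2; split; lra.
Qed.

Lemma clamp_sqr_le (n x : R) : 0 <= n ->
  Num.max (- n) (Num.min n x) ^+ 2 <= Num.max (- n) (Num.min n x) * x.
Proof.
move=> n0; rewrite expr2; case: (leP n x) => h1.
  by case: (leP (- n) n) => h2; nra.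
by case: (leP (- n) x) => h2; nra.
Qed.

Lemma clamp_dist (a b M : R) : `|a| <= M ->
  `|a - Num.max (- M) (Num.min b M)| <= `|a - b|.
Proof.
rewrite ler_norml => /andP[h1 h2].
have /ler_normlP[h3 h4] := lexx `|a - b|; have h5 := normr_ge0 (a - b).
rewrite ler_norml; apply/andP; rewrite /Num.max /Num.min.
move: `|a - b| h3 h4 h5 => n h3 h4 h5.
by case: (ltP b M) => hb; case: ltP => hc; split; lra.
Qed.

End primitives.

(** * Uniform approximation by polynomials *)

Section polynomial_approximation.
Context {R : realType}.
Implicit Types f g : R -> R.

Definition poly_approximable f := forall M e : R, 0 < e ->
  exists p : {poly R}, forall x, `|x| <= M -> `|f x - p.[x]| <= e.

Lemma poly_bounded (p : {poly R}) (M : R) :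
  exists B : R, forall x, `|x| <= M -> `|p.[x]| <= B.
Proof.
elim/poly_ind: p => [|p c [B pB]]; first by exists 0 => x _; rewrite horner0 normr0.
exists (B * M + `|c|) => x xM; rewrite hornerMXaddC.
rewrite (le_trans (ler_normD _ _))// lerD2r normrM ler_pM//; exact: pB.
Qed.

Lemma poly_approximable_poly (p : {poly R}) : poly_approximable (horner p).
Proof. by move=> M e e0; exists p => x _; rewrite subrr normr0 ltW. Qed.

Lemma poly_approximableD f g : poly_approximable f -> poly_approximable g ->
  poly_approximable (f \+ g).
Proof.
move=> pf pg M e e0; have e20 : 0 < e / 2 by rewrite divr_gt0.
have [p fp] := pf M _ e20; have [q gq] := pg M _ e20.
exists (p + q) => x xM; rewrite hornerD /=.
have -> : f x + g x - (p.[x] + q.[x]) = (f x - p.[x]) + (g x - q.[x]) by ring.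
by rewrite (le_trans (ler_normD _ _))// (splitr e) lerD ?fp ?gq.
Qed.

Lemma poly_approximableZ (k : R) f : poly_approximable f ->
  poly_approximable (fun x => k * f x).
Proof.
move=> pf M e e0; have e20 : 0 < e / (`|k| + 1) by rewrite divr_gt0// ltr_wpDl.
have [p fp] := pf M _ e20.
exists (k *: p) => x xM; rewrite hornerZ -mulrBr normrM.
rewrite (le_trans (ler_wpM2l _ (fp x xM)))//.
by rewrite mulrA ler_pdivrMr ?ltr_wpDl// mulrC ler_wpM2l ?(ltW e0)// lerDl.
Qed.

(** The classical iteration d -> d (1 - d / 2) for the error. *)
Lemma poly_approx_abs (n : nat) : exists p : {poly R}, forall x, `|x| <= 1 ->
  0 <= `|x| - p.[x] <= 2 / (n.+2)%:R /\ 0 <= p.[x].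
Proof.
elim: n => [|n [p IH]].
  by exists 0 => x x1; rewrite horner0 subr0 divff// normr_ge0 x1 lexx.
exists (p + 2^-1 *: ('X ^+ 2 - p ^+ 2)) => x x1.
have [/andP[d0 dn] p0] := IH x x1.
rewrite hornerD hornerZ hornerD hornerN !horner_exp hornerX.
rewrite -[x ^+ 2]real_normK ?num_real//.
set y := `|x| in x1 d0 dn *; set q := p.[x] in d0 dn p0 *.
have y0 : 0 <= y by rewrite /y.
have n2 : (0 : R) < n.+2%:R by [].
have n3 : (0 : R) < n.+3%:R by [].
have -> : y - (q + 2^-1 * (y ^+ 2 - q ^+ 2)) = (y - q) * (1 - (y + q) / 2) by field.
have : y - q <= (y - q) * 1 by rewrite mulr1.
split; last first.
  by rewrite addr_ge0// mulr_ge0// subr_ge0 lerXn2r ?nnegrE// -subr_ge0.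
apply/andP; split.
  by rewrite mulr_ge0//; lra.
set D := 2 / n.+2%:R in dn *.
have D1 : D <= 1 by rewrite /D ler_pdivrMr// mul1r ler_nat.
have D0 : 0 < D by rewrite /D divr_gt0.
apply: (@le_trans _ _ ((y - q) * (1 - (y - q) / 2))).
  by apply: ler_wpM2l => //; lra.
apply: (@le_trans _ _ (D * (1 - D / 2))).
  move: (y - q) d0 dn => d d0 dD; nra.
rewrite /D -[n.+3]addn1 -[n.+2]addn1 !natrD.
move: n2; rewrite -[n.+2]addn1 natrD; move: (n.+1%:R : R) => m m0.
have m20 : 0 < m + 1 + 1 by lra.
rewrite ler_pdivlMr//.
have -> : 2 / (m + 1) * (1 - 2 / (m + 1) / 2) * (m + 1 + 1) = 
  2 * (m * (m + 2)) / (m + 1) ^+ 2 by field; rewrite gt_eqF.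
rewrite ler_pdivrMr ?exprn_gt0//; nra.
Qed.

Lemma poly_approximable_norm : poly_approximable (@Num.norm _ R).
Proof.
move=> M e e0; wlog M0 : M / 0 < M.
  move=> H; have [p pH] := H (`|M| + 1) (ltr_wpDl (normr_ge0 _) ltr01).
  exists p => x xM; apply: pH; rewrite (le_trans xM)//.
  by rewrite (le_trans (ler_norm _))// lerDl.
have [n nP] : exists n : nat, 2 * M / e <= n%:R.
  by exists (Num.truncn (2 * M / e)).+1; rewrite ltW// truncnS_gt.
have [p pP] := poly_approx_abs n.
exists (M *: (p \Po (M^-1 *: 'X))) => x xM.
rewrite hornerZ horner_comp hornerZ hornerX.
have y1 : `|M^-1 * x| <= 1.
  by rewrite normrM gtr0_norm ?invr_gt0// mulrC ler_pdivrMr// mul1r.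
have [/andP[d0 dn] _] := pP _ y1.
have -> : `|x| = M * `|M^-1 * x|.
  by rewrite normrM gtr0_norm ?invr_gt0// mulrA divff ?gt_eqF// mul1r.
rewrite -mulrBr normrM (gtr0_norm M0) ger0_norm//.
rewrite (le_trans (ler_wpM2l (ltW M0) dn))//.
rewrite mulrA ler_pdivrMr// mulrC.
move: nP; rewrite ler_pdivrMr// => /le_trans; apply.
by rewrite mulrC ler_pM2l// ler_nat -addn2 leq_addr.
Qed.

Lemma poly_approximable_abs f : poly_approximable f ->
  poly_approximable (fun x => `|f x|).
Proof.
move=> pf M e e0; have e20 : 0 < e / 2 by rewrite divr_gt0.
have [p fp] := pf M _ e20; have [B pB] := poly_bounded p M.
have [q qP] := poly_approximable_norm B e20.
exists (q \Po p) => x xM; rewrite horner_comp.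
rewrite -(subrKA `|p.[x]|) (le_trans (ler_normD _ _))// (splitr e) lerD//.
  by rewrite (le_trans (ler_dist_dist _ _))// fp.
by apply: qP; exact: pB.
Qed.

Lemma poly_approximable_max f g : poly_approximable f -> poly_approximable g ->
  poly_approximable (fun x => Num.max (f x) (g x)).
Proof.
move=> pf pg.
have pfg := poly_approximable_abs (poly_approximableD pf (poly_approximableZ (-1) pg)).
have := poly_approximableZ 2^-1
  (poly_approximableD (poly_approximableD pf pg) pfg).
congr poly_approximable; apply/funext => x /=.
rewrite mulN1r maxr_absE mulrC//.
Qed.

Lemma poly_approximable_min f g : poly_approximable f -> poly_approximable g ->
  poly_approximable (fun x => Num.min (f x) (g x)).
Proof.
move=> pf pg.
have := poly_approximableZ (-1) (poly_approximable_max
  (poly_approximableZ (-1) pf) (poly_approximableZ (-1) pg)).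
congr poly_approximable; apply/funext => x /=.
by rewrite !mulN1r oppr_max !opprK.
Qed.

Lemma poly_approximable_affine (k c : R) : poly_approximable (fun x => k * x + c).
Proof.
have := @poly_approximable_poly (k *: 'X + c%:P).
congr poly_approximable; apply/funext => x /=.
by rewrite hornerD hornerZ hornerX hornerC.
Qed.

(** At degree 0 the multiple vanishes, whatever the division by zero is worth. *)
Definition poly_primitive (p : {poly R}) : {poly R} :=
  \poly_(i < (size p).+1) (p`_i.-1 / i%:R *+ (0 < i)).

Lemma deriv_poly_primitive p : (poly_primitive p)^`() = p.
Proof.
apply/polyP => i; rewrite coef_deriv coef_poly ltnS /=.
case: ltnP => ip; last by rewrite mul0rn nth_default.
by rewrite mulr1n -[LHS]mulr_natr divfK// pnatr_eq0.
Qed.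

Lemma has_derivative_horner (p : {poly R}) : has_derivative (horner p) (horner p^`()).
Proof.
move=> z; apply: DeriveDef; first exact: derivable_horner.
by rewrite -derive1E -derivE.
Qed.

(** Approximating the derivative first and integrating gives polynomials close
    to a function together with its derivative, as the chain rule needs. *)
Lemma C1_poly_approximation f df (M e : R) : has_derivative f df ->
  poly_approximable df -> 0 < e ->
  exists p : {poly R}, forall x, `|x| <= M ->
    `|f x - p.[x]| <= e /\ `|df x - p^`().[x]| <= e.
Proof.
move=> fd pdf e0; pose K := Num.max M 1.
have K1 : 1 <= K by rewrite le_max lexx orbT.
have K0 : 0 < K by exact: lt_le_trans ltr01 K1.
have [q qP] := pdf K (e / K) (divr_gt0 e0 K0).
pose p := poly_primitive q + (f 0 - (poly_primitive q).[0])%:P.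
have dp : p^`() = q by rewrite derivD derivC addr0 deriv_poly_primitive.
exists p => x xM; have xK : `|x| <= K by rewrite le_max xM.
rewrite dp; split; last first.
  by rewrite (le_trans (qP _ xK))// ler_pdivrMr// ler_peMr// ltW.
have hd : has_derivative (f - horner p) (df - horner q).
  by move=> z; apply: is_deriveB => //; rewrite -dp; exact: has_derivative_horner.
have p0 : (f - horner p) 0 = 0 by rewrite /= !fctE hornerD hornerC subrKC subrr.
have bound c : `|c| <= `|x| -> `|(df - horner q) c| <= e / K.
  by move=> cx; apply: qP; exact: le_trans cx xK.
have KM : e / K * `|x| <= e by rewrite -mulrA ler_piMr ?(ltW e0)// mulrC ler_pdivrMr// mul1r.
apply: le_trans KM; rewrite -[_ - _]/((f - horner p) x).
have [x0|x0|->] := ltgtP x 0.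
- have [c /andP[c1 c2]] := mean_value hd x0.
  rewrite p0 sub0r => E; rewrite -normrN E normrM sub0r normrN ler_wpM2r// bound//.
  by rewrite !ltr0_norm// lerN2 ltW.
- have [c /andP[c1 c2]] := mean_value hd x0.
  rewrite p0 !subr0 => E; rewrite E normrM ler_wpM2r// bound//.
  by rewrite !gtr0_norm// ltW.
- by rewrite p0 normr0 mulr0.
Qed.

End polynomial_approximation.

(** * Integrals against a probability measure *)

Section integrals.
Context d (T : measurableType d) (R : realType) (mu : probability T R).
Implicit Types f g h : T -> R.

Definition rint f : R := \int[mu]_x f x.

Definition intble f := mu.-integrable [set: T] (EFin \o f).

Lemma intble_measurable f : intble f -> measurable_fun [set: T] f.
Proof. by move=> /integrableP[/measurable_EFinP]. Qed.

Lemma intble_cst (c : R) : intble (cst c).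
Proof. exact: finite_measure_integrable_cst. Qed.

Lemma intbleD f g : intble f -> intble g -> intble (fun x => f x + g x).
Proof.
move=> If Ig; have := integrableD measurableT If Ig.
by apply: eq_integrable => // x _; rewrite /= EFinD.
Qed.

Lemma intbleZ (k : R) f : intble f -> intble (fun x => k * f x).
Proof.
move=> If; have := integrableZl measurableT k If.
by apply: eq_integrable => // x _; rewrite /= EFinM.
Qed.

Lemma intbleN f : intble f -> intble (fun x => - f x).
Proof.
by move=> If; have := intbleZ (-1) If; apply: eq_integrable => // x _; rewrite /= mulN1r.
Qed.

Lemma intbleB f g : intble f -> intble g -> intble (fun x => f x - g x).
Proof. by move=> If Ig; apply: intbleD => //; exact: intbleN. Qed.

Lemma intble_abs f : intble f -> intble (fun x => `|f x|).
Proof.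
by move=> If; have := integrable_abse If; apply: eq_integrable => // x _.
Qed.

Lemma le_intble f g : measurable_fun [set: T] f ->
  (forall x, `|f x| <= g x) -> intble g -> intble f.
Proof.
move=> mf fg Ig; apply: (le_integrable measurableT _ _ Ig).
  exact/measurable_EFinP.
by move=> x _ /=; rewrite lee_fin (le_trans (fg x))// ler_norm.
Qed.

Lemma rintE f : intble f -> (\int[mu]_x (f x)%:E)%E = (rint f)%:E.
Proof. by move=> If; rewrite /rint/= fineK//; exact: integrable_fin_num. Qed.

Lemma rintD f g : intble f -> intble g -> rint (fun x => f x + g x) = rint f + rint g.
Proof. exact: RintegralD. Qed.

Lemma rintB f g : intble f -> intble g -> rint (fun x => f x - g x) = rint f - rint g.
Proof. exact: RintegralB. Qed.

Lemma rintZ (k : R) f : intble f -> rint (fun x => k * f x) = k * rint f.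
Proof. by move=> If; rewrite /rint RintegralZl. Qed.

Lemma rintN f : intble f -> rint (fun x => - f x) = - rint f.
Proof.
move=> If; rewrite -mulN1r -rintZ//; congr rint; apply/funext => x.
by rewrite mulN1r.
Qed.

Lemma rint_cst (c : R) : rint (cst c) = c.
Proof. have e1 : fine (mu [set: T]) = 1 by rewrite probability_setT.
by rewrite -[RHS]mulr1 -e1; exact: Rintegral_cst. Qed.

Lemma le_rint f g : intble f -> intble g -> (forall x, f x <= g x) -> rint f <= rint g.
Proof. by move=> If Ig fg; apply: le_Rintegral. Qed.

Lemma rint_ge0 f : (forall x, 0 <= f x) -> 0 <= rint f.
Proof. by move=> f0; apply: Rintegral_ge0. Qed.

Lemma le_norm_rint f : intble f -> `|rint f| <= rint (fun x => `|f x|).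
Proof. by move=> If; apply: le_normr_Rintegral. Qed.

Lemma eq_ae_rint f g : measurable_fun [set: T] f -> measurable_fun [set: T] g ->
  {ae mu, forall x, f x = g x} -> rint f = rint g.
Proof.
move=> mf mg fg; congr fine; apply: ae_eq_integral => //.
- exact/measurable_EFinP.
- exact/measurable_EFinP.
- by apply: filterS fg => x /= -> _.
Qed.

Lemma intble_ae f g : measurable_fun [set: T] g ->
  {ae mu, forall x, f x = g x} -> intble f -> intble g.
Proof.
move=> mg fg /integrableP[mf If].
have mg' : measurable_fun [set: T] (EFin \o g) by exact/measurable_EFinP.
apply/integrableP; split => //; apply: le_lt_trans If.
rewrite le_eqVlt; apply/orP; left; apply/eqP; apply: ae_eq_integral => //.
- exact: measurableT_comp.
- exact: measurableT_comp.
- by apply: filterS fg => x /= -> _.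
Qed.

Lemma ae_le_rint f g : intble f -> intble g -> {ae mu, forall x, f x <= g x} ->
  rint f <= rint g.
Proof.
move=> If Ig fg.
have mf := intble_measurable If; have mg := intble_measurable Ig.
rewrite -subr_ge0 -rintB//.
have mfg : measurable_fun [set: T] (fun x => g x - f x) by exact: measurable_funB.
rewrite (@eq_ae_rint _ (fun x => Num.max (g x - f x) 0)) //.
- by apply: rint_ge0 => x; rewrite le_max lexx orbT.
- exact: measurable_maxr.
- by apply: filterS fg => x /= fg; rewrite max_l// subr_ge0.
Qed.

Lemma ae_ge0_of_rint f : intble f ->
  (forall B, measurable B -> 0 <= rint (fun x => \1_B x * f x)) ->
  {ae mu, forall x, 0 <= f x}.
Proof.
move=> If H; have mf := intble_measurable If.
pose B := [set x | f x < 0].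
have mB : measurable B.
  by rewrite -[B]setTI; apply: measurable_fun_ltr => //; exact: measurable_cst.
have e0 (x : T) : \1_B x * f x <= 0.
  rewrite indicE; have [|] := boolP (x \in B); last by rewrite mul0r.
  by rewrite inE /B /= mul1r => /ltW.
have I1 : intble (fun x => \1_B x * f x).
  apply: (le_intble _ _ (intble_abs If)).
    by apply: measurable_funM => //; exact: measurable_indic.
  move=> x; rewrite normrM indicE; case: (x \in B); last by rewrite normr0 mul0r.
  by rewrite normr1 mul1r.
have z : rint (fun x => `|\1_B x * f x|) = 0.
  apply/eqP; rewrite eq_le rint_ge0 ?andbT//.
  have -> : (fun x => `|\1_B x * f x|) = (fun x => - (\1_B x * f x)).
    by apply/funext => x; rewrite ler0_norm.
  by rewrite rintN// oppr_le0 H.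
have : (\int[mu]_x `|(\1_B x * f x)%:E| = 0)%E.
  by have := rintE (intble_abs I1); rewrite z.
have mI : measurable_fun [set: T] (EFin \o (fun x => \1_B x * f x)).
  by apply/measurable_EFinP; exact: intble_measurable I1.
move=> /(ae_eq_integral_abs mu measurableT mI).1.
apply: filterS => x /= /(_ I) [] E.
rewrite leNgt; apply/negP => fx; move: E; rewrite indicE mem_set//= mul1r => E.
by rewrite E ltxx in fx.
Qed.

Lemma measurable_superlevel f (l : R) : measurable_fun [set: T] f ->
  measurable [set x | l <= f x].
Proof.
move=> mf; have -> : [set x | l <= f x] = [set: T] `&` f @^-1` `[l, +oo[.
  by apply/seteqP; split => x /=; rewrite in_itv /= andbT // => -[].
exact: mf.
Qed.

Lemma measurable_strict_superlevel f (l : R) : measurable_fun [set: T] f ->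
  measurable [set x | l < f x].
Proof.
move=> mf; have -> : [set x | l < f x] = [set: T] `&` f @^-1` `]l, +oo[.
  by apply/seteqP; split => x /=; rewrite in_itv /= andbT // => -[].
exact: mf.
Qed.

Lemma rint_sum (F0 : nat -> T -> R) N : (forall k, intble (F0 k)) ->
  intble (fun x => \sum_(k < N) F0 k x) /\
  rint (fun x => \sum_(k < N) F0 k x) = \sum_(k < N) rint (F0 k).
Proof.
move=> IF; elim: N => [|N [IH1 IH2]].
  have -> : (fun x => \sum_(k < 0) F0 k x) = cst 0.
    by apply/funext => x; rewrite big_ord0.
  by rewrite big_ord0 rint_cst; split => //; exact: intble_cst.
have -> : (fun x => \sum_(k < N.+1) F0 k x) = (fun x => \sum_(k < N) F0 k x + F0 N x).
  by apply/funext => x; rewrite big_ord_recr.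
by split; [exact: intbleD|rewrite rintD// IH2 big_ord_recr].
Qed.

Lemma rint_dist_triangle f g h : intble f -> intble g -> intble h ->
  rint (fun x => `|f x - h x|) <=
  rint (fun x => `|f x - g x|) + rint (fun x => `|g x - h x|).
Proof.
move=> If Ig Ih; have Ifg := intble_abs (intbleB If Ig); have Igh := intble_abs (intbleB Ig Ih).
rewrite -rintD//; apply: le_rint; [exact/intble_abs/intbleB|exact: intbleD|].
by move=> x; rewrite -(subrKA (g x)) ler_normD.
Qed.

Lemma intble_pos f : intble f -> intble (fun x => Num.max (f x) 0).
Proof.
move=> If; have mf := intble_measurable If.
apply: (le_intble _ _ (intble_abs If)); first exact: measurable_maxr.
move=> x; have [f0|f0] := leP (f x) 0; first by rewrite normr0.
by [].
Qed.

End integrals.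

(** ** The Hilbert space of square integrable functions *)

Section square_integrable.
Context d (T : measurableType d) (R : realType) (mu : probability T R).
Implicit Types f g h : T -> R.
Local Notation rint := (rint mu).
Local Notation intble := (intble mu).

Definition sqintble f := measurable_fun [set: T] f /\ intble (fun x => f x ^+ 2).

Definition bounded_measurable f :=
  measurable_fun [set: T] f /\ exists M : R, forall x, `|f x| <= M.

Lemma sqintbleP f : f \in Lfun mu 2%:E <-> sqintble f.
Proof.
split=> [L2f|[mf If]].
  split; last exact: Lfun2_integrable_sqr.
  by move: L2f; rewrite inE => /andP[/[!inE]].
rewrite inE; apply/andP; split; rewrite inE//= /finite_norm unlock poweR_lty//.
rewrite (_ : (\int[mu]_x _)%E = (\int[mu]_x (f x ^+ 2)%:E)%E).
  by rewrite (rintE If) ltry.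
apply: eq_integral => x _ /=.
by rewrite powR_mulrn// real_normK// num_real.
Qed.

Lemma intble_mul f g : sqintble f -> sqintble g -> intble (fun x => f x * g x).
Proof.
move=> /sqintbleP L2f /sqintbleP L2g.
exact/Lfun1_integrable/Lfun2_mul_Lfun1.
Qed.

Lemma bounded_intble f : bounded_measurable f -> intble f.
Proof. by move=> [mf [M fM]]; apply: (le_intble _ _ (intble_cst mu M)). Qed.

Lemma bounded_sqintble f : bounded_measurable f -> sqintble f.
Proof.
move=> [mf [M fM]]; split => //; apply: bounded_intble; split.
  exact: measurable_funX.
exists (M ^+ 2) => x; rewrite normrX lerXn2r ?nnegrE//.
exact: le_trans (normr_ge0 _) (fM x).
Qed.

Lemma sqintble_intble f : sqintble f -> intble f.
Proof.
move=> sf; have := intble_mul sf (bounded_sqintble (f := cst 1) _).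
have bm1 : bounded_measurable (cst (1 : R)).
  by split; [exact: measurable_cst|exists 1 => x; rewrite normr1].
by move=> /(_ bm1); apply: eq_integrable => // x _ /=; rewrite mulr1.
Qed.

Lemma intble_bounded_mul f g : bounded_measurable f -> intble g ->
  intble (fun x => f x * g x).
Proof.
move=> [mf [M fM]] Ig; have mg := intble_measurable Ig.
apply: (le_intble _ _ (intbleZ M (intble_abs Ig))).
  exact: measurable_funM.
by move=> x; rewrite normrM ler_wpM2r.
Qed.

Lemma le_sqintble f g : measurable_fun [set: T] f -> sqintble g ->
  (forall x, `|f x| <= `|g x|) -> sqintble f.
Proof.
move=> mf [mg Ig] fg; split => //; apply: (le_intble _ _ Ig).
  exact: measurable_funX.
by move=> x; rewrite normrX -[leRHS]real_normK ?num_real// lerXn2r ?nnegrE.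
Qed.

Lemma sqintbleZ (k : R) f : sqintble f -> sqintble (fun x => k * f x).
Proof.
move=> [mf If]; split; first exact: measurable_funM.
have := intbleZ (k ^+ 2) If; apply: eq_integrable => // x _ /=.
by rewrite exprMn.
Qed.

Lemma sqintbleD f g : sqintble f -> sqintble g -> sqintble (fun x => f x + g x).
Proof.
move=> sf sg; have [mf If] := sf; have [mg Ig] := sg.
split; first exact: measurable_funD.
have := intbleD (intbleD If (intbleZ 2 (intble_mul sf sg))) Ig.
by apply: eq_integrable => // x _ /=; rewrite sqrrD mulr_natl.
Qed.

Lemma sqintbleN f : sqintble f -> sqintble (fun x => - f x).
Proof.
move=> sf; have := sqintbleZ (-1) sf.
by congr sqintble; apply/funext => x; rewrite mulN1r.
Qed.

Lemma sqintbleB f g : sqintble f -> sqintble g -> sqintble (fun x => f x - g x).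
Proof. by move=> sf sg; apply: sqintbleD => //; exact: sqintbleN. Qed.

Lemma sqintble_ae f g : measurable_fun [set: T] g ->
  {ae mu, forall x, f x = g x} -> sqintble f -> sqintble g.
Proof.
move=> mg fg [mf If]; split => //; apply: (intble_ae _ _ If).
  exact: measurable_funX.
by apply: filterS fg => x /= ->.
Qed.

Definition ip f g : R := rint (fun x => f x * g x).

Definition nrm f : R := Num.sqrt (ip f f).

Lemma ipC f g : ip f g = ip g f.
Proof. by congr rint; apply/funext => x; rewrite mulrC. Qed.

Lemma ipDl f g h : sqintble f -> sqintble g -> sqintble h ->
  ip (fun x => f x + g x) h = ip f h + ip g h.
Proof.
move=> sf sg sh; rewrite /ip -rintD; [|exact: intble_mul..].
by congr rint; apply/funext => x; rewrite mulrDl.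
Qed.

Lemma ipZl (k : R) f h : sqintble f -> sqintble h ->
  ip (fun x => k * f x) h = k * ip f h.
Proof.
move=> sf sh; rewrite /ip -rintZ; last exact: intble_mul.
by congr rint; apply/funext => x; rewrite mulrA.
Qed.

Lemma ipBl f g h : sqintble f -> sqintble g -> sqintble h ->
  ip (fun x => f x - g x) h = ip f h - ip g h.
Proof.
move=> sf sg sh; rewrite /ip -rintB; [|exact: intble_mul..].
by congr rint; apply/funext => x; rewrite mulrBl.
Qed.

Lemma ipDr f g h : sqintble f -> sqintble g -> sqintble h ->
  ip h (fun x => f x + g x) = ip h f + ip h g.
Proof. by move=> sf sg sh; rewrite ipC ipDl// !(ipC h). Qed.

Lemma ipBr f g h : sqintble f -> sqintble g -> sqintble h ->
  ip h (fun x => f x - g x) = ip h f - ip h g.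
Proof. by move=> sf sg sh; rewrite ipC ipBl// !(ipC h). Qed.

Lemma ipZr (k : R) f h : sqintble f -> sqintble h ->
  ip h (fun x => k * f x) = k * ip h f.
Proof. by move=> sf sh; rewrite ipC ipZl// ipC. Qed.

Lemma ip0l f : ip (cst 0) f = 0.
Proof.
have -> : ip (cst 0) f = rint (cst 0) by congr rint; apply/funext => x; rewrite mul0r.
exact: rint_cst.
Qed.

Lemma ip_ge0 f : 0 <= ip f f.
Proof. by apply: rint_ge0 => x; rewrite -expr2 sqr_ge0. Qed.

Lemma nrm_ge0 f : 0 <= nrm f.
Proof. exact: sqrtr_ge0. Qed.

Lemma nrm2 f : nrm f ^+ 2 = ip f f.
Proof. by rewrite sqr_sqrtr// ip_ge0. Qed.

Lemma nrm_le f (e : R) : 0 <= e -> (nrm f <= e) = (ip f f <= e ^+ 2).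
Proof. by move=> e0; rewrite -nrm2 ler_pXn2r// nnegrE// nrm_ge0. Qed.

Lemma cauchy_schwarz f g : sqintble f -> sqintble g -> `|ip f g| <= nrm f * nrm g.
Proof.
move=> sf sg.
have q (t : R) : 0 <= ip f f + 2 * t * ip f g + t ^+ 2 * ip g g.
  have := ip_ge0 (fun x => f x + t * g x).
  have stg := sqintbleZ t sg; have sftg := sqintbleD sf stg.
  rewrite ipDl// ipDr// ipDr// !ipZl// !ipZr// (ipC g f).
  by move=> /le_trans; apply; rewrite le_eqVlt; apply/orP; left; apply/eqP; ring.
have ff := ip_ge0 f; have gg := ip_ge0 g.
rewrite -(@ler_pXn2r _ 2)// ?nnegrE ?mulr_ge0 ?nrm_ge0//.
rewrite exprMn !nrm2 real_normK ?num_real//.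
have [g0|g0] := eqVneq (ip g g) 0.
  have -> : ip f g = 0; last by rewrite expr0n mulr_ge0.
  move: q; rewrite g0; set A := ip f f in ff *; set B := ip f g => q.
  apply/eqP; apply: contraT => B0.
  have := q (- (A + 1) / (2 * B)).
  have -> : A + 2 * (- (A + 1) / (2 * B)) * B + (- (A + 1) / (2 * B)) ^+ 2 * 0 = -1.
    by field; rewrite B0.
  by rewrite ler0N1.
have := q (- ip f g / ip g g).
have -> : ip f f + 2 * (- ip f g / ip g g) * ip f g +
    (- ip f g / ip g g) ^+ 2 * ip g g = (ip f f * ip g g - ip f g ^+ 2) / ip g g.
  by field.
by rewrite pmulr_lge0 ?subr_ge0// invr_gt0 lt_neqAle eq_sym g0.
Qed.

Lemma le_ip f g : sqintble f -> sqintble g -> ip f g <= nrm f * nrm g.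
Proof. by move=> sf sg; rewrite (le_trans (ler_norm _))// cauchy_schwarz. Qed.

Lemma nrmD f g : sqintble f -> sqintble g -> nrm (fun x => f x + g x) <= nrm f + nrm g.
Proof.
move=> sf sg; have sfg := sqintbleD sf sg.
rewrite -(@ler_pXn2r _ 2)// ?nnegrE ?addr_ge0 ?nrm_ge0//.
rewrite nrm2 ipDl// !ipDr// sqrrD !nrm2 (ipC g f).
have := le_ip sf sg; lra.
Qed.

Lemma nrmZ (k : R) f : sqintble f -> nrm (fun x => k * f x) = `|k| * nrm f.
Proof.
move=> sf; have skf := sqintbleZ k sf.
by rewrite /nrm ipZl// ipZr// mulrA -expr2 sqrtrM ?sqr_ge0// sqrtr_sqr.
Qed.

Lemma nrmN f : nrm (fun x => - f x) = nrm f.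
Proof. by congr (Num.sqrt (rint _)); apply/funext => x; rewrite mulrNN. Qed.

Lemma nrmB f g : nrm (fun x => f x - g x) = nrm (fun x => g x - f x).
Proof. by rewrite -nrmN; congr nrm; apply/funext => x; rewrite opprB. Qed.

Lemma nrm_triangle f g h : sqintble f -> sqintble g -> sqintble h ->
  nrm (fun x => f x - h x) <= nrm (fun x => f x - g x) + nrm (fun x => g x - h x).
Proof.
move=> sf sg sh; have := nrmD (sqintbleB sf sg) (sqintbleB sg sh).
by congr (_ <= _); congr nrm; apply/funext => x; rewrite subrKA.
Qed.

Lemma eq_ae_ip f g h : sqintble f -> sqintble g -> sqintble h ->
  {ae mu, forall x, f x = g x} -> ip f h = ip g h.
Proof.
move=> [mf _] [mg _] [mh _] fg; apply: eq_ae_rint.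
- exact: measurable_funM.
- exact: measurable_funM.
- by apply: filterS fg => x /= ->.
Qed.

Lemma eq_ae_nrm f g : measurable_fun [set: T] f -> measurable_fun [set: T] g ->
  {ae mu, forall x, f x = g x} -> nrm f = nrm g.
Proof.
move=> mf mg fg; congr Num.sqrt; apply: eq_ae_rint.
- exact: measurable_funM.
- exact: measurable_funM.
- by apply: filterS fg => x /= ->.
Qed.

Lemma le_nrm f g : sqintble g -> measurable_fun [set: T] f ->
  (forall x, `|f x| <= `|g x|) -> nrm f <= nrm g.
Proof.
move=> sg mf fg; have sf := le_sqintble mf sg fg.
rewrite ler_sqrt ?ip_ge0//; apply: le_rint; [exact: intble_mul..|].
by move=> x; rewrite -!expr2 -[leLHS]real_normK ?num_real// -[leRHS]real_normK ?num_real// lerXn2r ?nnegrE.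
Qed.

Lemma nrm_cst (c : R) : nrm (cst c) = `|c|.
Proof. by rewrite /nrm /ip (rint_cst mu (c * c)) -expr2 sqrtr_sqr. Qed.

Lemma le_rint_abs_nrm f : sqintble f -> rint (fun x => `|f x|) <= nrm f.
Proof.
move=> sf; have [mf If] := sf.
have saf : sqintble (fun x => `|f x|).
  by apply: (le_sqintble _ sf) => [|x]; [exact: measurableT_comp|rewrite normr_id].
have s1 : sqintble (cst 1).
  apply: bounded_sqintble; split; first exact: measurable_cst.
  by exists 1 => x; rewrite normr1.
have := le_ip saf s1; rewrite nrm_cst normr1 mulr1.
have -> : nrm (fun x => `|f x|) = nrm f.
  by congr (Num.sqrt (rint _)); apply/funext => x; rewrite -normrM ger0_norm// -expr2 sqr_ge0.
by congr (rint _ <= _); apply/funext => x; rewrite /= mulr1.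
Qed.

Lemma LnormE2 f : sqintble f -> 'N[mu]_2%:E[EFin \o f]%E = (nrm f)%:E.
Proof.
move=> [mf If]; rewrite unlock.
rewrite (_ : (\int[mu]_x _)%E = (\int[mu]_x (f x ^+ 2)%:E)%E); last first.
  by apply: eq_integral => x _ /=; rewrite powR_mulrn// real_normK// num_real.
rewrite (rintE If) poweR_EFin powR12_sqrt ?rint_ge0//; last by move=> x; exact: sqr_ge0.
Qed.

Lemma LnormE1 f : intble f -> 'N[mu]_1[EFin \o f]%E = (rint (fun x => `|f x|))%:E.
Proof. by move=> If; rewrite Lnorm1 -(rintE (intble_abs If)). Qed.

Lemma nrm_abs f : nrm (fun x => `|f x|) = nrm f.
Proof.
congr (Num.sqrt (rint _)); apply/funext => x.
by rewrite -normrM ger0_norm// -expr2 sqr_ge0.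
Qed.

Lemma sqintble_abs f : sqintble f -> sqintble (fun x => `|f x|).
Proof.
move=> sf; have [mf _] := sf; apply: le_sqintble sf _ => [|x]; last by rewrite normr_id.
exact: measurableT_comp.
Qed.

End square_integrable.

(** ** Completeness *)

Section completeness.
Context d (T : measurableType d) (R : realType) (mu : probability T R).
Implicit Types (f g : T -> R) (u : nat -> T -> R).
Local Notation rint := (rint mu).
Local Notation intble := (intble mu).
Local Notation sqintble := (sqintble mu).
Local Notation nrm := (nrm mu).

Lemma limn_einf_le (v : (\bar R)^nat) (c : \bar R) :
  (forall n, v n <= c)%E -> (limn_einf v <= c)%E.
Proof.
move=> vc; rewrite limn_einf_lim; apply: lime_le; first exact: is_cvg_einfs.
apply: nearW => n; apply: le_trans (vc n); apply: ereal_inf_lbound.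
by exists n => /=.
Qed.

Lemma fatou_rint u f (c : R) : (forall n, intble (u n)) ->
  (forall n x, 0 <= u n x) -> measurable_fun [set: T] f ->
  {ae mu, forall x, u n x @[n --> \oo] --> f x} ->
  (forall n, rint (u n) <= c) -> {ae mu, forall x, 0 <= f x} ->
  intble f /\ rint f <= c.
Proof.
move=> Iu u0 mf uf uc f0.
have mu' n : measurable_fun [set: T] (EFin \o u n).
  exact/measurable_EFinP/(intble_measurable (Iu n)).
have H : (\int[mu]_x (f x)%:E <= c%:E)%E.
  apply: (@le_trans _ _ (\int[mu]_x limn_einf (fun n => (u n x)%:E))%E).
    rewrite le_eqVlt; apply/orP; left; apply/eqP; apply: ae_eq_integral => //.
    - exact/measurable_EFinP.
    - under eq_fun do rewrite limn_einf_lim.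
      apply: (emeasurable_fun_cvg (fun k x => einfs (fun n => (u n x)%:E) k)).
        by move=> k; exact: measurable_fun_einfs.
      by move=> x _; exact: is_cvg_einfs.
    - apply: filterS uf => x /= ux _; apply/esym.
      have : (u n x)%:E @[n --> \oo] --> (f x)%:E by apply: cvg_EFin; [exact: nearW|].
      by move=> /cvg_limn_einf_sup[].
  apply: (le_trans (fatou mu measurableT mu' _)).
    by move=> n x _; rewrite lee_fin.
  by apply: limn_einf_le => n; rewrite (rintE (Iu n)) lee_fin.
have If : intble f.
  apply: (@intble_ae _ _ _ _ (fun x => Num.max (f x) 0)) => //.
    by apply: filterS f0 => x /= f0; rewrite max_l.
  apply/integrableP; split.
    by apply/measurable_EFinP; exact: measurable_maxr.
  apply: le_lt_trans (ltry c); apply: le_trans H.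
  rewrite le_eqVlt; apply/orP; left; apply/eqP; apply: ae_eq_integral => //.
  - apply: measurableT_comp => //; apply/measurable_EFinP; exact: measurable_maxr.
  - exact/measurable_EFinP.
  - by apply: filterS f0 => x /= f0 _; rewrite max_l// ger0_norm.
by split => //; rewrite -lee_fin -rintE.
Qed.

(** The increments of a subsequence with summable steps have a finite sum almost
    everywhere. *)
Lemma cauchy_ae_subsequence u : (forall n, intble (u n)) ->
  (forall e : R, 0 < e -> exists N, forall n m, (N <= n)%N -> (N <= m)%N ->
     rint (fun x => `|u n x - u m x|) <= e) ->
  exists (s : nat -> nat) f, [/\ forall k, (k <= s k)%N,
    measurable_fun [set: T] f &
    {ae mu, forall x, u (s k) x @[k --> \oo] --> f x}].
Proof.
move=> Iu Cu.
have mu' n := intble_measurable (Iu n).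
have e0 k : 0 < (2 ^+ k.+1)^-1 :> R by rewrite invr_gt0 exprn_gt0.
have [N NP] := choice (fun k => Cu _ (e0 k)).
pose s k := (k + \sum_(i < k.+1) N i)%N.
have sN k : (N k <= s k)%N.
  by rewrite /s big_ord_recr /= addnA leq_addl.
have sN1 k : (N k <= s k.+1)%N.
  by rewrite /s big_ord_recr /= big_ord_recr /= addnAC addnA leq_addl.
have sk k : (k <= s k)%N by rewrite leq_addr.
pose v k := u (s k).
pose g k x : R := `|v k.+1 x - v k x|.
have Ig k : intble (g k) by have := intble_abs (intbleB (Iu (s k.+1)) (Iu (s k))).
have gk k : rint (g k) <= (2 ^+ k.+1)^-1 by exact: NP.
have mg k : measurable_fun [set: T] (EFin \o g k).
  exact/measurable_EFinP/(intble_measurable (Ig k)).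
have g0 k x : 0 <= g k x by exact: normr_ge0.
pose G x := (\sum_(0 <= k <oo) (g k x)%:E)%E.
have mG : measurable_fun [set: T] G.
  apply: (@ge0_emeasurable_sum _ _ _ setT (fun k x => (g k x)%:E) xpredT).
    by move=> k x _ _; rewrite lee_fin.
  by move=> k _; exact: mg.
have G0 x : (0 <= G x)%E by apply: nneseries_ge0 => k _ _; rewrite lee_fin.
have psum n : \sum_(0 <= k < n) (2 ^+ k.+1)^-1 = 1 - (2 ^+ n)^-1 :> R.
  elim: n => [|n IH]; first by rewrite big_nil expr0 invr1 subrr.
  rewrite big_nat_recr//= IH exprS invfM; set x := (2 ^+ n)^-1; lra.
have GI : (\int[mu]_x G x <= 1)%E.
  rewrite integral_nneseries//; last by move=> k x _; rewrite lee_fin.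
  apply: lime_le.
    apply: is_cvg_nneseries => k _ _; apply: integral_ge0 => x _.
    by rewrite lee_fin.
  apply: nearW => n.
  apply: (@le_trans _ _ (\sum_(0 <= k < n) ((2 ^+ k.+1)^-1)%:E)%E).
    by apply: lee_sum => k _; rewrite (rintE (Ig k)) lee_fin.
  by rewrite sumEFin psum lee_fin lerBlDr lerDl invr_ge0 exprn_ge0.
have IG : mu.-integrable [set: T] G.
  apply/integrableP; split => //; apply: (@le_lt_trans _ _ 1%E); last by rewrite ltry.
  by under eq_integral do rewrite gee0_abs//.
exists s, (fun x => fine (limn_esup (fun k => (v k x)%:E))); split => //.
  apply: measurableT_comp => //; apply: measurable_fun_limn_esup => k.
  by have /measurable_EFinP := mu' (s k).
have := integrable_ae measurableT IG; apply: filterS => x /= /(_ I) Gx.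
have cg : cvgn (series (fun k => g k x)).
  apply: nondecreasing_is_cvgn.
    by apply/nondecreasing_seqP => n; rewrite /series /= big_nat_recr//= lerDl.
  exists (fine (G x)) => _ [n _ <-]; rewrite -lee_fin fineK// -sumEFin.
  by apply: nneseries_lim_ge => k _ _; rewrite lee_fin.
have cv : cvgn (fun k => v k x).
  have : cvgn (series (telescope (fun k => v k x))) by exact: normed_cvg.
  rewrite telescopeK => c.
  have -> : (fun k => v k x) = (fun k => (v k x - v 0%N x) + v 0%N x).
    by apply/funext => k; rewrite subrK.
  by apply: is_cvgD => //; exact: is_cvg_cst.
have E : (v k x)%:E @[k --> \oo] --> (limn (fun k => v k x))%:E by apply: cvg_EFin; [exact: nearW|].
by have [_ ->] := cvg_limn_einf_sup E.
Qed.

(** A rapidly Cauchy subsequence converges almost everywhere, and Fatou's lemma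
    transfers the Cauchy estimate to its limit. *)
Lemma complete_L1 u : (forall n, intble (u n)) ->
  (forall e : R, 0 < e -> exists N, forall n m, (N <= n)%N -> (N <= m)%N ->
     rint (fun x => `|u n x - u m x|) <= e) ->
  exists2 f, intble f & forall e : R, 0 < e -> exists N, forall n, (N <= n)%N ->
     rint (fun x => `|u n x - f x|) <= e.
Proof.
move=> Iu Cu; have [s [f [sk mf cf]]] := cauchy_ae_subsequence Iu Cu.
have H (e : R) : 0 < e -> exists N, forall n, (N <= n)%N ->
    intble (fun x => `|u n x - f x|) /\ rint (fun x => `|u n x - f x|) <= e.
  move=> /Cu[N NP]; exists N => n Nn.
  apply: (@fatou_rint (fun k x => `|u n x - u (s (k + N)%N) x|)).
  - by move=> k; apply/intble_abs/intbleB.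
  - by [].
  - apply: measurableT_comp => //; apply: measurable_funB => //.
    exact: intble_measurable.
  - apply: filterS cf => x /= cf; apply: cvg_norm; apply: cvgB; first exact: cvg_cst.
    by have := cf; rewrite -(cvg_shiftn N).
  - move=> k; apply: NP => //; apply: leq_trans (sk _); exact: leq_addl.
  - by apply: nearW => x.
exists f; last first.
  by move=> e /H[N NP]; exists N => n /NP[].
have [N /(_ N (leqnn N))[I1 _]] := H 1 ltr01.
have mN := intble_measurable (Iu N).
have : intble (fun x => u N x - f x).
  by apply: (le_intble _ _ I1) => //; exact: measurable_funB.
move=> /(intbleB (Iu N)); apply: eq_integrable => // x _ /=.
by rewrite subKr.
Qed.

(** The almost sure limit is the same as for exponent 1. *)
Lemma complete_L2 u : (forall n, sqintble (u n)) ->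
  (forall e : R, 0 < e -> exists N, forall n m, (N <= n)%N -> (N <= m)%N ->
     nrm (fun x => u n x - u m x) <= e) ->
  exists2 f, sqintble f & forall e : R, 0 < e -> exists N, forall n, (N <= n)%N ->
     nrm (fun x => u n x - f x) <= e.
Proof.
move=> su Cu.
have Iu n := sqintble_intble (su n).
have [|s [f [sk mf cf]]] := cauchy_ae_subsequence Iu.
  move=> e /Cu[N NP]; exists N => n m Nn Nm; apply: le_trans (NP n m Nn Nm).
  by apply: le_rint_abs_nrm; exact: sqintbleB.
have H (e : R) : 0 < e -> exists N, forall n, (N <= n)%N ->
    sqintble (fun x => u n x - f x) /\ nrm (fun x => u n x - f x) <= e.
  move=> e0; have [N NP] := Cu _ e0; exists N => n Nn.
  have mn := intble_measurable (Iu n).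
  have mnf : measurable_fun [set: T] (fun x => u n x - f x) by exact: measurable_funB.
  have [||||||I2 Ie] := @fatou_rint (fun k x => (u n x - u (s (k + N)%N) x) ^+ 2)
     (fun x => (u n x - f x) ^+ 2) (e ^+ 2).
  - by move=> k; have [] := sqintbleB (su n) (su (s (k + N)%N)).
  - by move=> k x; exact: sqr_ge0.
  - exact: measurable_funX.
  - apply: filterS cf => x /= cf; rewrite expr2; under eq_fun do rewrite expr2.
    have cB : u n x - u (s (k + N)%N) x @[k --> \oo] --> u n x - f x.
      apply: cvgB; first exact: cvg_cst.
      by have := cf; rewrite -(cvg_shiftn N).
    exact: cvgM.
  - move=> k; have sNk : (N <= s (k + N))%N.
      by apply: leq_trans (sk _); exact: leq_addl.
    by have := NP _ _ Nn sNk; rewrite (nrm_le _ _ (ltW e0)).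
  - by apply: nearW => x; exact: sqr_ge0.
  by split => //; rewrite (nrm_le _ _ (ltW e0)).
exists f; last first.
  by move=> e /H[N NP]; exists N => n /NP[].
have [N /(_ N (leqnn N))[I1 _]] := H 1 ltr01.
have := sqintbleB (su N) I1; congr sqintble; apply/funext => x /=.
by rewrite subKr.
Qed.

End completeness.

(** ** Bounded measurable functions *)

Section bounded_functionals.
Context d (T : measurableType d) (R : realType).
Implicit Types f g : T -> R.

Lemma bounded_measurable_cst (c : R) : bounded_measurable (cst c : T -> R).
Proof. by split; [exact: measurable_cst|exists `|c| => x]. Qed.

Lemma bounded_measurable_indic (B : set T) : measurable B ->
  bounded_measurable (\1_B : T -> R).
Proof.
move=> mB; split; first exact: measurable_indic.
by exists 1 => x; rewrite indicE; case: (x \in B); rewrite ?normr1// normr0.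
Qed.

Lemma bounded_measurableD f g : bounded_measurable f -> bounded_measurable g ->
  bounded_measurable (fun x => f x + g x).
Proof.
move=> [mf [M fM]] [mg [N gN]]; split; first exact: measurable_funD.
by exists (M + N) => x; rewrite (le_trans (ler_normD _ _))// lerD.
Qed.

Lemma bounded_measurableM f g : bounded_measurable f -> bounded_measurable g ->
  bounded_measurable (fun x => f x * g x).
Proof.
move=> [mf [M fM]] [mg [N gN]]; split; first exact: measurable_funM.
by exists (M * N) => x; rewrite normrM ler_pM.
Qed.

Lemma bounded_measurableZ (k : R) f : bounded_measurable f ->
  bounded_measurable (fun x => k * f x).
Proof. by move=> bf; apply: bounded_measurableM => //; exact: bounded_measurable_cst. Qed.

Lemma bounded_measurableN f : bounded_measurable f ->
  bounded_measurable (fun x => - f x).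
Proof.
move=> [mf [M fM]]; split; first exact: measurableT_comp.
by exists M => x; rewrite normrN.
Qed.

Lemma bounded_measurableB f g : bounded_measurable f -> bounded_measurable g ->
  bounded_measurable (fun x => f x - g x).
Proof. by move=> bf bg; apply: bounded_measurableD => //; exact: bounded_measurableN. Qed.

Lemma bounded_measurable_sum (I : Type) (s : seq I) (F : I -> T -> R) :
  (forall i, bounded_measurable (F i)) ->
  bounded_measurable (fun x => \sum_(i <- s) F i x).
Proof.
move=> bF; elim: s => [|i s IH].
  by under eq_fun do rewrite big_nil; exact: bounded_measurable_cst.
by under eq_fun do rewrite big_cons; exact: bounded_measurableD.
Qed.

Lemma measurable_continuous_comp (phi : R -> R) f : continuous phi ->
  measurable_fun [set: T] f -> measurable_fun [set: T] (phi \o f).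
Proof.
by move=> cphi mf; apply: measurableT_comp mf; exact: continuous_measurable_fun.
Qed.

Lemma bounded_measurable_comp (phi : R -> R) f : continuous phi ->
  bounded_measurable f -> bounded_measurable (phi \o f).
Proof.
move=> cphi [mf [M fM]]; split.
  by apply: measurableT_comp => //; exact: continuous_measurable_fun.
have cK : compact `[- M, M] by exact: segment_compact.
have [K [_ KP]] := compact_bounded
  (continuous_compact (continuous_subspaceT cphi) cK).
exists (K + 1) => x; apply: (KP (K + 1)); first by rewrite ltrDl.
by exists (f x) => //=; rewrite in_itv /= -ler_norml.
Qed.

(** Round f down to a multiple of e above a lower bound. *)
Lemma simple_approximation f (e : R) : bounded_measurable f -> 0 < e ->
  exists (c : R) (n : nat) (B : nat -> set T), (forall k, measurable (B k)) /\
    forall x, `|f x - (c + e * \sum_(k < n) \1_(B k) x)| <= e.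
Proof.
move=> [mf [M fM]] e0.
pose B (k : nat) := [set x | (k.+1)%:R * e - M <= f x].
pose n := (Num.truncn (2 * M / e)).+1.
exists (- M), n, B; split => [k|x].
  rewrite -[B k]setTI; exact: measurable_fun_le.
have fM0 : 0 <= f x + M by move: (fM x); rewrite ler_norml => /andP[]; lra.
have fM2 : f x + M <= 2 * M by move: (fM x); rewrite ler_norml => /andP[]; lra.
pose z := (f x + M) / e; have z0 : 0 <= z by rewrite divr_ge0// ltW.
have -> : \sum_(k < n) \1_(B k) x = (Num.truncn z)%:R :> R.
  have tz : (Num.truncn z <= n)%N.
    by rewrite ltnW// ltnS le_truncn// ler_pM2r// invr_gt0.
  have E (k : nat) : \1_(B k) x = (k < Num.truncn z)%N%:R :> R.
    rewrite indicE truncn_gt_nat; congr (_%:R); congr nat_of_bool.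
    rewrite /z ler_pdivlMr//; apply/idP/idP.
      by rewrite inE /B /= lerBlDr.
    by rewrite inE /B /= lerBlDr.
  under eq_bigr do rewrite E.
  elim: n tz => [|m IH]; first by rewrite leqn0 => /eqP ->; rewrite big_ord0.
  rewrite leq_eqVlt => /predU1P[->|].
    rewrite (eq_bigr (fun=> 1)) ?sumr_const ?card_ord// => i _.
    by rewrite ltn_ord.
  rewrite ltnS => tm; rewrite big_ord_recr /= IH// ltnNge tm /= addr0//.
have /andP[t1 t2] := truncn_itv z0.
have -> : f x - (- M + e * (Num.truncn z)%:R) = e * (z - (Num.truncn z)%:R).
  by rewrite /z; field; rewrite gt_eqF.
rewrite normrM gtr0_norm// ler_piMr ?ltW// ger0_norm ?subr_ge0//.
by rewrite ltrBlDr addrC natr1.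
Qed.

Definition bounded_functional (L : (T -> R) -> R) :=
  (forall (k : R) f g, bounded_measurable f -> bounded_measurable g ->
     L (fun x => k * f x + g x) = k * L f + L g) /\
  (forall f (M : R), bounded_measurable f -> (forall x, `|f x| <= M) -> `|L f| <= M).

(** Agreement on indicators passes to simple functions by linearity, and to their
    uniform limits by the bound. *)
Lemma bounded_functional_eq L1 L2 : bounded_functional L1 -> bounded_functional L2 ->
  (forall B, measurable B -> L1 \1_B = L2 \1_B) ->
  forall f, bounded_measurable f -> L1 f = L2 f.
Proof.
move=> [lin1 bd1] [lin2 bd2] H f bf.
have bone := bounded_measurable_indic (@measurableT _ T).
have step (c e : R) n (B : nat -> set T) : (forall k, measurable (B k)) ->
    bounded_measurable (fun x => c + e * \sum_(k < n) \1_(B k) x : R) /\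
    L1 (fun x => c + e * \sum_(k < n) \1_(B k) x) =
    L2 (fun x => c + e * \sum_(k < n) \1_(B k) x).
  move=> mB; elim: n => [|n [IHb IH]].
    have -> : (fun x => c + e * \sum_(k < 0) \1_(B k) x) =
              (fun x => c * \1_[set: T] x + 0 * \1_[set: T] x).
      by apply/funext => x; rewrite big_ord0 mulr0 mul0r indicE in_setT mulr1.
    split; first by apply: bounded_measurableD; exact: bounded_measurableZ.
    rewrite lin1//; last exact: bounded_measurableZ.
    rewrite lin2//; last exact: bounded_measurableZ.
    rewrite H//; congr (_ + _).
    have -> : (fun x => 0 * \1_[set: T] x) = (fun x => (-1 : R) * \1_[set: T] x + \1_[set: T] x).
      by apply/funext => x; rewrite mul0r mulN1r addNr.
    by rewrite lin1// lin2// H.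
  have -> : (fun x => c + e * \sum_(k < n.+1) \1_(B k) x) =
      (fun x => e * \1_(B n) x + (c + e * \sum_(k < n) \1_(B k) x)).
    by apply/funext => x; rewrite big_ord_recr /= mulrDr addrA addrC.
  have bB := bounded_measurable_indic (mB n).
  split; first by apply: bounded_measurableD => //; exact: bounded_measurableZ.
  by rewrite lin1// lin2// H// IH.
apply/eqP; rewrite -subr_eq0 -normr_le0; apply/ler_addgt0Pl => e e0.
rewrite addr0; have e20 : 0 < e / 2 by rewrite divr_gt0.
have [c [n [B [mB fB]]]] := simple_approximation bf e20.
have [bg Lg] := step c (e / 2) n B mB.
set g := (fun x => _) in bg Lg.
have bfg : bounded_measurable (fun x => -1 * g x + f x).
  by apply: bounded_measurableD => //; exact: bounded_measurableZ.
have fgb x : `|-1 * g x + f x| <= e / 2 by rewrite mulN1r addrC.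
have := bd1 _ _ bfg fgb; have := bd2 _ _ bfg fgb.
rewrite lin1// lin2// Lg !mulN1r => h2 h1.
have -> : L1 f - L2 f = (- L2 g + L1 f) - (- L2 g + L2 f) by ring.
by rewrite (splitr e) (le_trans (ler_normB _ _))// lerD.
Qed.

End bounded_functionals.

Section bounded_integrals.
Context d (T : measurableType d) (R : realType) (mu : probability T R).
Implicit Types f g h : T -> R.

Lemma rint_indic (B : set T) : measurable B -> (rint mu \1_B)%:E = mu B.
Proof.
move=> mB; rewrite -rintE; first by rewrite integral_indic// setIT.
exact/bounded_intble/bounded_measurable_indic.
Qed.

Lemma markov_bound f (B : set T) (l : R) : measurable B -> intble mu f ->
  (forall x, 0 <= f x) -> (forall x, B x -> l <= f x) -> l * rint mu \1_B <= rint mu f.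
Proof.
move=> mB fi f0 fB; have iB : intble mu \1_B by exact/bounded_intble/bounded_measurable_indic.
rewrite -rintZ//; apply: le_rint => // [|x]; first exact: intbleZ.
rewrite indicE; have [/set_mem Bx|_] := boolP (x \in B); last by rewrite mulr0.
by rewrite mulr1 fB.
Qed.

Lemma rint_mulBr f g h : intble mu f -> intble mu g -> bounded_measurable h ->
  rint mu (fun x => h x * (f x - g x)) = rint mu (fun x => h x * f x) - rint mu (fun x => h x * g x).
Proof.
move=> If Ig bh; rewrite -rintB; [|exact: intble_bounded_mul|exact: intble_bounded_mul].
by congr (rint mu _); apply/funext => x; rewrite mulrBr.
Qed.

Lemma densityP h : density mu h -> intble mu h /\ rint mu h = 1.
Proof.
move=> [mh h0 h1]; have Ih : intble mu h.
  apply/integrableP; split; first exact/measurable_EFinP.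
  have -> : (fun x => `|(EFin \o h) x|)%E = (EFin \o h).
    by apply/funext => x; rewrite /= ger0_norm.
  by rewrite h1 ltry.
by split => //; apply: EFin_inj; rewrite -rintE.
Qed.

End bounded_integrals.

(** * The semigroup of the process *)

(** The semigroup is only ever applied to bounded measurable functions, where
    it is defined pointwise. *)
Record markov_semigroup d (T : measurableType d) (R : realType)
    (mu : probability T R) (P : R -> (T -> R) -> T -> R) : Prop := {
  sg_measurable : forall t f, 0 <= t -> bounded_measurable f ->
    measurable_fun [set: T] (P t f) ;
  sg_linear : forall t (k : R) f g x, 0 <= t ->
    bounded_measurable f -> bounded_measurable g ->
    P t (fun y => k * f y + g y) x = k * P t f x + P t g x ;
  sg_ge0 : forall t f x, 0 <= t -> bounded_measurable f ->
    (forall y, 0 <= f y) -> 0 <= P t f x ;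
  sg_cst : forall t c x, 0 <= t -> P t (cst c) x = c ;
  sg_0 : forall f x, bounded_measurable f -> P 0 f x = f x ;
  sg_add : forall s t f x, 0 <= s -> 0 <= t -> bounded_measurable f ->
    P (s + t) f x = P s (P t f) x ;
  sg_invariant : forall t f, 0 <= t -> bounded_measurable f ->
    rint mu (P t f) = rint mu f }.

Section markov_semigroup_of_process.
Context (R : realType) (d dO : measure_display) (E : measurableType d)
  (Om : measurableType dO).
Variables (X : R -> Om -> E) (Px : R.-pker E ~> Om) (mu : probability E R).
Hypothesis mp : markov_process X Px.
Hypothesis inv : invariant_measure X Px mu.
Local Notation P := (semigroup X Px).

Lemma kernel_integrable t f x : 0 <= t -> bounded_measurable f ->
  (Px x).-integrable [set: Om] (EFin \o (f \o X t)).
Proof.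
move=> t0 [mf [M fM]]; apply: measurable_bounded_integrable => //.
- by rewrite prob_kernel ltry.
- by apply: measurableT_comp => //; exact: process_measurable mp _ t0.
- exists M; split; first by rewrite num_real.
  by move=> N MN w _ /=; rewrite (le_trans (fM _))// ltW.
Qed.

Lemma semigroup_linear t (k : R) f g x : 0 <= t ->
  bounded_measurable f -> bounded_measurable g ->
  P t (fun y => k * f y + g y) x = k * P t f x + P t g x.
Proof.
move=> t0 bf bg; rewrite /semigroup RintegralD//.
- by rewrite RintegralZl//; exact: kernel_integrable.
- exact: (kernel_integrable x t0 (bounded_measurableZ k bf)).
- exact: (kernel_integrable x t0 bg).
Qed.

Lemma semigroup_ge0 t f x : (forall y, 0 <= f y) -> 0 <= P t f x.
Proof. by move=> f0; apply: Rintegral_ge0. Qed.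

Lemma semigroup_cst t (c : R) x : P t (cst c) x = c.
Proof.
have e1 : fine (Px x [set: Om]) = 1 by rewrite prob_kernel.
by rewrite -[RHS]mulr1 -e1; exact: Rintegral_cst.
Qed.

Lemma semigroup_bound t f (M : R) x : 0 <= t -> bounded_measurable f ->
  (forall y, `|f y| <= M) -> `|P t f x| <= M.
Proof.
move=> t0 bf fM.
have bM := bounded_measurable_cst E M.
rewrite ler_norml; apply/andP; split.
  have := @semigroup_ge0 t (fun y => 1 * f y + cst M y) x.
  rewrite semigroup_linear// mul1r semigroup_cst -lerBlDr sub0r; apply => y.
  by rewrite mul1r /= -lerBlDr sub0r; move: (fM y); rewrite ler_norml => /andP[].
have := @semigroup_ge0 t (fun y => -1 * f y + cst M y) x.
rewrite semigroup_linear// mulN1r semigroup_cst addrC subr_ge0; apply => y.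
by rewrite mulN1r addrC subr_ge0; move: (fM y); rewrite ler_norml => /andP[].
Qed.

Lemma semigroup_measurable t f : 0 <= t -> bounded_measurable f ->
  measurable_fun [set: E] (P t f).
Proof.
move=> t0 bf; have [mf [M fM]] := bf.
have bM := bounded_measurable_cst E M.
have f0 y : 0 <= 1 * f y + cst M y.
  by rewrite mul1r /= -lerBlDr sub0r; move: (fM y); rewrite ler_norml => /andP[].
have -> : P t f = (fun x => P t (fun y => 1 * f y + cst M y) x - M).
  by apply/funext => x; rewrite semigroup_linear// mul1r semigroup_cst addrK.
apply: measurable_funB => //; apply: measurableT_comp => //.
apply: (@measurable_fun_integral_kernel _ _ _ _ _ (fun x => Px x) _
  (fun w => (1 * f (X t w) + cst M (X t w))%:E)) => //.
- by move=> U mU; exact: measurable_kernel.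
- by move=> w; rewrite lee_fin.
- apply/measurable_EFinP.
  have mX := process_measurable mp t0.
  apply: measurable_funD => //; apply: measurable_funM => //.
  exact: measurableT_comp.
Qed.

Lemma semigroup_bounded t f : 0 <= t -> bounded_measurable f ->
  bounded_measurable (P t f).
Proof.
move=> t0 bf; split; first exact: semigroup_measurable.
by have [_ [M fM]] := bf; exists M => x; exact: semigroup_bound.
Qed.

Lemma semigroup_indic t B x : 0 <= t -> measurable B ->
  (P t \1_B x)%:E = transition X Px t x B.
Proof.
move=> t0 mB; have mX := process_measurable mp t0.
have mXB : measurable (X t @^-1` B) by rewrite -[X in measurable X]setTI; exact: mX.
have -> : P t \1_B x = fine (\int[Px x]_w (\1_(X t @^-1` B) w)%:E)%E by [].
rewrite integral_indic// setIT fineK// ge0_fin_numE//.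
apply: (@le_lt_trans _ _ (Px x setT)); last by rewrite prob_kernel ltry.
by apply: le_measure => //; rewrite inE.
Qed.

Lemma semigroup_functional t x : 0 <= t -> bounded_functional (fun f => P t f x).
Proof.
move=> t0; split => [k f g bf bg|f M bf fM]; first exact: semigroup_linear.
exact: semigroup_bound.
Qed.

(** Both sides are bounded functionals of f, so the Markov property for
    indicators suffices. *)
Lemma semigroup_add s t f x : 0 <= s -> 0 <= t -> bounded_measurable f ->
  P (s + t) f x = P s (P t f) x.
Proof.
move=> s0 t0; have st0 : 0 <= s + t by exact: addr_ge0.
apply: (@bounded_functional_eq _ _ _ _ (fun f => P s (P t f) x)
  (semigroup_functional x st0)) => [|B mB].
  split => [k g h bg bh|g M bg gM].
    have -> : P t (fun y => k * g y + h y) = (fun y => k * P t g y + P t h y).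
      by apply/funext => y; exact: semigroup_linear.
    by rewrite semigroup_linear//; exact: semigroup_bounded.
  apply: semigroup_bound => //; first exact: semigroup_bounded.
  by move=> y; exact: semigroup_bound.
have := process_markov mp x s0 t0 _ mB (C := setT).
rewrite setTI => H; apply: EFin_inj; rewrite semigroup_indic// /transition H//; last first.
  have [F0 FC _] := smallest_sigma_algebra [set: Om]
    [set X u @^-1` B | u in [set u | 0 <= u <= s] & B in measurable].
  by have := FC _ F0; rewrite setD0.
rewrite /semigroup [in RHS]/Rintegral fineK.
  by apply: eq_integral => w _; rewrite -semigroup_indic.
apply: integrable_fin_num => //.
apply: (kernel_integrable x s0 (f := P t \1_B)).
exact/semigroup_bounded/bounded_measurable_indic.
Qed.

Lemma semigroup_0 f x : bounded_measurable f -> P 0 f x = f x.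
Proof.
apply: (@bounded_functional_eq _ _ _ _ (fun f => f x)
  (semigroup_functional x (lexx 0))) => [|B mB].
  by split => [k g h bg bh|g M bg gM].
by apply: EFin_inj; rewrite semigroup_indic// (process_start mp)// diracE indicE.
Qed.

(** Invariance is assumed on sets, and extends to functions as a statement on
    bounded functionals. *)
Lemma semigroup_invariant t f : 0 <= t -> bounded_measurable f ->
  rint mu (P t f) = rint mu f.
Proof.
move=> t0; have bP g := @semigroup_bounded t g t0.
apply: (@bounded_functional_eq _ _ _ (fun f => rint mu (P t f))) => [||B mB].
- split => [k g h bg bh|g M bg gM].
    have -> : P t (fun y => k * g y + h y) = (fun y => k * P t g y + P t h y).
      by apply/funext => y; exact: semigroup_linear.
    rewrite rintD ?rintZ//; first exact/bounded_intble/bP.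
      exact/intbleZ/bounded_intble/bP.
    exact/bounded_intble/bP.
  have Ig := bounded_intble mu (bP _ bg).
  rewrite (le_trans (le_norm_rint Ig))// -[leRHS](rint_cst mu).
  apply: le_rint; [exact: intble_abs|exact: intble_cst|].
  by move=> x; exact: semigroup_bound.
- split => [k g h bg bh|g M bg gM].
    by rewrite rintD ?rintZ//; [exact: bounded_intble|exact/intbleZ/bounded_intble|
      exact: bounded_intble].
  have Ig := bounded_intble mu bg.
  rewrite (le_trans (le_norm_rint Ig))// -[leRHS](rint_cst mu).
  by apply: le_rint; [exact: intble_abs|exact: intble_cst|].
- have bB := bounded_measurable_indic R mB.
  have I1 := bounded_intble mu (bP _ bB); have I2 := bounded_intble mu bB.
  apply: EFin_inj; rewrite -(rintE I1) -(rintE I2).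
  transitivity (\int[mu]_x transition X Px t x B)%E.
    by apply: eq_integral => x _; exact: semigroup_indic.
  by rewrite inv// integral_indic// setIT.
Qed.

Lemma process_markov_semigroup : markov_semigroup mu P.
Proof.
split.
- exact: semigroup_measurable.
- by move=> t k f g x; exact: semigroup_linear.
- by move=> t f x _ _; exact: semigroup_ge0.
- by move=> t c x _; exact: semigroup_cst.
- exact: semigroup_0.
- exact: semigroup_add.
- exact: semigroup_invariant.
Qed.

End markov_semigroup_of_process.

(** ** Convergence in mean and in quadratic mean *)

Section lp_convergence.
Context d (T : measurableType d) (R : realType) (mu : probability T R).
Context (I : Type) (F : set_system I) (FF : Filter F).
Implicit Types (u : I -> T -> R) (f : T -> R).

Lemma cvg_EFin0 (n : I -> R) : (forall i, 0 <= n i) ->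
  ((n i)%:E @[i --> F] --> 0%E) <->
  (forall e : R, 0 < e -> \forall i \near F, n i <= e).
Proof.
move=> n0; split=> [H e e0|H].
  have /cvgrPdist_le/(_ e e0) : (fun i => n i) @ F --> (0 : R) by exact: (fine_cvg H).
  by apply: filterS => i; rewrite sub0r normrN /= ger0_norm.
apply: cvg_EFin; first exact: nearW.
apply/cvgrPdist_le => e e0; apply: filterS (H e e0) => i.
by rewrite sub0r normrN /= ger0_norm.
Qed.

Lemma near_eq_cvge (v w : I -> \bar R) (l : \bar R) :
  (\forall i \near F, v i = w i) -> (v i @[i --> F] --> l) <-> (w i @[i --> F] --> l).
Proof.
move=> vw; split => H; apply: cvg_trans H; apply: near_eq_cvg => //.
by apply: filterS vw => i ->.
Qed.

Lemma lp_cvg2E u f : (\forall i \near F, sqintble mu (u i \- f)) ->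
  lp_cvg mu 2%:E F u f <->
  (forall e : R, 0 < e -> \forall i \near F, nrm mu (u i \- f) <= e).
Proof.
move=> su; rewrite -(cvg_EFin0 (fun i => nrm_ge0 mu _)); apply: near_eq_cvge.
by apply: filterS su => i si; rewrite LnormE2.
Qed.

Lemma lp_cvg1E u f : (\forall i \near F, intble mu (u i \- f)) ->
  lp_cvg mu 1%E F u f <->
  (forall e : R, 0 < e -> \forall i \near F, rint mu (fun x => `|u i x - f x|) <= e).
Proof.
move=> su; have n0 i : 0 <= rint mu (fun x => `|u i x - f x|) by apply: rint_ge0.
rewrite -(cvg_EFin0 n0); apply: near_eq_cvge.
by apply: filterS su => i si; rewrite (LnormE1 si).
Qed.

End lp_convergence.

Section lp_convergence_at_right.
Context d (T : measurableType d) (R : realType) (mu : probability T R).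

Lemma near_right0P (Q : R -> Prop) :
  (\forall t \near 0^'+, Q t) <->
  exists2 e : R, 0 < e & forall t, 0 < t -> t <= e -> Q t.
Proof.
split=> [[e /= e0 H]|[e e0 H]].
  exists (e / 2); first by rewrite divr_gt0.
  move=> t t0 te; apply: H => //=; rewrite sub0r normrN gtr0_norm//.
  by rewrite (le_lt_trans te)// ltr_pdivrMr// ltr_pMr// ltr1n.
near=> t; apply: H; near: t; [exact: nbhs_right_gt|exact: nbhs_right_le].
Unshelve. all: by end_near. Qed.

Lemma lp_cvg2_rightP (u : R -> T -> R) f :
  (forall t, 0 < t -> sqintble mu (u t)) -> sqintble mu f ->
  lp_cvg mu 2%:E 0^'+ u f <->
  (forall e : R, 0 < e -> exists2 r : R, 0 < r & forall t, 0 < t -> t <= r ->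
     nrm mu (fun x => u t x - f x) <= e).
Proof.
move=> su sf; rewrite lp_cvg2E; last first.
  by apply/near_right0P; exists 1 => // t t0 _; apply: sqintbleB => //; exact: su.
by split => H e /H/near_right0P.
Qed.

Lemma lp_cvg2_natP (u : nat -> T -> R) f :
  (forall n, sqintble mu (u n)) -> sqintble mu f ->
  lp_cvg mu 2%:E \oo u f <->
  (forall e : R, 0 < e -> exists N, forall n, (N <= n)%N ->
     nrm mu (fun x => u n x - f x) <= e).
Proof.
move=> su sf; rewrite lp_cvg2E; last by apply: nearW => n; exact: sqintbleB.
split=> [H e /H[N _ NP]|H e /H[N NP]]; first by exists N => n /NP.
by exists N => // n /NP.
Qed.

Lemma lp_cvg1_natP (u : nat -> T -> R) f :
  (forall n, intble mu (u n)) -> intble mu f ->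
  lp_cvg mu 1%E \oo u f <->
  (forall e : R, 0 < e -> exists N, forall n, (N <= n)%N ->
     rint mu (fun x => `|u n x - f x|) <= e).
Proof.
move=> su sf; rewrite lp_cvg1E; last by apply: nearW => n; exact: intbleB.
split=> [H e /H[N _ NP]|H e /H[N NP]]; first by exists N => n /NP.
by exists N => // n /NP.
Qed.

End lp_convergence_at_right.

(** * The functions eta and psi *)

Section eta_psi_facts.
Context {R : realType}.
Variables (eta : R -> R) (b a : R).
Hypotheses (etaP : H_eta eta b) (ab : Num.max 2 b < a).
Local Notation eta'' := (derive1n 2 eta).
Local Notation psi2 := (psi2 eta a).
Local Notation psi1 := (psi1 eta a).
Local Notation psi := (psi eta a).

Lemma a_gt2 : 2 < a.
Proof. by rewrite (le_lt_trans _ ab)// le_max lexx. Qed.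

Lemma a_gtb : b < a.
Proof. by rewrite (le_lt_trans _ ab)// le_max lexx orbT. Qed.

Lemma a_gt0 : 0 < a.
Proof. exact: lt_trans a_gt2. Qed.

Lemma eta2_gt0 u : a <= u -> 0 < eta'' u.
Proof. by move=> au; apply: (eta_convex etaP); exact: lt_le_trans a_gtb au. Qed.

Lemma eta2_nonincreasing x y : a <= x -> x <= y -> eta'' y <= eta'' x.
Proof.
move=> ax xy; have ba := ltW a_gtb; have bx := le_trans ba ax.
apply: (eta_d2_nonincreasing etaP) => //; rewrite in_itv /= andbT//.
exact: le_trans bx xy.
Qed.

Lemma eta2_continuous x : 0 < x -> {for x, continuous eta''}.
Proof. by move=> x0; case: (eta_C2 etaP) => _ H _ _; case: (H x x0). Qed.

Lemma psi2E u : psi2 u = eta'' (Num.max u a) / eta'' a.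
Proof.
rewrite /Defs.psi2; have [au|ua] := leP a u; first by [].
by rewrite divff//; apply: lt0r_neq0; exact: eta2_gt0.
Qed.

Lemma psi2_gt0 u : 0 < psi2 u.
Proof.
by rewrite psi2E; apply: divr_gt0; apply: eta2_gt0 => //; rewrite le_max lexx orbT.
Qed.

Lemma psi2_ge0 u : 0 <= psi2 u.
Proof. exact/ltW/psi2_gt0. Qed.

Lemma psi2_1 u : u <= a -> psi2 u = 1.
Proof.
move=> ua; rewrite psi2E (max_idPr ua) divff//.
by apply: lt0r_neq0; exact: eta2_gt0.
Qed.

Lemma psi2_nonincreasing x y : x <= y -> psi2 y <= psi2 x.
Proof.
move=> xy; rewrite !psi2E; apply: ler_wpM2r.
  by rewrite invr_ge0; apply: ltW; exact: eta2_gt0.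
apply: eta2_nonincreasing; first by rewrite le_max lexx orbT.
by rewrite ge_max !le_max xy lexx orbT.
Qed.

Lemma psi2_le1 u : psi2 u <= 1.
Proof.
have [ua|/ltW au] := leP u a; first by rewrite psi2_1.
by rewrite -(psi2_1 (lexx a)); exact: psi2_nonincreasing.
Qed.

Lemma psi2_continuous : continuous psi2.
Proof.
move=> u; have -> : psi2 = (fun u => eta'' (Num.max u a) / eta'' a).
  by apply/funext => x; exact: psi2E.
apply: cvgM; last exact: cvg_cst.
have cm : Num.max x a @[x --> u] --> Num.max u a.
  by apply: (@continuous_max R R idfun (cst a)); [exact: cvg_id|exact: cvg_cst].
apply: continuous_cvg cm.
by apply: eta2_continuous; rewrite lt_max a_gt0 orbT.
Qed.

Lemma psi1D : has_derivative psi1 psi2.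
Proof. by apply: is_derive_oriented_integral; exact: psi2_continuous. Qed.

Lemma psi1_continuous : continuous psi1.
Proof. exact: has_derivative_continuous psi1D. Qed.

Lemma psiD : has_derivative psi psi1.
Proof. by apply: is_derive_oriented_integral; exact: psi1_continuous. Qed.

Lemma psi1_nondecreasing : {homo psi1 : x y / x <= y}.
Proof. by apply: nondecreasing_primitive psi1D _ => z; exact/ltW/psi2_gt0. Qed.

Lemma psi1_lipschitz x y : `|psi1 x - psi1 y| <= `|x - y|.
Proof.
rewrite -[leRHS]mul1r; apply: lipschitz_primitive psi1D _ _ _ => z.
by rewrite ger0_norm ?psi2_le1 ?ltW ?psi2_gt0.
Qed.

Lemma psi1_low u : u <= a -> psi1 u = u - 2^-1.
Proof.
move=> ua; have h0 : psi1 2^-1 = 0 by exact: oriented_integralxx.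
have ha : 2^-1 <= a by have := a_gt2; lra.
have [hu|uh|<-] := ltgtP 2^-1 u; last by rewrite h0 subrr.
- have [c /andP[_ cu]] := mean_value psi1D hu.
  by rewrite h0 psi2_1 ?(ltW (lt_le_trans cu ua))// mul1r subr0.
- have [c /andP[_ cu]] := mean_value psi1D uh.
  rewrite h0 psi2_1 ?(ltW (lt_le_trans cu ha))// mul1r sub0r.
  by move/eqP; rewrite eqr_oppLR opprB => /eqP.
Qed.

Lemma psi_1 : psi 1 = 0.
Proof. exact: oriented_integralxx. Qed.

(** Subtracting the tangent line at 1 does not change the integral of psi
    against a probability density, and makes the integrand nonnegative. *)
Definition chi (u : R) : R := psi u - (u - 1) / 2.

Lemma chiD : has_derivative chi (fun u => psi1 u - 2^-1).
Proof.
have -> : chi = (fun u => psi u + -1 * (2^-1 * u + - 2^-1)).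
  by apply/funext => u; rewrite /chi; lra.
have -> : (fun u => psi1 u - 2^-1) = (fun u => psi1 u + -1 * 2^-1).
  by apply/funext => u; rewrite mulN1r.
apply: has_derivativeD; first exact: psiD.
by apply: has_derivativeZ; exact: has_derivative_affine.
Qed.

Lemma chi_1 : chi 1 = 0.
Proof. by rewrite /chi psi_1 subrr mul0r subr0. Qed.

Lemma psi1_1 : psi1 1 = 2^-1.
Proof. by rewrite psi1_low; have := a_gt2; lra. Qed.

Lemma chi_low u : u <= a -> chi u = (u - 1) ^+ 2 / 2.
Proof.
move=> ua; have a2 := a_gt2.
pose D x := (x - 1) ^+ 2 / 2 + -1 * chi x.
have DD := has_derivativeD has_derivative_half_sq (has_derivativeZ (-1) chiD).
suff : D u = D 1 by rewrite /D chi_1 subrr expr0n mul0r; lra.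
have [u1|u1|->//] := ltgtP u 1.
- have [c /andP[_ c1]] := mean_value DD u1.
  rewrite psi1_low; last lra.
  have -> : c - 1 + -1 * (c - 2^-1 - 2^-1) = 0 by lra.
  by rewrite mul0r => /eqP; rewrite subr_eq0 => /eqP.
- have [c /andP[_ cu]] := mean_value DD u1.
  rewrite psi1_low; last lra.
  have -> : c - 1 + -1 * (c - 2^-1 - 2^-1) = 0 by lra.
  by rewrite mul0r => /eqP; rewrite subr_eq0 => /eqP.
Qed.

Lemma chi_ge0 u : 0 <= chi u.
Proof.
rewrite -chi_1; apply: (derive_sign_min chiD) => z; rewrite -psi1_1.
have [z1|/ltW z1] := leP z 1.
  by apply: mulr_le0; rewrite subr_le0//; exact: psi1_nondecreasing.
by apply: mulr_ge0; rewrite subr_ge0//; exact: psi1_nondecreasing.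
Qed.

Lemma chi_le u : chi u <= (u - 1) ^+ 2 / 2.
Proof.
have DD := has_derivativeD has_derivative_half_sq (has_derivativeZ (-1) chiD).
suff H (z : R) : 0 <= (z - 1 + -1 * (psi1 z - 2^-1)) * (z - 1).
  by have := derive_sign_min DD H u; rewrite chi_1 subrr expr0n mul0r; lra.
have := psi1_lipschitz z 1; rewrite psi1_1.
have [z1|/ltW z1] := leP z 1.
  have := psi1_nondecreasing z1; rewrite psi1_1 => p.
  by rewrite !ler0_norm; nra.
have := psi1_nondecreasing z1; rewrite psi1_1 => p.
by rewrite !ger0_norm; nra.
Qed.

Lemma chi_ge u : 2 <= u -> (u - 1) / 2 <= chi u.
Proof.
move=> u2; have a2 := a_gt2.
have h2 : chi 2 = 2^-1 by rewrite chi_low; [lra|exact: ltW].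
have := u2; rewrite le_eqVlt => /predU1P[<-|lt2u]; first by rewrite h2; lra.
have [c /andP[c2 _]] := mean_value chiD lt2u; rewrite h2.
have := psi1_nondecreasing (ltW c2); rewrite psi1_low ?(ltW a2)// => p e.
nra.
Qed.

(** The weighted form of the bound of the L^1 distance by the square root of
    the entropy: the weight s will be chosen of the order of that root. *)
Lemma abs_le_chi (s u : R) : 0 < s -> s <= 2^-1 -> `|u - 1| <= s + chi u / s.
Proof.
move=> s0 s1; rewrite -(@ler_pM2r _ s)// mulrDl mulfVK ?lt0r_neq0//.
have [u2|u2] := leP u 2.
  rewrite chi_low; last exact: le_trans u2 (ltW a_gt2).
  rewrite -[(u - 1) ^+ 2]real_normK ?num_real//.
  by move: `|u - 1| (normr_ge0 (u - 1)) => y; nra.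
have := chi_ge (ltW u2); rewrite ger0_norm; nra.
Qed.

Lemma eta_derive (u : R) : 0 < u -> is_derive u 1 eta (derive1 eta u).
Proof.
move=> u0; case: (eta_C2 etaP) => _ H _ _; case: (H u u0) => du _ _.
by apply: DeriveDef; [exact: du|rewrite derive1E].
Qed.

Lemma eta1_derive (u : R) : 0 < u -> is_derive u 1 (derive1 eta) (eta'' u).
Proof.
move=> u0; case: (eta_C2 etaP) => _ H _ _; case: (H u u0) => _ du _.
suff -> : eta'' u = 'D_1 (derive1 eta) u by exact: DeriveDef.
by rewrite -derive1E.
Qed.

Lemma eta_le x y : a <= x -> x <= y -> eta x <= eta y.
Proof.
move=> ax xy; have bx := le_trans (ltW a_gtb) ax.
by apply: (eta_nondecreasing etaP) => //; rewrite in_itv /= andbT// (le_trans bx).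
Qed.

(** Otherwise eta would vanish on the whole interval from b to a, where its second
    derivative is positive. *)
Lemma eta_a_gt0 : 0 < eta a.
Proof.
have b0 := eta_b_gt0 etaP; have ba := a_gtb; have a0 := a_gt0.
rewrite lt_neqAle (eta_ge0 etaP) ?(ltW a0)// andbT; apply/eqP => ea.
have z x : b <= x -> x <= a -> eta x = 0.
  move=> bx xa; apply/eqP; rewrite eq_le (eta_ge0 etaP) ?(le_trans (ltW b0))// andbT ea.
  by apply: (eta_nondecreasing etaP) => //; rewrite in_itv /= andbT// ltW.
have [m /andP[bm ma]] : exists m, b < m < a.
  by exists ((b + a) / 2); rewrite (midf_lt ba).1 (midf_lt ba).2.
have d0 x y : b <= x -> x < y -> y <= a -> exists2 c, x < c < y & derive1 eta c = 0.
  move=> bx xy ya.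
  have [c cxy] := mean_value_pos eta_derive (lt_le_trans b0 bx) xy.
  rewrite !z ?subrr ?(le_trans bx) ?(ltW xy)//; last exact: le_trans (ltW xy) ya.
  move=> e; exists c => //; apply/eqP; move/esym/eqP: e.
  by rewrite mulf_eq0 subr_eq0 (gt_eqF xy) orbF.
have [x /andP[bx xm] ex] := d0 b m (lexx b) bm (ltW ma).
have [y /andP[my ya] ey] := d0 m a (ltW bm) ma (lexx a).
have xy := lt_trans xm my.
have [c /andP[xc cy]] := mean_value_pos eta1_derive (lt_trans b0 bx) xy.
rewrite ex ey subrr => /esym/eqP; rewrite mulf_eq0 subr_eq0 (gt_eqF xy) orbF.
by rewrite gt_eqF// (eta_convex etaP) ?(lt_trans bx).
Qed.

(** Far away eta is superlinear; before that it is at least its positive value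
    at a. *)
Lemma linear_le_eta : exists2 C : R, 0 < C & forall u, a <= u -> u <= C * eta u.
Proof.
have [U [_ HU]] : exists U : R, U \is Num.real /\ forall u, U < u -> 1 <= eta u / u.
  have /cvgryPge := eta_superlinear etaP.
  by move=> /(_ 1); apply: filterS.
have ea := eta_a_gt0; have a0 := a_gt0.
pose V := Num.max a U; have V0 : 0 < V by rewrite lt_max a0.
exists (1 + V / eta a); first by rewrite addr_gt0// divr_gt0.
move=> u au; have u0 := lt_le_trans a0 au; have eu := eta_le (lexx a) au.
have eu0 := lt_le_trans ea eu.
rewrite mulrDl mul1r; have [Uu|uU] := ltP U u.
  have := HU u Uu; rewrite ler_pdivlMr// mul1r => /le_trans; apply.
  by rewrite lerDl mulr_ge0// ?divr_ge0// ltW.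
have uV : u <= V by rewrite le_max uU orbT.
apply: (le_trans uV); apply: (@le_trans _ _ (V / eta a * eta u)); last first.
  by rewrite lerDr ltW.
by rewrite mulrAC -mulrA ler_peMr ?(ltW V0)// ler_pdivlMr// mul1r.
Qed.

(** Beyond a the functions psi and eta / eta''(a) have the same second derivative,
    so their difference is affine, hence dominated by eta. *)
Lemma chi_le_eta : exists2 C : R, 0 < C & forall u, a <= u -> chi u + u / 2 <= C * eta u.
Proof.
have [C C0 CP] := linear_le_eta; have e0 := eta2_gt0 (lexx a); have a0 := a_gt0.
pose k := (eta'' a)^-1; have k0 : 0 < k by rewrite invr_gt0.
pose m := psi1 a - k * derive1 eta a; pose q := psi a - k * eta a.
have D1 u : a <= u -> psi1 u - k * derive1 eta u = m.
  rewrite le_eqVlt => /predU1P[<-//|au].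
  have dD (z : R) : 0 < z -> is_derive z 1 (fun z => psi1 z - k * derive1 eta z)
      (psi2 z - k * eta'' z).
    move=> z0; have d1 := psi1D z; have d2 := eta1_derive z0.
    by apply: is_deriveB.
  have [c /andP[ac _]] := mean_value_pos dD a0 au.
  rewrite psi2E (max_idPl (ltW ac)) [_ / _]mulrC subrr mul0r => /eqP.
  by rewrite subr_eq0 => /eqP.
have D2 u : a <= u -> psi u - k * eta u = q + m * (u - a).
  rewrite le_eqVlt => /predU1P[<-|au]; first by rewrite subrr mulr0 addr0.
  have dD (z : R) : 0 < z -> is_derive z 1 (fun z => psi z - k * eta z)
      (psi1 z - k * derive1 eta z).
    move=> z0; have d1 := psiD z; have d2 := eta_derive z0.
    by apply: is_deriveB.
  have [c /andP[ac _]] := mean_value_pos dD a0 au.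
  by rewrite (D1 _ (ltW ac)) -/q; move: (psi u - _) (m * _) => x y; lra.
exists (k + (`|q| + 2 * `|m| + 1) * C).
  by rewrite addr_gt0// mulr_gt0// ltr_wpDl// addr_ge0// mulr_ge0.
move=> u au; have := D2 u au; have := CP u au; rewrite /chi.
have a2 := a_gt2; have u2 : 2 < u by exact: lt_le_trans au.
have hq : q <= `|q| * u.
  by rewrite (le_trans (ler_norm q))// ler_peMr//; lra.
have hm : m * (u - a) <= 2 * `|m| * u.
  rewrite (le_trans (ler_norm _))// normrM mulrC [2 * _]mulrC -mulrA.
  rewrite [leLHS]mulrC ler_wpM2l// ger0_norm ?subr_ge0//; lra.
move: (eta u) (psi u) (`|q|) (`|m|) (normr_ge0 q) (normr_ge0 m) hq hm => e p qq mm.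
move: (m * (u - a)) => z q0 m0 hq hm uC pe.
have : (qq + 2 * mm + 1) * u <= (qq + 2 * mm + 1) * (C * e).
  by apply: ler_wpM2l => //; lra.
by rewrite mulrA; lra.
Qed.

Lemma psi_le_eta : exists2 C : R, 0 < C & forall u, 0 <= u -> psi u <= C * (1 + eta u).
Proof.
have [C C0 CP] := chi_le_eta; exists (C + a ^+ 2); first by rewrite addr_gt0// exprn_gt0// a_gt0.
move=> u u0; have := eta_ge0 etaP u0; have a2 := a_gt2.
have [ua|/ltW au] := leP u a.
  have := chi_low ua; rewrite /chi => e.
  have -> : psi u = (u ^+ 2 - u) / 2 by move: e; rewrite !expr2; lra.
  by move: (eta u) => v v0; rewrite !expr2; nra.
have := CP u au; rewrite /chi; move: (eta u) (psi u) => v p h v0.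
by rewrite !expr2; nra.
Qed.

Lemma chi_continuous : continuous chi.
Proof. exact: has_derivative_continuous chiD. Qed.

(** The second derivative of psi is at most 1. *)
Lemma chi_taylor p q : chi p - chi q <= (psi1 q - 2^-1) * (p - q) + (p - q) ^+ 2 / 2.
Proof.
pose D x := ((x - q) ^+ 2 / 2 + (psi1 q - 2^-1) * (x - q)) - chi x.
have DD : has_derivative D (fun x => (x - q + (psi1 q - 2^-1)) - (psi1 x - 2^-1)).
  have -> : D = (fun x => ((x - 1) ^+ 2 / 2
      + ((1 - q + (psi1 q - 2^-1)) * x
         + ((q ^+ 2 - 1) / 2 - (psi1 q - 2^-1) * q))) + -1 * chi x).
    by apply/funext => x; rewrite /D; move: (psi1 q) (chi x) => c1 c2; rewrite !expr2; lra.
  have -> : (fun x => (x - q + (psi1 q - 2^-1)) - (psi1 x - 2^-1)) =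
      (fun x => ((x - 1) + cst (1 - q + (psi1 q - 2^-1)) x) + -1 * (psi1 x - 2^-1)).
    by apply/funext => x; rewrite /cst /=; lra.
  apply: has_derivativeD; last exact: has_derivativeZ chiD.
  by apply: has_derivativeD; [exact: has_derivative_half_sq|exact: has_derivative_affine].
have Ds z : 0 <= ((z - q + (psi1 q - 2^-1)) - (psi1 z - 2^-1)) * (z - q).
  have := psi1_lipschitz z q; have := psi1_nondecreasing.
  have [zq|/ltW qz] := leP z q.
    move=> /(_ _ _ zq) m; rewrite !ler0_norm ?subr_le0//; nra.
  by move=> /(_ _ _ qz) m; rewrite !ger0_norm ?subr_ge0//; nra.
by have := derive_sign_min DD Ds p; rewrite /D subrr expr0n mul0r mulr0; lra.
Qed.

Lemma chi_dist p q : `|chi p - chi q| <= 2 * ((`|p - 1| + `|q - 1|) * `|p - q|).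
Proof.
have H x y : chi x - chi y <= 2 * ((`|x - 1| + `|y - 1|) * `|x - y|).
  apply: (le_trans (chi_taylor x y)).
  have := psi1_lipschitz y 1; rewrite psi1_1 => h1.
  have h2 : (psi1 y - 2^-1) * (x - y) <= `|y - 1| * `|x - y|.
    by apply: (le_trans (ler_norm _)); rewrite normrM; apply: ler_wpM2r.
  have h3 : `|x - y| <= `|x - 1| + `|y - 1|.
    by have -> : x - y = (x - 1) - (y - 1) by [lra]; exact: ler_normB.
  have h4 : (x - y) ^+ 2 = `|x - y| * `|x - y| by rewrite -expr2 real_normK ?num_real.
  rewrite h4; move: h2 h3 (normr_ge0 (x - y)) (normr_ge0 (x - 1)) (normr_ge0 (y - 1)).
  by move: (_ * (x - y)) `|x - y| `|x - 1| `|y - 1| => q1 q2 q3 q4; nra.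
apply/ler_normlP; split; last exact: H.
by rewrite opprB [`|p - q|]distrC [`|p - 1| + _]addrC; exact: H.
Qed.

(** Adding a constant at most 1 to a truncation of y costs a linear term only,
    because the derivative of chi grows at most linearly. *)
Lemma chi_shift (m d0 y : R) : 0 <= m -> m <= y -> 0 <= d0 -> d0 <= 1 ->
  chi (m + d0) <= chi y + y + 3.
Proof.
move=> m0 my d00 d01; have := chi_taylor (m + d0) m.
rewrite (addrC m) addrK => h1.
have h2 : (psi1 m - 2^-1) * d0 <= m + 1.
  have := psi1_lipschitz m 1; rewrite psi1_1 => h2.
  have h3 : `|m - 1| <= m + 1 by apply/ler_normlP; split; lra.
  apply: (le_trans (ler_norm _)); rewrite normrM (ger0_norm d00).
  apply: (@le_trans _ _ ((m + 1) * 1)); last by rewrite mulr1.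
  by apply: ler_pM => //; exact: le_trans h3.
have h3 : d0 ^+ 2 / 2 <= 1 by rewrite expr2; nra.
have h4 : chi m <= chi y + 2^-1.
  have [m1|/ltW m1] := leP m 1.
    have := chi_le m; have := chi_ge0 y.
    by rewrite expr2; move: (chi m) (chi y) => q1 q2; nra.
  move: my; rewrite le_eqVlt => /predU1P[->|my]; first by rewrite lerDl.
  have [c /andP[mc _]] := mean_value chiD my.
  have := psi1_nondecreasing (le_trans m1 (ltW mc)).
  rewrite psi1_1 => p1 e.
  have : 0 <= (psi1 c - 2^-1) * (y - m) by rewrite mulr_ge0// subr_ge0// ltW.
  by rewrite -e; lra.
by move: h1; rewrite (addrC d0); lra.
Qed.

Lemma psi_chi u : psi u = chi u + (2^-1 * u - 2^-1).
Proof. by rewrite /chi; lra. Qed.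

(** ** Decomposition along geometric levels *)

Section levels.
Variable rho : R.
Hypothesis rho1 : 1 < rho.

Definition level (k : nat) : R := a * rho ^+ k.

Lemma level_gt0 k : 0 < level k.
Proof. by rewrite mulr_gt0 ?a_gt0// exprn_gt0// (lt_trans _ rho1). Qed.

Lemma levelS k : level k.+1 = rho * level k.
Proof. by rewrite /level exprS mulrCA. Qed.

Lemma level_lt k : level k < level k.+1.
Proof. by rewrite levelS ltr_pMl// level_gt0. Qed.

Lemma level_le j k : (j <= k)%N -> level j <= level k.
Proof. by move=> /subnK <-; elim: (k - j)%N => // n IH; rewrite addSn (le_trans IH)// ltW// level_lt. Qed.

Lemma level_ge_a k : a <= level k.
Proof. by have := level_le (leq0n k); rewrite /level expr0 mulr1. Qed.

(** Bernoulli's inequality makes some power of rho exceed 2. *)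
Lemma level_unbounded (u : R) : exists k, u <= level k.
Proof.
have r0 : 0 < rho - 1 by rewrite subr_gt0.
pose k := Num.bound `|u|; pose n := Num.bound (rho - 1)^-1.
have uk : u <= k%:R by rewrite (le_trans (ler_norm u))// ltW// archi_boundP.
exists (n * k)%N; rewrite (le_trans uk)//.
have rn : 2 <= rho ^+ n.
  have Hn m : 1 + m%:R * (rho - 1) <= rho ^+ m.
    elim: m => [|m IH]; first by rewrite mul0r addr0.
    have : rho * (1 + m%:R * (rho - 1)) <= rho * rho ^+ m by rewrite ler_wpM2l//; lra.
    rewrite exprS -natr1; move: (rho * rho ^+ m) (m%:R : R) (ler0n R m) => q p p0.
    apply: le_trans; rewrite -subr_ge0; have := mulr_ge0 p0 (sqr_ge0 (rho - 1)).
    by move: p0 r0; rewrite expr2; lra.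
  rewrite (le_trans _ (Hn n))//; have : (rho - 1)^-1 < n%:R.
    by rewrite archi_boundP// invr_ge0 ltW.
  by rewrite -(ltr_pM2r r0) mulVf ?lt0r_neq0//; lra.
rewrite /level exprM; apply: (@le_trans _ _ (2 ^+ k)).
  by rewrite -natrX ler_nat ltnW// ltn_expl.
apply: (@le_trans _ _ ((rho ^+ n) ^+ k)).
  by rewrite ler_pXn2r ?nnegrE// (le_trans _ rn).
by rewrite ler_peMl// ?exprn_ge0 ?(le_trans _ rn)//; have := a_gt2; lra.
Qed.

(** The tent has height 1 and is Lipschitz, as the localisation of the energy
    requires. Its primitive is the smoothed truncation of the identity to a layer,
    which is tested against the capacity of a superlevel set. *)
Definition tent (k : nat) (u : R) : R :=
  2 / (level k.+1 - level k) * Num.max 0 (Num.min (u - level k) (level k.+1 - u)).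

Definition cutoff (k : nat) (u : R) : R := oriented_integral (level k) u (tent k).

Definition ramp (u : R) : R :=
  Num.max 0 (Num.min 1 ((level 2 - u) / (level 2 - level 1))).

Definition low_cutoff (u : R) : R := oriented_integral 0 u ramp.

Lemma level_gap k : 0 < level k.+1 - level k.
Proof. by rewrite subr_gt0 level_lt. Qed.

Lemma tent_lipschitz k x y :
  `|tent k x - tent k y| <= 2 / (level k.+1 - level k) * `|x - y|.
Proof.
rewrite /tent -mulrBr normrM ger0_norm ?divr_ge0 ?(ltW (level_gap k))//.
rewrite ler_wpM2l ?divr_ge0 ?(ltW (level_gap k))//.
rewrite (le_trans (lipschitz_max0 _ _))//; apply: lipschitz_min.
  by rewrite opprB addrA subrK.
by rewrite opprB addrC addrA subrK distrC.
Qed.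

Lemma ramp_lipschitz x y : `|ramp x - ramp y| <= (level 2 - level 1)^-1 * `|x - y|.
Proof.
have g := level_gap 1.
rewrite /ramp (le_trans (lipschitz_max0 _ _))//; apply: lipschitz_min.
  by rewrite subrr normr0 mulr_ge0// invr_ge0 ltW.
rewrite -mulrBl normrM [(_ - x) - _]addrC opprB addrA subrK distrC mulrC.
by rewrite (ger0_norm (_ : 0 <= (_ - _)^-1))// invr_ge0 ltW.
Qed.

Lemma tent_ge0 k u : 0 <= tent k u.
Proof. by rewrite mulr_ge0 ?divr_ge0 ?(ltW (level_gap k))// le_max lexx. Qed.

Lemma tent_le1 k u : tent k u <= 1.
Proof.
rewrite /tent mulrAC ler_pdivrMr ?level_gap// mul1r.
have := level_gap k; move: (level k) (level k.+1) => x y xy.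
by case: (leP (u - x) (y - u)) => h; [case: (leP 0 (u - x))|case: (leP 0 (y - u))] => h'; lra.
Qed.

Lemma tent_low k u : u <= level k -> tent k u = 0.
Proof.
move=> uk; rewrite /tent (max_idPl _) ?mulr0//.
by rewrite ge_min subr_le0 uk.
Qed.

Lemma tent_high k u : level k.+1 <= u -> tent k u = 0.
Proof.
move=> uk; rewrite /tent (max_idPl _) ?mulr0//.
by rewrite ge_min !subr_le0 uk orbT.
Qed.

Lemma ramp_ge0 u : 0 <= ramp u.
Proof. by rewrite le_max lexx. Qed.

Lemma ramp_le1 u : ramp u <= 1.
Proof. by rewrite ge_max ler01 ge_min lexx. Qed.

Lemma ramp_low u : u <= level 1 -> ramp u = 1.
Proof.
move=> u1; rewrite /ramp (min_idPl _) ?(max_idPr ler01)//.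
by rewrite ler_pdivlMr ?level_gap// mul1r; lra.
Qed.

Lemma ramp_high u : level 2 <= u -> ramp u = 0.
Proof.
move=> u1; rewrite /ramp (max_idPl _)//.
by rewrite ge_min pmulr_lle0 ?invr_gt0 ?level_gap// subr_le0 u1 orbT.
Qed.

Lemma poly_approximable_tent k : poly_approximable (tent k).
Proof.
apply: poly_approximableZ; apply: poly_approximable_max.
  rewrite (_ : (fun=> 0) = (fun x : R => 0 * x + 0)); first exact: poly_approximable_affine.
  by apply/funext => x; rewrite mul0r addr0.
apply: poly_approximable_min.
  rewrite (_ : (fun u => _) = (fun x : R => 1 * x + - level k)); first exact: poly_approximable_affine.
  by apply/funext => x; rewrite mul1r.
rewrite (_ : (fun u => _) = (fun x : R => -1 * x + level k.+1)); first exact: poly_approximable_affine.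
by apply/funext => x; rewrite mulN1r addrC.
Qed.

Lemma poly_approximable_ramp : poly_approximable ramp.
Proof.
have aff (k c : R) f : f =1 (fun x : R => k * x + c) -> poly_approximable f.
  by move=> /funext ->; exact: poly_approximable_affine.
apply: poly_approximable_max; first by apply: (aff 0 0) => x; lra.
apply: poly_approximable_min; first by apply: (aff 0 1) => x; lra.
apply: (aff (- (level 2 - level 1)^-1) (level 2 / (level 2 - level 1))) => x.
by rewrite mulrBl mulNr addrC mulrC.
Qed.

Lemma cutoffD k : has_derivative (cutoff k) (tent k).
Proof. exact/is_derive_oriented_integral/lipschitz_continuous/tent_lipschitz. Qed.

Lemma low_cutoffD : has_derivative low_cutoff ramp.
Proof. exact/is_derive_oriented_integral/lipschitz_continuous/ramp_lipschitz. Qed.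

Lemma cutoff_low k u : u <= level k -> cutoff k u = 0.
Proof.
move=> uk; have <- : cutoff k (level k) = 0 by exact: oriented_integralxx.
apply/esym/(constant_primitive (@cutoffD k) uk) => z /andP[_ /ltW].
exact: tent_low.
Qed.

Lemma cutoff_high k u : level k.+1 <= u -> cutoff k u = cutoff k (level k.+1).
Proof.
move=> uk; apply: (constant_primitive (@cutoffD k) uk) => z /andP[/ltW + _].
exact: tent_high.
Qed.

Lemma cutoff_ge0 k u : 0 <= cutoff k u.
Proof.
have [uk|/ltW uk] := leP u (level k); first by rewrite cutoff_low.
rewrite -(cutoff_low (lexx (level k))).
exact: nondecreasing_primitive (@cutoffD k) (tent_ge0 k) _ _ uk.
Qed.

Lemma cutoff_le k u : cutoff k u <= cutoff k (level k.+1).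
Proof.
have [uk|/ltW uk] := leP u (level k.+1); last by rewrite (cutoff_high uk).
exact: nondecreasing_primitive (@cutoffD k) (tent_ge0 k) _ _ uk.
Qed.

(** The slope is at least one half on the middle half of the interval. *)
Lemma cutoff_height k : (level k.+1 - level k) / 4 <= cutoff k (level k.+1).
Proof.
set l := level k; set r := level k.+1; have lr : 0 < r - l := level_gap k.
pose x := l + (r - l) / 4; pose y := r - (r - l) / 4.
have xy : x < y by rewrite /x /y; lra.
have [c /andP[xc cy] e] := mean_value (@cutoffD k) xy.
have c2 : 2^-1 <= tent k c.
  rewrite /tent -/l -/r mulrAC ler_pdivlMr//.
  rewrite /x /y in xc cy *; case: (leP (c - l) (r - c)) => h.
    by case: (leP 0 (c - l)) => h'; lra.
  by case: (leP 0 (r - c)) => h'; lra.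
have := cutoff_le k y; rewrite -/r; have := cutoff_ge0 k x.
rewrite (_ : y - x = (r - l) / 2) in e; last by rewrite /x /y; lra.
by nra.
Qed.

Lemma low_cutoff_low u : 0 <= u -> u <= level 1 -> low_cutoff u = u.
Proof.
move=> u0 u1; have h0 : low_cutoff 0 = 0 by exact: oriented_integralxx.
move: u0; rewrite le_eqVlt => /predU1P[<-//|u0].
have [c /andP[_ cu]] := mean_value low_cutoffD u0.
by rewrite ramp_low ?(le_trans (ltW cu))// h0 !subr0 mul1r.
Qed.

Lemma low_cutoff_ge0 u : 0 <= u -> 0 <= low_cutoff u.
Proof.
move=> u0; have <- : low_cutoff 0 = 0 by exact: oriented_integralxx.
exact: nondecreasing_primitive low_cutoffD ramp_ge0 _ _ u0.
Qed.

Lemma low_cutoff_le u : 0 <= u -> low_cutoff u <= u.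
Proof.
have h0 : low_cutoff 0 = 0 by exact: oriented_integralxx.
rewrite le_eqVlt => /predU1P[<-|u0]; first by rewrite h0.
have [c _] := mean_value low_cutoffD u0.
by rewrite h0 !subr0 => ->; rewrite ler_piMl ?ramp_le1 ?ltW.
Qed.

(** The least value of psi'' on the support of the tent. *)
Definition weight k : R := psi2 (level k.+1).

(** The supports of the tents are consecutive, so at most one of them contributes
    at a given point. *)
Lemma tent_sum_le N u :
  \sum_(k < N) weight k * tent k u <= psi2 u /\
  (level N <= u -> \sum_(k < N) weight k * tent k u = 0).
Proof.
elim: N => [|N [IH IHN]].
  by rewrite !big_ord0; split; first exact: psi2_ge0.
rewrite !big_ord_recr /=; move: (\sum_(k < N) _) IH IHN => S IH IHN; split.
- have [uN|/ltW Nu] := leP u (level N); first by rewrite (tent_low uN) mulr0 addr0; exact: IH.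
  rewrite (IHN Nu) add0r; have [uN1|/ltW Nu1] := leP u (level N.+1).
    apply: (@le_trans _ _ (weight N)); first exact: ler_piMr (psi2_ge0 _) (tent_le1 _ _).
    exact: psi2_nonincreasing.
  by rewrite (tent_high Nu1) mulr0; exact: psi2_ge0.
- move=> Nu; rewrite (tent_high Nu) mulr0 addr0; apply: IHN.
  exact: le_trans (ltW (level_lt N)) Nu.
Qed.

Lemma ramp_weight_le u : psi2 (level 2) * ramp u <= psi2 u.
Proof.
have [u2|/ltW u2] := leP u (level 2); last by rewrite (ramp_high u2) mulr0; exact: psi2_ge0.
apply: (@le_trans _ _ (psi2 (level 2))); first exact: ler_piMr (psi2_ge0 _) (ramp_le1 _).
exact: psi2_nonincreasing.
Qed.

End levels.
End eta_psi_facts.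

(** * The generator and the carre du champ on the algebra *)

Section setup.
Context d (T : measurableType d) (R : realType) (mu : probability T R).
Variables (P Pd : R -> (T -> R) -> T -> R) (A : set (T -> R)).
Hypothesis sg : markov_semigroup mu P.
Hypothesis Pcont : strongly_continuous mu P.
Hypothesis Abd : forall f, A f -> exists M : R, forall x, `|f x| <= M.
Hypothesis adj : adjoint_semigroup mu P Pd.
Hypothesis car : carre_du_champ_algebra mu P Pd A.
Implicit Types (f g h : T -> R) (t s : R).
Local Notation rint := (rint mu).
Local Notation intble := (intble mu).
Local Notation sqintble := (sqintble mu).
Local Notation nrm := (nrm mu).
Local Notation ip := (ip mu).
Local Notation L := (generator mu P).
Local Notation Ld := (generator mu Pd).
Local Notation Gam := (core_carre mu P).

Lemma sg_bound t f (M : R) x : 0 <= t -> bounded_measurable f ->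
  (forall y, `|f y| <= M) -> `|P t f x| <= M.
Proof.
move=> t0 bf fM; have bM := bounded_measurable_cst T M.
rewrite ler_norml; apply/andP; split.
  have := sg_ge0 sg x t0 (f := fun y => 1 * f y + cst M y).
  rewrite (sg_linear sg)// mul1r (sg_cst sg)// -lerBlDr sub0r; apply => [|y].
    by apply: bounded_measurableD => //; exact: bounded_measurableZ.
  by rewrite mul1r /= -lerBlDr sub0r; move: (fM y); rewrite ler_norml => /andP[].
have := sg_ge0 sg x t0 (f := fun y => -1 * f y + cst M y).
rewrite (sg_linear sg)// mulN1r (sg_cst sg)// addrC subr_ge0; apply => [|y].
  by apply: bounded_measurableD => //; exact: bounded_measurableZ.
by rewrite mulN1r addrC subr_ge0; move: (fM y); rewrite ler_norml => /andP[].
Qed.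

Lemma sg_bounded t f : 0 <= t -> bounded_measurable f -> bounded_measurable (P t f).
Proof.
move=> t0 bf; split; first exact: (sg_measurable sg).
by have [_ [M fM]] := bf; exists M => x; exact: sg_bound.
Qed.

Lemma sg_D t f g x : 0 <= t -> bounded_measurable f -> bounded_measurable g ->
  P t (fun y => f y + g y) x = P t f x + P t g x.
Proof.
move=> t0 bf bg; have := sg_linear sg 1 x t0 bf bg; rewrite mul1r => <-.
by congr (P t _ x); apply/funext => y; rewrite mul1r.
Qed.

Lemma sg_Z t (k : R) f x : 0 <= t -> bounded_measurable f ->
  P t (fun y => k * f y) x = k * P t f x.
Proof.
move=> t0 bf; have := sg_linear sg k x t0 bf (bounded_measurable_cst T 0).
rewrite (sg_cst sg)// addr0 => <-.
by congr (P t _ x); apply/funext => y; rewrite addr0.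
Qed.

Lemma sg_B t f g x : 0 <= t -> bounded_measurable f -> bounded_measurable g ->
  P t (fun y => f y - g y) x = P t f x - P t g x.
Proof.
move=> t0 bf bg; rewrite -mulN1r -sg_Z// -sg_D//; last exact: bounded_measurableZ.
by congr (P t _ x); apply/funext => y; rewrite mulN1r.
Qed.

(** Jensen's inequality for the kernel, by expanding the square. *)
Lemma sg_sqr_le t f x : 0 <= t -> bounded_measurable f ->
  P t f x ^+ 2 <= P t (fun y => f y ^+ 2) x.
Proof.
move=> t0 bf; set m := P t f x.
have bf2 := bounded_measurableM bf bf.
have := sg_ge0 sg x t0 (f := fun y => -2 * m * f y + (f y * f y + cst (m ^+ 2) y)).
have bm := bounded_measurable_cst T (m ^+ 2).
rewrite (sg_linear sg)//; last exact: bounded_measurableD.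
rewrite sg_D// (sg_cst sg)// -/m => H.
have -> : P t (fun y => f y ^+ 2) x = P t (fun y => f y * f y) x by [].
rewrite -subr_ge0; have := H _ _.
have -> : -2 * m * m + (P t (fun y => f y * f y) x + m ^+ 2) =
  P t (fun y => f y * f y) x - m ^+ 2 by ring.
apply => [|y].
  by apply: bounded_measurableD; [exact: bounded_measurableZ|exact: bounded_measurableD].
have -> : -2 * m * f y + (f y * f y + cst (m ^+ 2) y) = (f y - m) ^+ 2 by rewrite /=; ring.
exact: sqr_ge0.
Qed.

Lemma sg_contraction t f : 0 <= t -> bounded_measurable f -> nrm (P t f) <= nrm f.
Proof.
move=> t0 bf; rewrite nrm_le ?nrm_ge0// nrm2.
have bf2 := bounded_measurableM bf bf; have bP := sg_bounded t0 bf.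
rewrite /ip -(sg_invariant sg t0 bf2); apply: le_rint.
- exact/bounded_intble/bounded_measurableM.
- exact/bounded_intble/sg_bounded.
- by move=> x; rewrite -expr2; exact: sg_sqr_le.
Qed.

Lemma sg_continuous f : bounded_measurable f -> forall e : R, 0 < e ->
  exists2 r : R, 0 < r & forall t, 0 <= t -> t <= r ->
    nrm (fun x => P t f x - f x) <= e.
Proof.
move=> bf e e0; have sf := bounded_sqintble mu bf.
have /sqintbleP/Pcont := sf; rewrite lp_cvg2_rightP//; last first.
  by move=> t t0; apply: bounded_sqintble; apply: sg_bounded => //; exact: ltW.
move=> /(_ e e0)[r r0 rP]; exists r => // t; rewrite le_eqVlt => /predU1P[<- _|].
  have -> : (fun x => P 0 f x - f x) = cst 0.
    by apply/funext => x; rewrite (sg_0 sg)// subrr.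
  by rewrite nrm_cst normr0 ltW.
exact: rP.
Qed.

Lemma algebra_bounded f : A f -> bounded_measurable f.
Proof.
move=> Af; split; last exact: Abd.
have [g [/sqintbleP[]//]] := (carre_core car).1 _ Af.
Qed.

Lemma generator_cvg f g : bounded_measurable f -> is_generator mu P f g ->
  forall e : R, 0 < e -> exists2 r : R, 0 < r & forall t, 0 < t -> t <= r ->
    nrm (fun x => (P t f x - f x) / t - g x) <= e.
Proof.
move=> bf [_ /sqintbleP sg']; rewrite lp_cvg2_rightP// => t t0.
apply: bounded_sqintble; apply: bounded_measurableM; last exact: bounded_measurable_cst.
by apply: bounded_measurableB => //; apply: sg_bounded => //; exact: ltW.
Qed.

Lemma generatorP f : generator_dom mu P f -> is_generator mu P f (L f).
Proof. by move=> [g fg]; exact: (xgetPex (cst 0) (ex_intro _ g fg)). Qed.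

Lemma generator_sqintble f : generator_dom mu P f -> sqintble (L f).
Proof. by move=> /generatorP[_ /sqintbleP]. Qed.

Lemma small_nrm_ae0 f : sqintble f -> (forall e : R, 0 < e -> nrm f <= e) ->
  {ae mu, forall x, f x = 0}.
Proof.
move=> sf H; have n0 : nrm f = 0.
  by apply/eqP; rewrite eq_le nrm_ge0 andbT; apply/ler_addgt0Pl => e e0; rewrite addr0 H.
have I0 : rint (fun x => `|f x|) = 0.
  apply/eqP; rewrite eq_le rint_ge0// andbT -n0; exact: le_rint_abs_nrm.
have If := sqintble_intble sf.
have : (\int[mu]_x `|(f x)%:E| = 0)%E by have := rintE (intble_abs If); rewrite I0.
move=> /(ae_eq_integral_abs mu measurableT (integrableP _ _ _ If).1).1.
by apply: filterS => x /= /(_ I) [].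
Qed.

Lemma eq_of_norm_le (a b : R) : (forall e : R, 0 < e -> `|a - b| <= e) -> a = b.
Proof.
move=> H; apply/eqP; rewrite -subr_eq0 -normr_le0; apply/ler_addgt0Pl => e e0.
by rewrite addr0 H.
Qed.

Lemma generator_unique f g g' : bounded_measurable f ->
  is_generator mu P f g -> is_generator mu P f g' -> {ae mu, forall x, g x = g' x}.
Proof.
move=> bf fg fg'; have [_ /sqintbleP s1 _] := fg; have [_ /sqintbleP s2 _] := fg'.
have H e : 0 < e -> nrm (fun x => g x - g' x) <= e.
  move=> e0; have e20 : 0 < e / 2 by rewrite divr_gt0.
  have [r r0 rP] := generator_cvg bf fg e20.
  have [q q0 qP] := generator_cvg bf fg' e20.
  pose t := Num.min r q; have t0 : 0 < t by rewrite lt_min r0.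
  have tr : t <= r by rewrite ge_min lexx.
  have tq : t <= q by rewrite ge_min lexx orbT.
  have sq : sqintble (fun x => (P t f x - f x) / t).
    apply: bounded_sqintble; apply: bounded_measurableM; last exact: bounded_measurable_cst.
    by apply: bounded_measurableB => //; apply: sg_bounded => //; exact: ltW.
  rewrite (le_trans (nrm_triangle s1 sq s2))// (splitr e) lerD//; last exact: qP.
  by rewrite nrmB rP.
by have := small_nrm_ae0 (sqintbleB s1 s2) H; apply: filterS => x /= /subr0_eq.
Qed.

Lemma generator_linear (k : R) f g f' g' : bounded_measurable f -> bounded_measurable g ->
  is_generator mu P f f' -> is_generator mu P g g' ->
  is_generator mu P (fun x => k * f x + g x) (fun x => k * f' x + g' x).
Proof.
move=> bf bg Hf Hg; have [_ /sqintbleP s1 _] := Hf; have [_ /sqintbleP s2 _] := Hg.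
have bfg : bounded_measurable (fun x => k * f x + g x).
  by apply: bounded_measurableD => //; exact: bounded_measurableZ.
have s12 : sqintble (fun x => k * f' x + g' x).
  by apply: sqintbleD => //; exact: sqintbleZ.
have sq t h : 0 < t -> bounded_measurable h -> sqintble (fun x => (P t h x - h x) / t).
  move=> t0 bh; apply: bounded_sqintble; apply: bounded_measurableM; last exact: bounded_measurable_cst.
  by apply: bounded_measurableB => //; apply: sg_bounded => //; exact: ltW.
split; [exact/sqintbleP/bounded_sqintble|exact/sqintbleP|].
rewrite lp_cvg2_rightP//; last by move=> t t0; exact: sq.
move=> e e0; have K0 : 0 < `|k| + 1 by rewrite ltr_wpDl.
have e20 : 0 < e / 2 / (`|k| + 1) by rewrite !divr_gt0.
have e21 : 0 < e / 2 by rewrite divr_gt0.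
have [r r0 rP] := generator_cvg bf Hf e20.
have [q q0 qP] := generator_cvg bg Hg e21.
exists (Num.min r q); first by rewrite lt_min r0.
move=> t t0; rewrite le_min => /andP[tr tq].
have -> : (fun x => (P t (fun x => k * f x + g x) x - (k * f x + g x)) / t - (k * f' x + g' x)) =
  (fun x => k * ((P t f x - f x) / t - f' x) + ((P t g x - g x) / t - g' x)).
  apply/funext => x; rewrite (sg_linear sg) ?ltW//; field; exact: lt0r_neq0.
have sf := sqintbleB (sq _ _ t0 bf) s1; have sg' := sqintbleB (sq _ _ t0 bg) s2.
rewrite (le_trans (nrmD (sqintbleZ k sf) sg'))// (splitr e) lerD//; last exact: qP.
rewrite nrmZ// (le_trans (ler_wpM2l (normr_ge0 k) (rP t t0 tr)))//.
by rewrite mulrA ler_pdivrMr// mulrC ler_wpM2l ?(ltW e21)// lerDl.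
Qed.

Lemma algebra_generator f : A f -> is_generator mu P f (L f).
Proof. by move=> Af; apply: generatorP; exact: (carre_core car).1. Qed.

Lemma L_sqintble f : A f -> sqintble (L f).
Proof. by move=> /algebra_generator[_ /sqintbleP]. Qed.

Lemma algebra_sqintble f : A f -> sqintble f.
Proof. by move=> Af; exact/bounded_sqintble/algebra_bounded. Qed.

Lemma algebra_cst (c : R) : A (cst c).
Proof. by have [H _ _] := carre_algebra car. Qed.

Lemma algebraD f g : A f -> A g -> A (fun x => f x + g x).
Proof. by have [_ H _] := carre_algebra car; exact: H. Qed.

Lemma algebraM f g : A f -> A g -> A (fun x => f x * g x).
Proof. by have [_ _ H] := carre_algebra car; exact: H. Qed.

Lemma algebraZ (k : R) f : A f -> A (fun x => k * f x).
Proof. by move=> Af; apply: (algebraM (algebra_cst k)). Qed.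

Lemma algebraB f g : A f -> A g -> A (fun x => f x - g x).
Proof.
move=> Af Ag; have := algebraD Af (algebraZ (-1) Ag).
by congr A; apply/funext => x; rewrite mulN1r.
Qed.

Lemma algebra_lin (k : R) f g : A f -> A g -> A (fun x => k * f x + g x).
Proof. by move=> Af Ag; apply: algebraD => //; exact: algebraZ. Qed.

Lemma algebra_horner (p : {poly R}) f : A f -> A (fun x => p.[f x]).
Proof.
move=> Af; elim/poly_ind: p => [|p c IH].
  by under eq_fun do rewrite horner0; exact: algebra_cst.
under eq_fun do rewrite hornerMXaddC.
by apply: (algebraD _ (algebra_cst c)); exact: algebraM.
Qed.

Lemma L_linear (k : R) f g : A f -> A g ->
  {ae mu, forall x, L (fun x => k * f x + g x) x = k * L f x + L g x}.
Proof.
move=> Af Ag; have Afg := algebra_lin k Af Ag.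
apply: (generator_unique (algebra_bounded Afg) (algebra_generator Afg)).
apply: generator_linear; [exact: algebra_bounded..|exact: algebra_generator|].
exact: algebra_generator.
Qed.

Lemma weak_generator f f' g : bounded_measurable f -> is_generator mu P f f' ->
  sqintble g -> forall e : R, 0 < e -> exists2 r : R, 0 < r & forall t, 0 < t -> t <= r ->
    `|ip g (fun x => (P t f x - f x) / t) - ip g f'| <= e.
Proof.
move=> bf Hf sg' e e0; have [_ /sqintbleP s1 _] := Hf.
have K0 : 0 < nrm g + 1 by rewrite ltr_wpDl// nrm_ge0.
have [r r0 rP] := generator_cvg bf Hf (divr_gt0 e0 K0).
exists r => // t t0 tr.
have sq : sqintble (fun x => (P t f x - f x) / t).
  apply: bounded_sqintble; apply: bounded_measurableM; last exact: bounded_measurable_cst.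
  by apply: bounded_measurableB => //; apply: sg_bounded => //; exact: ltW.
rewrite -ipBr// (le_trans (cauchy_schwarz sg' (sqintbleB sq s1)))//.
rewrite (le_trans (ler_wpM2l (nrm_ge0 _ _) (rP t t0 tr)))//.
by rewrite mulrA ler_pdivrMr// mulrC ler_wpM2l ?(ltW e0)// lerDl.
Qed.

Lemma rint_L f : A f -> rint (L f) = 0.
Proof.
move=> Af; have bf := algebra_bounded Af.
apply: eq_of_norm_le => e e0; rewrite subr0.
have s1 := bounded_sqintble mu (bounded_measurable_cst T 1).
have [r r0 rP] := weak_generator bf (algebra_generator Af) s1 e0.
have := rP r r0 (lexx r).
have bP := sg_bounded (ltW r0) bf.
have -> : ip (cst 1) (fun x => (P r f x - f x) / r) = 0.
  transitivity (rint (fun x => r^-1 * (P r f x - f x))).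
    by congr rint; apply/funext => x; rewrite /= mul1r mulrC.
  rewrite rintZ; last exact/bounded_intble/bounded_measurableB.
  by rewrite rintB ?(sg_invariant sg) ?subrr ?mulr0 ?ltW//; exact: bounded_intble.
rewrite sub0r normrN; congr (`|rint _| <= _).
by apply/funext => x; rewrite /= mul1r.
Qed.

(** Up to the factor 1 / t, the transition kernels have nonnegative variances,
    and these converge weakly to the carre du champ. *)
Lemma Gam_ge0 f : A f -> {ae mu, forall x, 0 <= Gam f f x}.
Proof.
move=> Af; have bf := algebra_bounded Af; have Aff := algebraM Af Af.
have bff := algebra_bounded Aff.
have sL := L_sqintble Af; have sLL := L_sqintble Aff.
have IfL : intble (fun x => f x * L f x).
  by apply: intble_bounded_mul => //; exact: sqintble_intble.
have IG : intble (Gam f f).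
  by apply: intbleB => //; apply: intbleB => //; exact: sqintble_intble.
apply: ae_ge0_of_rint => // B mB.
apply/ler_addgt0Pl => e e0; rewrite addrC.
have bB := bounded_measurable_indic R mB.
have bBf := bounded_measurableM bB bf.
have e30 : 0 < e / 3 by rewrite divr_gt0.
have [r r0 rP] := weak_generator bff (algebra_generator Aff) (bounded_sqintble mu bB) e30.
have [q q0 qP] := weak_generator bf (algebra_generator Af) (bounded_sqintble mu bBf) e30.
pose t := Num.min r q; have t0 : 0 < t by rewrite lt_min r0.
have tr : t <= r by rewrite ge_min lexx.
have tq : t <= q by rewrite ge_min lexx orbT.
have := rP t t0 tr; have := qP t t0 tq.
set a := ip _ (L f); set b := ip _ (fun x => (P t f x - f x) / t).
set a' := ip _ (L _); set b' := ip _ _.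
have -> : rint (fun x => \1_B x * Gam f f x) = a' - 2 * a.
  rewrite /a' /a /ip -rintZ; last first.
    apply: intble_mul => //; exact: bounded_sqintble.
  rewrite -rintB; first last.
  - apply: intbleZ; apply: intble_mul => //; exact: bounded_sqintble.
  - apply: intble_mul => //; exact: bounded_sqintble.
  by congr rint; apply/funext => x; rewrite /core_carre; ring.
have bb : 0 <= b' - 2 * b.
  have bq h : bounded_measurable h -> bounded_measurable (fun x => (P t h x - h x) / t).
    move=> bh; apply: bounded_measurableM; last exact: bounded_measurable_cst.
    by apply: bounded_measurableB => //; apply: sg_bounded => //; exact: ltW.
  rewrite /b' /b /ip -rintZ; last by apply/bounded_intble/bounded_measurableM => //; exact: bq.
  rewrite -rintB; first last.
  - by apply/intbleZ/bounded_intble/bounded_measurableM => //; exact: bq.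
  - by apply/bounded_intble/bounded_measurableM => //; exact: bq.
  apply: rint_ge0 => x /=.
  have := sg_sqr_le x (ltW t0) bf.
  have -> : (fun y => f y ^+ 2) = f \* f by apply/funext => y; rewrite expr2.
  move=> J; rewrite (_ : _ - _ = \1_B x * ((P t (f \* f) x - P t f x ^+ 2 + (P t f x - f x) ^+ 2) / t)).
    apply: mulr_ge0; first by rewrite indicE; case: (x \in B).
    by rewrite divr_ge0 ?(ltW t0)// addr_ge0 ?sqr_ge0// subr_ge0.
  by rewrite /=; ring.
move=> /ler_normlP[h1 h2] /ler_normlP[h3 h4].
by clearbody a b a' b'; clear - h1 h2 h3 h4 bb; lra.
Qed.

Lemma Gam_intble f g : A f -> A g -> intble (Gam f g).
Proof.
move=> Af Ag; have sL u : A u -> intble (L u) by move=> Au; exact/sqintble_intble/L_sqintble.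
apply: intbleB; last by apply: intble_bounded_mul; [exact: algebra_bounded|exact: sL].
apply: intbleB; first by apply: sL; exact: algebraM.
by apply: intble_bounded_mul; [exact: algebra_bounded|exact: sL].
Qed.

Lemma Gam_sym f g : Gam f g = Gam g f.
Proof.
apply/funext => x; rewrite /core_carre.
have -> : f \* g = g \* f by apply/funext => y /=; rewrite mulrC.
ring.
Qed.

Lemma Gam_linear (k : R) f g h : A f -> A g -> A h ->
  {ae mu, forall x, Gam (fun y => k * f y + g y) h x = k * Gam f h x + Gam g h x}.
Proof.
move=> Af Ag Ah; have H1 := L_linear k Af Ag.
have H2 := L_linear k (algebraM Af Ah) (algebraM Ag Ah).
apply: filterS2 H1 H2 => x e1 e2; rewrite /core_carre.
have -> : (fun y => k * f y + g y) \* h = (fun y => k * (f y * h y) + g y * h y).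
  by apply/funext => y /=; ring.
rewrite e1 e2; ring.
Qed.

(** Since the integral of [L (f ^+ 2)] vanishes, the energy is a quadratic form
    of the generator. *)
Definition en f : R := rint (Gam f f).

Lemma enE f : A f -> en f = -2 * ip f (L f).
Proof.
move=> Af; have sL := L_sqintble Af.
have If : intble (fun x => f x * L f x).
  by apply: intble_mul => //; exact: algebra_sqintble.
have -> : en f = rint (fun x => L (fun x => f x * f x) x + -2 * (f x * L f x)).
  by congr rint; apply/funext => x; rewrite /core_carre /=; ring.
rewrite rintD; [|exact/sqintble_intble/L_sqintble/algebraM|exact: intbleZ].
by rewrite rint_L ?add0r ?rintZ//; exact: algebraM.
Qed.

Lemma en_ge0 f : A f -> 0 <= en f.
Proof.
move=> Af; rewrite -(rint_cst mu 0); apply: ae_le_rint; first exact: intble_cst.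
  exact: Gam_intble.
exact: Gam_ge0.
Qed.

Lemma en_lin (k : R) f g : A f -> A g ->
  en (fun x => k * f x + g x) = k ^+ 2 * en f - 2 * k * (ip f (L g) + ip g (L f)) + en g.
Proof.
move=> Af Ag; have Afg := algebra_lin k Af Ag.
have [sf sg'] := (algebra_sqintble Af, algebra_sqintble Ag).
have [sLf sLg] := (L_sqintble Af, L_sqintble Ag).
rewrite !enE//.
have -> : ip (fun x => k * f x + g x) (L (fun x => k * f x + g x)) =
    ip (fun x => k * L f x + L g x) (fun x => k * f x + g x).
  rewrite ipC; apply: eq_ae_ip; [exact: L_sqintble|..|exact: L_linear].
    by apply: sqintbleD => //; exact: sqintbleZ.
  exact: algebra_sqintble.
have sk h : sqintble h -> sqintble (fun x => k * h x) by exact: sqintbleZ.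
have skf := sk _ sf; have skLf := sk _ sLf.
rewrite ipDl//; last exact: algebra_sqintble.
rewrite !ipDr// ipZl// ipZr// ipZl// ipZr// !(ipC _ (L _)).
move: (ip _ _) (ip _ _) (ip _ _) (ip _ _) => x1 x2 x3 x4; ring.
Qed.

Lemma enB f g : A f -> A g ->
  en (fun x => f x - g x) = en f + 2 * (ip f (L g) + ip g (L f)) + en g.
Proof.
move=> Af Ag; have -> : (fun x => f x - g x) = (fun x => -1 * g x + f x).
  by apply/funext => x; ring.
rewrite (en_lin (-1) Ag Af).
move: (ip f (L g)) (ip g (L f)) (en f) (en g) => x1 x2 x3 x4; ring.
Qed.

Lemma enZ (k : R) f : A f -> en (fun x => k * f x) = k ^+ 2 * en f.
Proof.
move=> Af; have A0 := algebra_cst 0.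
have ae0 : {ae mu, forall x, L (cst 0) x = 0}.
  have := L_linear (-1) A0 A0.
  have -> : (fun x => -1 * cst 0 x + cst 0 x) = (cst 0 : T -> R).
    by apply/funext => x /=; rewrite mulr0 addr0.
  by apply: filterS => x ->; ring.
have e0 : en (cst 0) = 0 by rewrite enE// ip0l mulr0.
have -> : (fun x => k * f x) = (fun x => k * f x + cst 0 x).
  by apply/funext => x /=; rewrite addr0.
rewrite (en_lin k Af A0) e0 ip0l !addr0.
have -> : ip f (L (cst 0)) = 0.
  transitivity (ip (cst 0) f); last exact: ip0l.
  by rewrite ipC; apply: eq_ae_ip => //; [exact: L_sqintble|
    exact: algebra_sqintble|exact: algebra_sqintble].
by rewrite mulr0 subr0.
Qed.

(** The quadratic form of the generator satisfies the parallelogram identity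
    although the generator need not be symmetric. *)
Lemma en_parallelogram f g : A f -> A g ->
  en (fun x => f x - g x) = 2 * en f + 2 * en g - 4 * en (fun x => 2^-1 * (f x + g x)).
Proof.
move=> Af Ag; rewrite enB// enZ; last exact: algebraD.
have -> : (fun x => f x + g x) = (fun x => 1 * f x + g x).
  by apply/funext => x; ring.
rewrite (en_lin 1 Af Ag).
move: (ip f (L g)) (ip g (L f)) (en f) (en g) => x1 x2 x3 x4; by field.
Qed.


(** * Duality with the adjoint semigroup *)

(** Duality with indicators reduces this to the same bound for the semigroup. *)
Lemma adjoint_le t h (M : R) : 0 <= t -> intble h -> h \in Lfun mu 1%E ->
  {ae mu, forall x, h x <= M} -> {ae mu, forall x, Pd t h x <= M}.
Proof.
move=> t0 Ih hL1 hM; have [/Lfun1_integrable PI dual] := adj t0 hL1.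
have IB : intble (fun x => M - Pd t h x) by apply: intbleB => //; exact: intble_cst.
suff : {ae mu, forall x, 0 <= M - Pd t h x}.
  by apply: filterS => x; rewrite subr_ge0.
apply: ae_ge0_of_rint => // B mB.
have bB := bounded_measurable_indic R mB; have bPB := sg_bounded t0 bB.
have -> : rint (fun x => \1_B x * (M - Pd t h x)) = rint (fun x => P t \1_B x * (M - h x)).
  have -> : (fun x => \1_B x * (M - Pd t h x)) =
      (fun x => M * \1_B x - \1_B x * Pd t h x) by apply/funext => x; ring.
  have -> : (fun x => P t \1_B x * (M - h x)) =
      (fun x => M * P t \1_B x - P t \1_B x * h x) by apply/funext => x; ring.
  rewrite rintB; [|exact/intbleZ/bounded_intble|exact: intble_bounded_mul].
  rewrite rintB; [|exact/intbleZ/bounded_intble|exact: intble_bounded_mul].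
  rewrite !rintZ; [|exact: bounded_intble..].
  rewrite (sg_invariant sg)//; congr (_ - _).
  by apply: dual; [have [] := bB|have [_] := bB].
rewrite -[leLHS](rint_cst mu); apply: ae_le_rint; first exact: intble_cst.
  by apply: intble_bounded_mul => //; apply: intbleB => //; exact: intble_cst.
apply: filterS hM => x hx /=; rewrite mulr_ge0 ?subr_ge0//.
by apply: (sg_ge0 sg) => // y; rewrite indicE; case: (y \in B).
Qed.

Lemma intble_Lfun h : intble h -> h \in Lfun mu 1%E.
Proof. by move=> Ih; exact/Lfun1_integrable. Qed.

Lemma adjoint_dual t h f : 0 <= t -> intble h -> bounded_measurable f ->
  rint (fun x => f x * Pd t h x) = rint (fun x => P t f x * h x).
Proof. by move=> t0 /intble_Lfun h1 [mf bf]; have [_] := adj t0 h1; exact. Qed.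

Lemma adjoint_intble t h : 0 <= t -> intble h -> intble (Pd t h).
Proof. by move=> t0 /intble_Lfun h1; have [/Lfun1_integrable] := adj t0 h1. Qed.

Lemma adjoint_testP t h g : 0 <= t -> intble h -> intble g ->
  (forall f, bounded_measurable f -> rint (fun x => f x * g x) = rint (fun x => P t f x * h x)) ->
  {ae mu, forall x, Pd t h x = g x}.
Proof.
move=> t0 Ih Ig H; have IP := adjoint_intble t0 Ih.
have le0 u v : intble u -> intble v -> (forall f, bounded_measurable f ->
    rint (fun x => f x * u x) = rint (fun x => f x * v x)) ->
    {ae mu, forall x, 0 <= u x - v x}.
  move=> Iu Iv uv; apply: ae_ge0_of_rint; first exact: intbleB.
  move=> B mB; have bB := bounded_measurable_indic R mB.
  have -> : (fun x => \1_B x * (u x - v x)) = (fun x => \1_B x * u x - \1_B x * v x).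
    by apply/funext => x; rewrite mulrBr.
  by rewrite rintB ?uv ?subrr//; exact: intble_bounded_mul.
have H' f : bounded_measurable f ->
    rint (fun x => f x * Pd t h x) = rint (fun x => f x * g x).
  by move=> bf; rewrite adjoint_dual// H.
have H1 := le0 _ _ IP Ig H'.
have H2 := le0 _ _ Ig IP (fun f bf => esym (H' f bf)).
apply: filterS2 H1 H2 => x; rewrite !subr_ge0 => h1 h2.
by apply/eqP; rewrite eq_le h1 h2.
Qed.

Lemma adjoint_bound t h (M : R) : 0 <= t -> intble h ->
  {ae mu, forall x, `|h x| <= M} -> {ae mu, forall x, `|Pd t h x| <= M}.
Proof.
move=> t0 Ih hM; have IN := intbleN Ih.
have H1 : {ae mu, forall x, Pd t h x <= M}.
  apply: adjoint_le => //; first exact: intble_Lfun.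
  by apply: filterS hM => x /ler_normlP[].
have H2 : {ae mu, forall x, Pd t (fun y => - h y) x <= M}.
  apply: adjoint_le => //; first exact: intble_Lfun.
  by apply: filterS hM => x /ler_normlP[].
have H3 : {ae mu, forall x, Pd t (fun y => - h y) x = - Pd t h x}.
  apply: adjoint_testP => //; first exact/intbleN/adjoint_intble.
  move=> f bf; have bP := sg_bounded t0 bf.
  have N u v : (fun x => u x * - v x) = (fun x : T => - (u x * v x) : R).
    by apply/funext => x; rewrite mulrN.
  rewrite !N rintN; last exact/intble_bounded_mul/adjoint_intble.
  by rewrite rintN ?adjoint_dual//; exact: intble_bounded_mul.
apply: filterS3 H1 H2 H3 => x h1 h2 h3.
by rewrite ler_norml h1 andbT lerNl -h3.
Qed.

Lemma adjoint_sqintble t h : 0 <= t -> bounded_measurable h -> sqintble (Pd t h).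
Proof.
move=> t0 bh; have Ih := bounded_intble mu bh; have IP := adjoint_intble t0 Ih.
have mP := intble_measurable IP.
have [_ [M hM]] := bh.
have hM' : {ae mu, forall x, `|h x| <= M} by apply: nearW.
have H := adjoint_bound t0 Ih hM'.
apply: (@sqintble_ae _ _ _ _ (fun x => Num.max (- M) (Num.min (Pd t h x) M))) => //.
  by apply: filterS H => x; rewrite ler_norml => /andP[h1 h2]; rewrite min_l// max_r.
apply: bounded_sqintble; split.
  by apply: measurable_maxr => //; apply: measurable_minr.
exists M => x; have [h0 //=|M0] := leP 0 M; last first.
  by have := le_trans (normr_ge0 _) (hM x); rewrite leNgt M0.
by rewrite ler_norml le_max lexx /= ge_max ge_min lexx orbT andbT lerNl (le_trans _ h0)// oppr_le0.
Qed.

(** * Energy of limits of elements of the algebra *)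

Lemma adjoint_generator f g : A f -> A g -> ip (L f) g = ip f (Ld g).
Proof.
move=> Af Ag; have [bf bg] := (algebra_bounded Af, algebra_bounded Ag).
have [sf sg'] := (algebra_sqintble Af, algebra_sqintble Ag).
have Hf := algebra_generator Af.
have Hg : is_generator mu Pd g (Ld g).
  by have [g' gg'] := carre_adjoint_dom car Ag; exact: (xgetPex (cst 0) (ex_intro _ g' gg')).
have [_ /sqintbleP sLd cLd] := Hg.
apply: eq_of_norm_le => e e0; have e20 : 0 < e / 2 by rewrite divr_gt0.
have [r r0 rP] := weak_generator bf Hf sg' e20.
have K0 : 0 < nrm f + 1 by rewrite ltr_wpDl// nrm_ge0.
have sPd t : 0 < t -> sqintble (fun x => (Pd t g x - g x) / t).
  move=> t0; have := sqintbleZ t^-1 (sqintbleB (adjoint_sqintble (ltW t0) bg) sg').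
  by congr sqintble; apply/funext => x; rewrite mulrC.
have := cLd; rewrite lp_cvg2_rightP// => /(_ _ (divr_gt0 e20 K0))[q q0 qP].
pose t := Num.min r q; have t0 : 0 < t by rewrite lt_min r0.
have tr : t <= r by rewrite ge_min lexx.
have tq : t <= q by rewrite ge_min lexx orbT.
have E : ip g (fun x => (P t f x - f x) / t) = ip f (fun x => (Pd t g x - g x) / t).
  have bP := sg_bounded (ltW t0) bf.
  have Z u v : (fun x => u x * (v x / t)) = (fun x : T => t^-1 * (u x * v x)).
    by apply/funext => x; ring.
  rewrite /ip !Z !rintZ; first last.
  - by apply: intble_mul => //; apply: bounded_sqintble; exact: bounded_measurableB.
  - by apply: intble_mul => //; apply: sqintbleB => //; exact: adjoint_sqintble (ltW t0) bg.
  have B u v w : (fun x => u x * (v x - w x)) = (fun x : T => u x * v x - u x * w x : R).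
    by apply/funext => x; rewrite mulrBr.
  rewrite !B !rintB; first last.
  - exact: intble_mul.
  - by apply: intble_mul => //; exact: bounded_sqintble.
  - exact: intble_mul.
  - by apply: intble_mul => //; exact: adjoint_sqintble (ltW t0) bg.
  rewrite (adjoint_dual (ltW t0) (bounded_intble mu bg) bf).
  by congr (_ * (rint _ - rint _)); apply/funext => x; rewrite mulrC.
have h1 := rP t t0 tr.
have h2 : `|ip f (fun x => (Pd t g x - g x) / t) - ip f (Ld g)| <= e / 2.
  rewrite -ipBr//; last exact: sPd.
  rewrite (le_trans (cauchy_schwarz sf (sqintbleB (sPd _ t0) sLd)))//.
  rewrite (le_trans (ler_wpM2l (nrm_ge0 _ _) (qP t t0 tq)))//.
  by rewrite mulrA ler_pdivrMr// mulrC ler_wpM2l ?(ltW e20)// lerDl.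
rewrite ipC (splitr e) -(subrKA (ip g (fun x => (P t f x - f x) / t))).
apply: (le_trans (ler_normD _ _)); rewrite E in h1 *; apply: lerD; last exact: h2.
by rewrite distrC; exact: h1.
Qed.

(** The form is controlled by pairings with a fixed function along one vector;
    this is where the algebra being in the domain of the adjoint generator
    enters, and it makes the form closable. *)
Lemma en_closable (u : nat -> T -> R) : (forall n, A (u n)) ->
  (forall e : R, 0 < e -> exists N, forall n, (N <= n)%N -> nrm (u n) <= e) ->
  (forall e : R, 0 < e -> exists N, forall n m, (N <= n)%N -> (N <= m)%N ->
     en (fun x => u n x - u m x) <= e) ->
  forall e : R, 0 < e -> exists N, forall n, (N <= n)%N -> en (u n) <= e.
Proof.
move=> Au u0 Cu e e0; have e20 : 0 < e / 2 by rewrite divr_gt0.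
have [N NP] := Cu _ e20.
have sLd : sqintble (Ld (u N)).
  have [g' gg'] := carre_adjoint_dom car (Au N).
  by have [_ /sqintbleP] := xgetPex (cst 0) (ex_intro _ g' gg').
have sL := L_sqintble (Au N); have sw := sqintbleD sL sLd.
set w := (fun x => _) in sw.
have K0 : 0 < 2 * (nrm w + 1) by rewrite mulr_gt0// ltr_wpDl// nrm_ge0.
have [N' N'P] := u0 _ (divr_gt0 e20 K0).
exists (maxn N N') => n; rewrite geq_max => /andP[Nn N'n].
have su := algebra_sqintble (Au n).
have := NP n N Nn (leqnn N); rewrite enB//.
have -> : ip (u n) (L (u N)) + ip (u N) (L (u n)) = ip (u n) w.
  by rewrite (ipC mu (u N)) adjoint_generator// /w ipDr.
have enN := en_ge0 (Au N).
have : `|ip (u n) w| <= e / 2 / 2.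
  rewrite (le_trans (cauchy_schwarz su sw))//.
  rewrite (le_trans (ler_wpM2r (nrm_ge0 _ _) (N'P n N'n)))//.
  move: (nrm w) (nrm_ge0 mu w) K0 => y y0 K0; rewrite mulrAC ler_pdivrMr//.
  have -> : e / 2 / 2 * (2 * (y + 1)) = e / 2 * (y + 1) by field.
  by rewrite ler_wpM2l ?(ltW e20)// lerDl.
move=> /ler_normlP[]; move: (ip _ _) (en _) (en _) enN => x1 x2 x3; lra.
Qed.

(** From Young's inequality applied to Gam (f - g, g). *)
Lemma Gam_dist (k : R) f g : 0 < k -> A f -> A g ->
  rint (fun x => `|Gam f f x - Gam g g x|) <=
  k * en g + (1 + k^-1) * en (fun x => f x - g x).
Proof.
move=> k0 Af Ag; pose h x := f x - g x; have Ah : A h by exact: algebraB.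
have I := Gam_intble.
rewrite /en -rintZ; last exact: I.
rewrite -rintZ; last exact: I.
rewrite -rintD; [|apply: intbleZ; exact: I|apply: intbleZ; exact: I].
apply: ae_le_rint.
- by apply: intble_abs; apply: intbleB; exact: I.
- by apply: intbleD; apply: intbleZ; exact: I.
have Ak q : A (fun x => q * g x + h x) by exact: algebra_lin.
have lin (q : R) : {ae mu, forall x, Gam (fun x => q * g x + h x) (fun x => q * g x + h x) x =
    q ^+ 2 * Gam g g x + 2 * q * Gam g h x + Gam h h x}.
  have H1 := Gam_linear q Ag Ah (Ak q).
  have H2 := Gam_linear q Ag Ah Ag.
  have H3 := Gam_linear q Ag Ah Ah.
  apply: filterS3 H1 H2 H3 => x e1 e2 e3; rewrite e1.
  by rewrite (Gam_sym g) (Gam_sym h) e2 e3 (Gam_sym h g); ring.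
have fE : f = (fun x => 1 * g x + h x) by apply/funext => x; rewrite /h; ring.
have l1 := lin 1; rewrite -fE in l1.
have P1 : {ae mu, forall x, 0 <= k ^+ 2 * Gam g g x + 2 * k * Gam g h x + Gam h h x}.
  by apply: filterS2 (lin k) (Gam_ge0 (Ak k)) => x ->.
have P2 : {ae mu, forall x, 0 <= k ^+ 2 * Gam g g x - 2 * k * Gam g h x + Gam h h x}.
  apply: filterS2 (lin (- k)) (Gam_ge0 (Ak (- k))) => x ->.
  by rewrite sqrrN mulrN mulNr.
apply: filterS2 (filterI P1 P2) (filterI l1 (Gam_ge0 Ah)) => x [p1 p2] [-> p3].
move: (Gam g g x) (Gam g h x) (Gam h h x) p1 p2 p3 => x1 x2 x3 p1 p2 p3.
rewrite -(ler_pM2l k0).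
have -> : k * (k * x1 + (1 + k^-1) * x3) = k ^+ 2 * x1 + x3 + k * x3.
  by field; rewrite gt_eqF.
have -> : 1 ^+ 2 * x1 + 2 * 1 * x2 + x3 - x1 = 2 * x2 + x3 by ring.
rewrite -[X in X * _](gtr0_norm k0) -normrM ler_norml; apply/andP; split.
  by have := mulr_ge0 (ltW k0) p3; lra.
by lra.
Qed.

(** The lower semicontinuous envelope of the energy. It is defined before a
    function is known to lie in the Dirichlet domain. *)
Definition relaxed_energy_le f (c : R) := sqintble f /\ forall e : R, 0 < e ->
  exists2 u, A u & nrm (fun x => u x - f x) <= e /\ en u <= c + e.

Lemma en_cauchyP (u : nat -> T -> R) : (forall n, A (u n)) ->
  ((\int[mu]_x (Gam (u p.1 \- u p.2) (u p.1 \- u p.2) x)%:E)%E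
          @[p --> filter_prod \oo \oo] --> 0%E) <->
  (forall e : R, 0 < e -> exists N, forall n m, (N <= n)%N -> (N <= m)%N ->
     en (fun x => u n x - u m x) <= e).
Proof.
move=> Au; have AB n m := algebraB (Au n) (Au m).
have -> : (fun p : nat * nat => (\int[mu]_x (Gam (u p.1 \- u p.2) (u p.1 \- u p.2) x)%:E)%E) =
   (fun p => (en (fun x => u p.1 x - u p.2 x))%:E).
  by apply/funext => p; rewrite (rintE (Gam_intble (AB _ _) (AB _ _))).
rewrite cvg_EFin0; last by move=> p; exact: en_ge0.
split=> H e e0.
  have [[Q1 Q2] /= [[N1 _ N1P] [N2 _ N2P]] QH] := H e e0.
  exists (maxn N1 N2) => n m; rewrite !geq_max => /andP[n1 _] /andP[_ m2].
  by apply: (QH (n, m)); split => /=; [exact: N1P|exact: N2P].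
have [N NP] := H e e0.
exists ([set n | (N <= n)%N], [set n | (N <= n)%N]) => /=; first by split; exists N.
by move=> [n m] [/= Nn Nm]; exact: NP.
Qed.

(** The data of is_carre, with limits spelled out. *)
Definition energy_approx f (G : T -> R) (u : nat -> T -> R) :=
  [/\ forall n, A (u n),
    forall e : R, 0 < e -> exists N, forall n, (N <= n)%N -> nrm (fun x => u n x - f x) <= e,
    forall e : R, 0 < e -> exists N, forall n m, (N <= n)%N -> (N <= m)%N ->
      en (fun x => u n x - u m x) <= e &
    forall e : R, 0 < e -> exists N, forall n, (N <= n)%N ->
      rint (fun x => `|Gam (u n) (u n) x - G x|) <= e].

Lemma is_carreP f G : is_carre mu P A f G <->
  [/\ sqintble f, intble G & exists u, energy_approx f G u].
Proof.
split=> [[/sqintbleP sf /Lfun1_integrable IG [u [Au uf uC uG]]]|[sf IG [u [Au uf uC uG]]]].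
  split=> //; exists u; split => //.
  - by move: uf; rewrite lp_cvg2_natP// => n; exact: algebra_sqintble.
  - exact/en_cauchyP.
  - by move: uG; rewrite lp_cvg1_natP// => n; exact: Gam_intble.
split; [exact/sqintbleP|exact/Lfun1_integrable|].
exists u; split => //.
- by rewrite lp_cvg2_natP// => n; exact: algebra_sqintble.
- exact/en_cauchyP.
- by rewrite lp_cvg1_natP// => n; exact: Gam_intble.
Qed.

Lemma energy_approx_en f G u : intble G -> energy_approx f G u ->
  forall e : R, 0 < e -> exists N, forall n, (N <= n)%N -> `|en (u n) - rint G| <= e.
Proof.
move=> IG [Au _ _ uG] e /uG[N NP]; exists N => n Nn.
have I := Gam_intble (Au n) (Au n).
rewrite -rintB//; apply: le_trans (NP n Nn).
by apply: le_norm_rint; exact: intbleB.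
Qed.

(** Two approximating sequences differ by a sequence that tends to 0, whose energy
    vanishes by closability. *)
Lemma is_carre_unique f G G' : is_carre mu P A f G -> is_carre mu P A f G' ->
  rint (fun x => `|G x - G' x|) = 0.
Proof.
move=> /is_carreP[sf IG [u uP]] /is_carreP[_ IG' [v vP]].
have [Au uf uC uG] := uP; have [Av vf vC vG] := vP.
pose w n x := u n x - v n x.
have Aw n : A (w n) by exact: algebraB.
have sq n := algebra_sqintble (Au n); have sv n := algebra_sqintble (Av n).
have w0 (e : R) : 0 < e -> exists N, forall n, (N <= n)%N -> nrm (w n) <= e.
  move=> e0; have e20 : 0 < e / 2 by rewrite divr_gt0.
  have [N NP] := uf _ e20; have [N' NP'] := vf _ e20.
  exists (maxn N N') => n; rewrite geq_max => /andP[Nn Nn'].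
  apply: (le_trans (nrm_triangle (sq n) sf (sv n))); rewrite (splitr e).
  by apply: lerD; [exact: NP|rewrite nrmB; exact: NP'].
have wC (e : R) : 0 < e -> exists N, forall n m, (N <= n)%N -> (N <= m)%N ->
    en (fun x => w n x - w m x) <= e.
  move=> e0; have e40 : 0 < e / 4 by rewrite divr_gt0.
  have [N NP] := uC _ e40; have [N' NP'] := vC _ e40.
  exists (maxn N N') => n m; rewrite !geq_max => /andP[Nn Nn'] /andP[Nm Nm'].
  have -> : (fun x => w n x - w m x) = (fun x => (u n x - u m x) - (v n x - v m x)).
    by apply/funext => x; rewrite /w; ring.
  have A1 := algebraB (Au n) (Au m); have A2 := algebraB (Av n) (Av m).
  rewrite en_parallelogram//.
  have := en_ge0 (algebraZ 2^-1 (algebraD A1 A2)); have := NP n m Nn Nm; have := NP' n m Nn' Nm'.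
  move: (en _) (en _) (en _) => y1 y2 y3; lra.
have enw := en_closable Aw w0 wC.
apply/eqP; rewrite eq_le; apply/andP; split; last by apply: rint_ge0.
apply/ler_addgt0Pl => e e0; rewrite addr0.
have I n := Gam_intble (Au n) (Au n); have I' n := Gam_intble (Av n) (Av n).
have e40 : 0 < e / 4 by rewrite divr_gt0.
pose C := `|rint G'| + 1; have C0 : 0 < C by rewrite ltr_wpDl.
pose k := e / 4 / C; have k0 : 0 < k by rewrite !divr_gt0.
have K0 : 0 < 1 + k^-1 by rewrite addr_gt0// invr_gt0.
have [N1 NP1] := uG _ e40; have [N2 NP2] := vG _ e40.
have [N3 NP3] := enw _ (divr_gt0 e40 K0).
have [N4 NP4] := energy_approx_en IG' vP ltr01.
pose n := maxn (maxn N1 N2) (maxn N3 N4).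
have n1 : (N1 <= n)%N by rewrite !leq_max leqnn.
have n2 : (N2 <= n)%N by rewrite !leq_max leqnn ?orbT.
have n3 : (N3 <= n)%N by rewrite !leq_max leqnn ?orbT.
have n4 : (N4 <= n)%N by rewrite !leq_max leqnn ?orbT.
rewrite (le_trans (rint_dist_triangle IG (I n) IG'))//.
have h1 : rint (fun x => `|G x - Gam (u n) (u n) x|) <= e / 4.
  by under eq_fun do rewrite distrC; exact: NP1.
have h2 := rint_dist_triangle (I n) (I' n) IG'.
have h3 := NP2 n n2; have h4 := Gam_dist k0 (Au n) (Av n).
have h5 : k * en (v n) <= e / 4.
  rewrite /k -mulrA ler_piMr ?(ltW e40)// mulrC ler_pdivrMr// mul1r.
  have := NP4 n n4 => /ler_normlP[_]; rewrite lerBlDr => /le_trans; apply.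
  by rewrite /C addrC lerD2r ler_norm.
have h6 : (1 + k^-1) * en (w n) <= e / 4.
  by rewrite mulrC -ler_pdivlMr// NP3.
have -> : e = e / 4 + (e / 4 + e / 4 + e / 4) by field.
apply: lerD; first exact: h1.
apply: (le_trans h2); apply: lerD; last exact: h3.
by apply: (le_trans h4); apply: lerD; [exact: h5|exact: h6].
Qed.

(** Lower semicontinuity: by the parallelogram identity, almost minimisers of
    the energy in shrinking neighbourhoods of f form a Cauchy sequence. *)
Lemma relaxed_energy_carre f (c : R) : relaxed_energy_le f c ->
  exists2 G, is_carre mu P A f G & rint G <= c.
Proof.
move=> [sf Hf].
pose S (n : nat) := [set en u | u in [set u | A u /\ nrm (fun x => u x - f x) <= n.+1%:R^-1]].
have n0 (n : nat) : (0 : R) < n.+1%:R^-1 by rewrite invr_gt0.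
have lb n : lbound (S n) 0 by move=> _ [u [Au _] <-]; exact: en_ge0.
have Snon n (e : R) : 0 < e -> exists2 y, S n y & y <= c + e.
  move=> e0; have m0 : 0 < Num.min e n.+1%:R^-1 by rewrite lt_min e0 n0.
  have [u Au [u1 u2]] := Hf _ m0; exists (en u).
    by exists u => //; split => //; rewrite (le_trans u1)// ge_min lexx orbT.
  by rewrite (le_trans u2)// lerD2l ge_min lexx.
have hi n : has_inf (S n).
  by split; [have [y Sy _] := Snon n 1 ltr01; exists y|exists 0; exact: lb].
(* The infima over shrinking balls increase to a limit that is at most c. *)
pose l n := inf (S n).
have lc n : l n <= c.
  apply/ler_addgt0Pr => e e0; have [y Sy yc] := Snon n e e0.
  by rewrite (le_trans _ yc)//; apply: ge_inf => //; have [] := hi n.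
have lle n u : A u -> nrm (fun x => u x - f x) <= n.+1%:R^-1 -> l n <= en u.
  by move=> Au uf; apply: ge_inf; [have [] := hi n|exists u].
have [u uP] : exists u : nat -> T -> R, forall n,
    [/\ A (u n), nrm (fun x => u n x - f x) <= n.+1%:R^-1 & en (u n) <= l n + n.+1%:R^-1].
  have : forall n, exists u, [/\ A u, nrm (fun x => u x - f x) <= n.+1%:R^-1 &
      en u <= l n + n.+1%:R^-1].
    move=> n; have [y [u [Au uf] <-] ul] := inf_adherent (n0 n) (hi n).
    by exists u; split => //; exact: ltW.
  by move=> /choice[u uP]; exists u.
have Au n : A (u n) by have [] := uP n.
have su n := algebra_sqintble (Au n).
have inv_le (n m : nat) : (n <= m)%N -> m.+1%:R^-1 <= n.+1%:R^-1 :> R.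
  by move=> nm; rewrite lef_pV2 ?posrE// ler_nat.
have small (e : R) : 0 < e -> exists N : nat, N.+1%:R^-1 <= e.
  move=> e0; exists (Num.truncn e^-1).
  by rewrite invf_ple ?posrE// ltW// truncnS_gt.
have lmono n m : (n <= m)%N -> l n <= l m.
  move=> nm; apply: lb_le_inf; first by have [] := hi m.
  move=> _ [v [Av vf] <-]; apply: lle => //; exact: le_trans vf (inv_le _ _ nm).
have hsl : has_sup (range l) by split; [exists (l 0%N), 0%N|exists c => _ [n _ <-]].
pose ls := sup (range l).
have lls n : l n <= ls by apply: sup_upper_bound => //; exists n.
have lsc : ls <= c by apply: ge_sup => [|_ [n _ <-]//]; exists (l 0%N), 0%N.
(* The midpoint of two almost minimisers is a competitor in the larger ball. *)
have mid n m : en (fun x => u n x - u m x) <=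
    4 * (ls - l (minn n m)) + 2 * (n.+1%:R^-1 + m.+1%:R^-1).
  rewrite en_parallelogram//.
  have [_ _ h1] := uP n; have [_ _ h2] := uP m.
  have Am := algebraZ 2^-1 (algebraD (Au n) (Au m)).
  have : l (minn n m) <= en (fun x => 2^-1 * (u n x + u m x)).
    apply: lle => //.
    have -> : (fun x => 2^-1 * (u n x + u m x) - f x) =
      (fun x => 2^-1 * (u n x - f x) + 2^-1 * (u m x - f x)) by apply/funext => x; field.
    have s1 := sqintbleB (su n) sf; have s2 := sqintbleB (su m) sf.
    rewrite (le_trans (nrmD (sqintbleZ _ s1) (sqintbleZ _ s2)))// !nrmZ//.
    have [_ f1 _] := uP n; have [_ f2 _] := uP m.
    have := le_trans f1 (inv_le _ _ (geq_minl n m)).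
    have := le_trans f2 (inv_le _ _ (geq_minr n m)).
    rewrite ger0_norm//.
    by move: (nrm _) (nrm _) (_^-1) => y1 y2 y3; lra.
  have := lls n; have := lls m; move: h1 h2.
  move: (en _) (en _) (en _) (_.+1%:R^-1) (_.+1%:R^-1) (l _) (l _) (l _).
  move=> y1 y2 y3 y4 y5 y6 y7 y8; lra.
have uC (e : R) : 0 < e -> exists N, forall n m, (N <= n)%N -> (N <= m)%N ->
    en (fun x => u n x - u m x) <= e.
  move=> e0; have e80 : 0 < e / 8 by rewrite divr_gt0.
  have [_ [N1 _ <-] N1P] := sup_adherent e80 hsl.
  have [N2 N2P] := small _ e80.
  exists (maxn N1 N2) => n m; rewrite !geq_max => /andP[n1 n2] /andP[m1 m2].
  have h1 : l N1 <= l (minn n m) by apply: lmono; rewrite leq_min n1.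
  have h2 := le_trans (inv_le _ _ n2) N2P; have h3 := le_trans (inv_le _ _ m2) N2P.
  apply: le_trans (mid n m) _; move: N1P h1 h2 h3; rewrite -/ls.
  move: (l N1) (l (minn n m)) (n.+1%:R^-1) (m.+1%:R^-1) => y1 y2 y3 y4; lra.
have enb n : en (u n) <= ls + 1.
  have [_ _ h] := uP n; apply: le_trans h _; apply: lerD => //.
  by rewrite invf_le1// ler1n.
have I n := Gam_intble (Au n) (Au n).
have [|G IG GP] := complete_L1 (u := fun n => Gam (u n) (u n)) I.
  move=> e e0; have e20 : 0 < e / 2 by rewrite divr_gt0.
  pose C := `|ls + 1| + 1; have C0 : 0 < C by rewrite ltr_wpDl.
  pose k := e / 2 / C; have k0 : 0 < k by rewrite !divr_gt0.
  have K0 : 0 < 1 + k^-1 by rewrite addr_gt0// invr_gt0.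
  have [N NP] := uC _ (divr_gt0 e20 K0); exists N => n m Nn Nm.
  apply: le_trans (Gam_dist k0 (Au n) (Au m)) _; rewrite (splitr e) lerD//.
    rewrite /k -mulrA ler_piMr ?(ltW e20)// mulrC ler_pdivrMr// mul1r.
    by rewrite (le_trans (enb m))// (le_trans (ler_norm _))// lerDl.
  by rewrite mulrC -ler_pdivlMr// NP.
have uP' : energy_approx f G u.
  split => // e e0; have [N NP] := small _ e0; exists N => n Nn.
  by have [_ uf _] := uP n; rewrite (le_trans uf)// (le_trans _ NP)// inv_le.
exists G; first by apply/is_carreP; split => //; exists u.
apply/ler_addgt0Pl => e e0; have e20 : 0 < e / 2 by rewrite divr_gt0.
have [N NP] := energy_approx_en IG uP' e20; have [N' NP'] := small _ e20.
have := NP (maxn N N') (leq_maxl _ _).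
have [_ _ h1] := uP (maxn N N').
have h2 := le_trans (inv_le _ _ (leq_maxr N N')) NP'.
have h3 := lc (maxn N N').
move=> /ler_normlP[h4 _]; move: h1 h2 h3 h4.
move: (en _) (l _) (_.+1%:R^-1) (rint G) => y1 y2 y3 y4; lra.
Qed.

Lemma carreP f : dirichlet_dom mu P A f -> is_carre mu P A f (carre mu P A f).
Proof. by move=> [G fG]; exact: (xgetPex (cst 0) (ex_intro _ G fG)). Qed.

Lemma energy_le f (c : R) : relaxed_energy_le f c ->
  dirichlet_dom mu P A f /\ (energy mu P A f <= c%:E)%E.
Proof.
move=> /relaxed_energy_carre[G fG Gc]; have df : dirichlet_dom mu P A f by exists G.
split => //; have fC := carreP df.
have /is_carreP[_ IC _] := fC; have /is_carreP[_ IG _] := fG.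
rewrite /energy (rintE IC) lee_fin (le_trans _ Gc)//.
have := is_carre_unique fC fG; have := le_norm_rint (intbleB IC IG).
rewrite rintB// => /[swap] -> /ler_normlP[_]; by rewrite subr_le0.
Qed.

Lemma carre_ge0 f : dirichlet_dom mu P A f -> {ae mu, forall x, 0 <= carre mu P A f x}.
Proof.
move=> /carreP/is_carreP[sf]; set G := carre _ _ _ _ => IG [u [Au _ _ uG]].
apply: ae_ge0_of_rint => // B mB; have bB := bounded_measurable_indic R mB.
apply/ler_addgt0Pl => e e0; have [N NP] := uG e e0.
have I := Gam_intble (Au N) (Au N); have H := NP N (leqnn N).
have h1 : 0 <= rint (fun x => \1_B x * Gam (u N) (u N) x).
  rewrite -[leLHS](rint_cst mu); apply: ae_le_rint; first exact: intble_cst.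
    exact: intble_bounded_mul.
  apply: filterS (Gam_ge0 (Au N)) => x hx /=.
  by apply: mulr_ge0 => //; rewrite indicE; case: (x \in B).
rewrite (le_trans h1)// -lerBlDr -rintB; [|exact: intble_bounded_mul..].
rewrite (le_trans _ H)//; apply: le_rint.
- by apply: intbleB; exact: intble_bounded_mul.
- exact/intble_abs/intbleB.
move=> x; rewrite -mulrBr indicE; case: (x \in B); last by rewrite mul0r.
by rewrite mul1r ler_norm.
Qed.

Lemma Gam_cst (c : R) f : A f -> {ae mu, forall x, Gam (cst c) f x = 0}.
Proof.
move=> Af; have A1 := algebra_cst 1; have A0 := algebra_cst 0.
have H1 : {ae mu, forall x, Gam (cst 1) f x = 0}.
  have := carre_derivation car A1 A1 Af.
  have -> : cst 1 \* cst 1 = (cst 1 : T -> R) by apply/funext => x /=; rewrite mulr1.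
  by apply: filterS => x /=; rewrite mul1r => /eqP; rewrite -subr_eq0 opprD addNKr oppr_eq0 => /eqP.
have := Gam_linear (c - 1) A1 A1 Af.
have -> : (fun y => (c - 1) * cst 1 y + cst 1 y) = (cst c : T -> R).
  by apply/funext => x /=; rewrite mulr1 subrK.
by move=> H2; apply: filterS2 H1 H2 => x -> ->; rewrite mulr0 addr0.
Qed.

(** Induction on the Horner scheme, with one derivation at each step. *)
Lemma Gam_horner_l (p : {poly R}) f h : A f -> A h ->
  {ae mu, forall x, Gam (fun y => p.[f y]) h x = p^`().[f x] * Gam f h x}.
Proof.
move=> Af Ah; elim/poly_ind: p => [|p c IH].
  have -> : (fun y => (0 : {poly R}).[f y]) = cst 0 by apply/funext => y; rewrite horner0.
  by apply: filterS (Gam_cst 0 Ah) => x ->; rewrite deriv0 horner0 mul0r.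
have Ap := algebra_horner p Af; have Apf := algebraM Ap Af.
have -> : (fun y => (p * 'X + c%:P).[f y]) = (fun y => 1 * (p.[f y] * f y) + cst c y).
  by apply/funext => y; rewrite hornerMXaddC mul1r.
have H1 := Gam_linear 1 Apf (algebra_cst c) Ah.
have H2 := carre_derivation car Ap Af Ah.
have H3 := Gam_cst c Ah.
apply: filterS2 (filterI IH H1) (filterI H2 H3) => x [e1 e2] [e3 e4].
rewrite e2 e4 addr0 mul1r [Gam _ h x]e3 e1.
by rewrite derivD derivC addr0 derivM derivX mulr1 hornerD hornerM hornerX; ring.
Qed.

Lemma Gam_horner (p : {poly R}) f : A f ->
  {ae mu, forall x, Gam (fun y => p.[f y]) (fun y => p.[f y]) x =
                    p^`().[f x] ^+ 2 * Gam f f x}.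
Proof.
move=> Af; have Ap := algebra_horner p Af.
have H1 := Gam_horner_l p Af Ap; have H2 := Gam_horner_l p Af Af.
apply: filterS2 H1 H2 => x -> e2.
by rewrite Gam_sym e2 expr2 mulrA.
Qed.

Lemma relaxed_energy_ge0 f (c : R) : relaxed_energy_le f c -> 0 <= c.
Proof.
move=> [_ H]; apply/ler_addgt0Pr => e e0; have [u Au [_ uc]] := H e e0.
by apply: le_trans uc; exact: en_ge0.
Qed.

Lemma relaxed_energyZ (k : R) f (c : R) : relaxed_energy_le f c ->
  relaxed_energy_le (fun x => k * f x) (k ^+ 2 * c).
Proof.
move=> [sf H]; split; first exact: sqintbleZ.
move=> e e0; have K0 : 0 < `|k| + k ^+ 2 + 1.
  by rewrite ltr_wpDl// addr_ge0// sqr_ge0.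
have [u Au [u1 u2]] := H _ (divr_gt0 e0 K0).
have eK : e / (`|k| + k ^+ 2 + 1) * (`|k| + k ^+ 2 + 1) = e by rewrite divfK// gt_eqF.
have q0 : 0 < e / (`|k| + k ^+ 2 + 1) by rewrite divr_gt0.
have k2 := sqr_ge0 k; have k1 := normr_ge0 k.
exists (fun x => k * u x); first exact: algebraZ.
split.
  have -> : (fun x => k * u x - k * f x) = (fun x => k * (u x - f x)).
    by apply/funext => x; rewrite mulrBr.
  rewrite nrmZ; last by apply: sqintbleB => //; exact: algebra_sqintble.
  rewrite (le_trans (ler_wpM2l (normr_ge0 k) u1))// -[leRHS]eK mulrC ler_pM2l//.
  by rewrite -addrA lerDl addr_ge0.
rewrite enZ// (le_trans (ler_wpM2l k2 u2))// mulrDr lerD2l -[leRHS]eK mulrC ler_pM2l//.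
by rewrite addrAC lerDr addr_ge0.
Qed.

(** The tails tend to 0 pointwise and are dominated by the modulus of f. *)
Lemma intble_tail f (e : R) : intble f -> 0 < e ->
  exists N : nat, rint (fun x => Num.max (f x - N%:R) 0) <= e.
Proof.
move=> If e0; have mf := intble_measurable If.
pose F (n : nat) x := (Num.max (f x - n%:R) 0)%:E.
have mF n : measurable_fun [set: T] (F n).
  by apply/measurable_EFinP; apply: measurable_maxr => //; exact: measurable_funB.
have [] := @dominated_convergence _ _ _ mu [set: T] measurableT F (cst 0%E)
  (fun x => `|f x|%:E) mF (@measurable_cst _ _ _ _ _ _).
- apply: nearW => x _; apply: (@cvg_near_cst _ _ _ _ _ _).
  exists (Num.truncn (f x)).+1 => // n /= fn; rewrite /F max_r// subr_le0.
  by rewrite (le_trans (ltW (truncnS_gt _)))// ler_nat.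
- exact: intble_abs.
- apply: nearW => x n _ /=; rewrite lee_fin ger0_norm ?le_max ?lexx ?orbT//.
  rewrite ge_max normr_ge0 andbT lerBlDr (le_trans (ler_norm _))// lerDl//.
move=> _ _; rewrite integral0 => H.
have In (n : nat) : intble (fun x => Num.max (f x - n%:R) 0).
  by apply: intble_pos; apply: intbleB => //; exact: intble_cst.
have : (rint (fun x => Num.max (f x - n%:R) 0))%:E @[n --> \oo] --> 0%E.
  by under eq_fun do rewrite -(rintE (In _)).
rewrite cvg_EFin0; last by move=> n; apply: rint_ge0 => x; rewrite le_max lexx orbT.
by move=> /(_ e e0)[N _ /(_ N (leqnn N))]; exists N.
Qed.

(** Localisation of the energy: for a C^1 function of h whose derivative is
    Lipschitz and a limit of polynomials, only the region where the derivative
    lives contributes. *)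
Lemma relaxed_energy_comp h (phi dphi : R -> R) (K : R) :
  dirichlet_dom mu P A h -> has_derivative phi dphi -> poly_approximable dphi ->
  (forall x y, `|dphi x - dphi y| <= K * `|x - y|) ->
  (forall x, 0 <= dphi x <= 1) ->
  relaxed_energy_le (phi \o h) (rint (fun x => dphi (h x) ^+ 2 * carre mu P A h x)).
Proof.
move=> dh phiD pdphi dphiK dphi01.
have G0 := carre_ge0 dh; have /carreP/is_carreP[sh] := dh.
set G := carre _ _ _ _ in G0 * => IG [u uP]; have [Au uh _ uG] := uP.
have cphi := has_derivative_continuous phiD.
have K0 : 0 <= K.
  by have := dphiK 1 0; rewrite subr0 normr1 mulr1; exact: le_trans.
have cdphi := lipschitz_continuous dphiK.
have phi1 x y : `|phi x - phi y| <= `|x - y|.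
  have := lipschitz_primitive (K := 1) phiD _ x y; rewrite mul1r; apply => z.
  by have /andP[h0 h1] := dphi01 z; rewrite ger0_norm.
have mh : measurable_fun [set: T] h by have [] := sh.
have mphi : measurable_fun [set: R] phi by exact: continuous_measurable_fun.
have mdphi : measurable_fun [set: R] dphi by exact: continuous_measurable_fun.
have s1 : sqintble (fun x => `|h x| + `|phi 0|).
  apply: sqintbleD; last exact/bounded_sqintble/bounded_measurable_cst.
  by apply: (le_sqintble _ sh) => [|x]; [exact: measurableT_comp|rewrite normr_id].
have sphi : sqintble (phi \o h).
  apply: (le_sqintble _ s1) => [|x]; first exact: measurableT_comp.
  rewrite /= [leRHS]ger0_norm ?addr_ge0// -lerBlDr.
  by rewrite (le_trans (lerB_dist _ _))// (le_trans (phi1 _ _))// subr0.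
have bd v : measurable_fun [set: T] v -> bounded_measurable (fun x => dphi (v x) ^+ 2).
  move=> mv; split; first by apply: measurable_funX; exact: measurableT_comp.
  exists 1 => x; have /andP[h0 h1] := dphi01 (v x).
  by rewrite normrX ger0_norm// exprn_ile1.
split => // e e0.
have e80 : 0 < e / 8 by rewrite divr_gt0.
have e20 : 0 < e / 2 by rewrite divr_gt0.
have [N NP] := intble_tail IG e80.
have q0 : 0 < e / 8 / (2 * K * N%:R + 1) by rewrite divr_gt0// ltr_wpDl// !mulr_ge0.
have [N1 N1P] := uh _ e20; have [N2 N2P] := uh _ q0; have [N3 N3P] := uG _ e80.
have [N4 N4P] := energy_approx_en IG uP ltr01.
pose n := maxn (maxn N1 N2) (maxn N3 N4).
have n1 : (N1 <= n)%N by rewrite !leq_max leqnn.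
have n2 : (N2 <= n)%N by rewrite !leq_max leqnn ?orbT.
have n3 : (N3 <= n)%N by rewrite !leq_max leqnn ?orbT.
have n4 : (N4 <= n)%N by rewrite !leq_max leqnn ?orbT.
pose v := u n; have Av : A v by exact: Au.
have mv := (algebra_bounded Av).1; have sv := algebra_sqintble Av.
have [_ [M vM]] := algebra_bounded Av.
(* Three times a bound for the energy of v, which the error del multiplies. *)
pose D := 3 * (`|rint G| + 1); have D0 : 0 < D by rewrite mulr_gt0// ltr_wpDl.
pose del := Num.min (e / 2) (Num.min 1 (e / 8 / D)).
have del0 : 0 < del by rewrite !lt_min e20 ltr01 divr_gt0.
have del1 : del <= 1 by rewrite !ge_min lexx ?orbT.
have del2 : del <= e / 2 by rewrite !ge_min lexx ?orbT.
have del3 : del <= e / 8 / D by rewrite !ge_min lexx ?orbT.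
have [p pP] := C1_poly_approximation M phiD pdphi del0.
have Ap := algebra_horner p Av.
exists (fun x => p.[v x]) => //; split.
  have spv : sqintble (phi \o v).
    apply: bounded_sqintble; apply: bounded_measurable_comp => //.
    exact: algebra_bounded.
  rewrite (le_trans (nrm_triangle (algebra_sqintble Ap) spv sphi))// (splitr e) lerD//.
    rewrite -(ger0_norm (ltW e20)) -(nrm_cst mu); apply: le_nrm.
    - exact/bounded_sqintble/bounded_measurable_cst.
    - by have [] := sqintbleB (algebra_sqintble Ap) spv.
    move=> x; rewrite /= distrC (ger0_norm (ltW e20)).
    by have [h1 _] := pP _ (vM x); exact: le_trans h1 del2.
  rewrite (le_trans _ (N1P _ n1))//; apply: le_nrm; first exact: sqintbleB.
    by have [] := sqintbleB spv sphi.
  by move=> x /=; exact: phi1.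
have IGv := Gam_intble Av Av.
pose W v := rint (fun x => dphi (v x) ^+ 2 * G x).
(* The chain rule for polynomials, with p' replaced by dphi. *)
have enp : en (fun x => p.[v x]) <= rint (fun x => (dphi (v x) ^+ 2 + 3 * del) * Gam v v x).
  have bdv : bounded_measurable (fun x => dphi (v x) ^+ 2 + 3 * del).
    by apply: bounded_measurableD; [exact: bd|exact: bounded_measurable_cst].
  apply: ae_le_rint; [exact: Gam_intble|exact: intble_bounded_mul|].
  apply: filterS2 (Gam_horner p Av) (Gam_ge0 Av) => x -> g0.
  apply: ler_wpM2r => //; have [_ h2] := pP _ (vM x).
  have /andP[d0 d1] := dphi01 (v x).
  move: h2 d0 d1; move: (dphi (v x)) (p^`().[v x]) => y z /ler_normlP[h1 h2] d0 d1.
  have zy : `|z| <= y + del by apply/ler_normlP; clear - h1 h2 d0 del0; split; lra.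
  have : z ^+ 2 <= (y + del) ^+ 2.
    by rewrite -(real_normK (num_real z)) lerXn2r ?nnegrE// addr_ge0// ltW.
  by move=> /le_trans; apply; clear - d0 d1 del0 del1; nra.
apply: (le_trans enp).
have step1 : rint (fun x => (dphi (v x) ^+ 2 + 3 * del) * Gam v v x) <=
    rint (fun x => dphi (v x) ^+ 2 * Gam v v x) + e / 8.
  have -> : (fun x => (dphi (v x) ^+ 2 + 3 * del) * Gam v v x) =
      (fun x => dphi (v x) ^+ 2 * Gam v v x + (3 * del) * Gam v v x).
    by apply/funext => x; rewrite mulrDl.
  rewrite rintD; [|exact: intble_bounded_mul (bd _ mv) IGv|exact: intbleZ].
  rewrite rintZ// lerD2l -/(en v).
  have : en v <= `|rint G| + 1.
    have /ler_normlP[_] := N4P n n4; rewrite -/v lerBlDr addrC => /le_trans; apply.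
    by rewrite lerD2r ler_norm.
  have d30 : 0 <= 3 * del by rewrite mulr_ge0// ltW.
  move=> /(ler_wpM2l d30)/le_trans; apply.
  by rewrite mulrAC -/D mulrC -ler_pdivlMr.
(* Gam v v is close to G in mean. *)
have step2 : rint (fun x => dphi (v x) ^+ 2 * Gam v v x) <= W v + e / 8.
  rewrite -lerBlDl /W -rintB; [|exact: intble_bounded_mul (bd _ mv) _..].
  apply: le_trans (N3P n n3); apply: le_rint.
  - by apply: intbleB; exact: intble_bounded_mul (bd _ mv) _.
  - exact/intble_abs/intbleB.
  move=> x; rewrite -mulrBr -/v.
  have /andP[d0 d1] := dphi01 (v x).
  rewrite (le_trans (ler_norm _))// normrM ler_piMl// normrX ger0_norm//.
  by rewrite exprn_ile1.
(* The tail of G where G exceeds N, the Lipschitz bound on dphi elsewhere. *)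
have step3 : W v <= W h + (e / 8 + e / 8).
  rewrite -lerBlDl /W -rintB; [|exact: intble_bounded_mul (bd _ mv) _|
    exact: intble_bounded_mul (bd _ mh) _].
  have Ivh := intble_abs (intbleB (sqintble_intble sv) (sqintble_intble sh)).
  have It : intble (fun x => Num.max (G x - N%:R) 0).
    by apply: intble_pos; apply: intbleB => //; exact: intble_cst.
  apply: (@le_trans _ _ (rint (fun x => 2 * K * N%:R * `|v x - h x| + Num.max (G x - N%:R) 0))).
    apply: ae_le_rint.
    - by apply: intbleB; [exact: intble_bounded_mul (bd _ mv) _|exact: intble_bounded_mul (bd _ mh) _].
    - by apply: intbleD => //; exact: intbleZ.
    apply: filterS G0 => x g0; rewrite -mulrBl.
    have /andP[d0 d1] := dphi01 (v x); have /andP[d2 d3] := dphi01 (h x).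
    have := dphiK (v x) (h x) => /ler_normlP[_].
    move: (dphi (v x)) (dphi (h x)) d0 d1 d2 d3 (normr_ge0 (v x - h x)).
    move: `|_| (G x) g0 => y g g0 a b a0 a1 b0 b1 y0 ab.
    have N0 : (0 : R) <= N%:R by [].
    move: (N%:R : R) N0 => m m0.
    have Ky : 0 <= K * y by rewrite mulr_ge0.
    have a2 : a ^+ 2 - b ^+ 2 <= 2 * (K * y) by clear - a0 a1 b0 b1 ab Ky; nra.
    have a3 : a ^+ 2 - b ^+ 2 <= 1 by nra.
    rewrite (_ : 2 * K * m * y = 2 * (K * y) * m); last by ring.
    have [gm|/ltW mg] := leP (g - m) 0.
      rewrite addr0.
      have gm' : g <= m by rewrite -subr_le0.
      apply: (@le_trans _ _ (2 * (K * y) * g)); first exact: ler_wpM2r.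
      by apply: (ler_wpM2l _ gm'); rewrite mulr_ge0.
    have -> : (a ^+ 2 - b ^+ 2) * g = (a ^+ 2 - b ^+ 2) * m + (a ^+ 2 - b ^+ 2) * (g - m) by ring.
    apply: lerD; first exact: ler_wpM2r.
    by rewrite -[leRHS]mul1r; exact: ler_wpM2r.
  rewrite rintD//; last exact: intbleZ.
  rewrite rintZ//; apply: lerD; last exact: NP.
  have c0 : 0 <= 2 * K * N%:R by rewrite !mulr_ge0.
  have h1 := le_trans (le_rint_abs_nrm (sqintbleB sv sh)) (N2P n n2).
  rewrite (le_trans (ler_wpM2l c0 h1))// mulrA -[leRHS]mulr1.
  rewrite ler_pdivrMr ?ltr_wpDl// mulr1 mulrC.
  by rewrite ler_wpM2l ?(ltW e80)// lerDl.
rewrite (le_trans step1)//.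
have E8 : e = e / 8 + (e / 8 + e / 8) + e / 8 + e / 2 by field.
have e2' := ltW e20.
move: step2 step3 E8 e2'; rewrite -/(W h).
move: (rint (fun x => dphi (v x) ^+ 2 * Gam v v x)) (W v) (W h) => y1 y2 y3; lra.
Qed.

(** * Time averages of the semigroup *)

Lemma sum_mul (F : nat -> R) (N M : nat) :
  \sum_(i < N * M) F i = \sum_(k < N) \sum_(j < M) F (k * M + j)%N.
Proof.
elim: N => [|N IH]; first by rewrite !big_ord0.
by rewrite big_ord_recr /= -IH mulSnr big_split_ord.
Qed.

Lemma sum_shift (a : nat -> R) (N j : nat) :
  \sum_(k < N) (a (k + j)%N - a k) = \sum_(k < j) (a (k + N)%N - a k).
Proof.
elim: j => [|j IH].
  by rewrite big_ord0 big1// => k _; rewrite addn0 subrr.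
rewrite big_ord_recr /= -IH; apply/eqP; rewrite addrC -subr_eq -sumrB; apply/eqP.
under eq_bigr do rewrite opprB addrA subrK addnS.
rewrite -(big_mkord xpredT (fun k => a (k + j).+1 - a (k + j)%N)).
by rewrite (telescope_sumr_eq (fun k => a (k + j)%N))// add0n addnC.
Qed.

Lemma mean_cst (N : nat) (c : R) : (0 < N)%N -> N%:R^-1 * \sum_(k < N) c = c.
Proof.
by move=> N0; rewrite sumr_const card_ord -[c *+ N]mulr_natl mulKf// pnatr_eq0 -lt0n.
Qed.

Lemma sg_sum t N (F : nat -> T -> R) x : 0 <= t ->
  (forall k, bounded_measurable (F k)) ->
  P t (fun y => \sum_(k < N) F k y) x = \sum_(k < N) P t (F k) x.
Proof.
move=> t0 bF; elim: N => [|N IH].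
  rewrite big_ord0 -[RHS](sg_cst sg 0 x t0); congr (P t _ x).
  by apply/funext => y; rewrite big_ord0.
rewrite big_ord_recr /= -IH -sg_D//; last exact: bounded_measurable_sum.
by congr (P t _ x); apply/funext => y; rewrite big_ord_recr.
Qed.

Lemma nrm_sum_le N (F : nat -> T -> R) (c : R) :
  (forall k, (k < N)%N -> sqintble (F k)) -> (forall k, (k < N)%N -> nrm (F k) <= c) ->
  sqintble (fun x => \sum_(k < N) F k x) /\ nrm (fun x => \sum_(k < N) F k x) <= N%:R * c.
Proof.
elim: N => [|N IH] sF Fc.
  have -> : (fun x => \sum_(k < 0) F k x) = cst 0 by apply/funext => x; rewrite big_ord0.
  by rewrite nrm_cst normr0 mul0r; split => //; exact/bounded_sqintble/bounded_measurable_cst.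
have [|k kN|s1 n1] := IH; first by move=> k kN; apply: sF; exact: ltnW.
  by apply: Fc; exact: ltnW.
have s2 := sF N (ltnSn N).
have -> : (fun x => \sum_(k < N.+1) F k x) = (fun x => \sum_(k < N) F k x + F N x).
  by apply/funext => x; rewrite big_ord_recr.
split; first exact: sqintbleD.
rewrite (le_trans (nrmD s1 s2))// -natr1 mulrDl mul1r lerD//.
exact: Fc.
Qed.

Definition time_average g (tau : R) (N : nat) x : R :=
  N%:R^-1 * \sum_(k < N) P (k%:R * (tau / N%:R)) g x.

Section averages.
Variables (g : T -> R) (tau : R).
Hypotheses (bg : bounded_measurable g) (tau0 : 0 < tau).
Local Notation avg := (time_average g tau).

Let step_ge0 N (k : nat) : 0 <= k%:R * (tau / N%:R).
Proof. by rewrite mulr_ge0// divr_ge0// ltW. Qed.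

Let step_le N (k : nat) : (0 < N)%N -> (k <= N)%N -> k%:R * (tau / N%:R) <= tau.
Proof.
move=> N0 kN; have N0' : (0 : R) < N%:R by rewrite ltr0n.
by rewrite mulrCA ler_piMr ?(ltW tau0)// ler_pdivrMr// mul1r ler_nat.
Qed.

Let bounded_term N k : bounded_measurable (P (k%:R * (tau / N%:R)) g).
Proof. exact: sg_bounded. Qed.

Let bounded_partial N M :
  bounded_measurable (fun x => \sum_(k < M) P (k%:R * (tau / N%:R)) g x).
Proof.
apply: (@bounded_measurable_sum _ _ _ 'I_M (index_enum _)
  (fun k : 'I_M => P (k%:R * (tau / N%:R)) g)).
by move=> k; exact: bounded_term.
Qed.

Lemma time_average_bounded N : bounded_measurable (avg N).
Proof. by apply: bounded_measurableZ. Qed.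

Lemma time_average_bound (M : R) N x : 0 <= M -> (forall y, `|g y| <= M) ->
  `|avg N x| <= M.
Proof.
move=> M0 gM; case: N => [|N]; first by rewrite /avg invr0 mul0r normr0.
rewrite /avg normrM gtr0_norm ?invr_gt0// mulrC ler_pdivrMr//.
apply: (le_trans (ler_norm_sum _ _ _)).
apply: (@le_trans _ _ (\sum_(k < N.+1) M)).
  by apply: ler_sum => k _; apply: sg_bound.
by rewrite sumr_const card_ord mulr_natr.
Qed.

Lemma shifted_dist s (r m : R) h : 0 <= s -> 0 <= r -> bounded_measurable h ->
  nrm (fun x => P r h x - h x) <= m ->
  nrm (fun x => P (s + r) h x - P s h x) <= m.
Proof.
move=> s0 r0 bh; apply: le_trans.
have bd := bounded_measurableB (sg_bounded r0 bh) bh.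
have := sg_contraction s0 bd; congr (nrm _ <= _); apply/funext => x.
by rewrite (sg_add sg)// sg_B//; exact: sg_bounded.
Qed.

(** Refining the subdivision moves each time by less than one step. *)
Lemma time_average_refine N M (m : R) : (0 < N)%N -> (0 < M)%N ->
  (forall r, 0 <= r -> r <= tau / N%:R -> nrm (fun x => P r g x - g x) <= m) ->
  nrm (fun x => avg (N * M) x - avg N x) <= m.
Proof.
move=> N0 M0 H.
have N0' : (0 : R) < N%:R by rewrite ltr0n.
have M0' : (0 : R) < M%:R by rewrite ltr0n.
have NM0 : (0 : R) < (N * M)%:R by rewrite ltr0n muln_gt0 N0.
pose F (i : nat) x := P (i%:R * (tau / (N * M)%:R)) g x - P ((i %/ M)%N%:R * (tau / N%:R)) g x.
have -> : (fun x => avg (N * M) x - avg N x) =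
    (fun x => (N * M)%:R^-1 * \sum_(i < N * M) F i x).
  apply/funext => x; rewrite /F sumrB mulrBr; congr (_ - _).
  rewrite (sum_mul (fun i => P ((i %/ M)%N%:R * (tau / N%:R)) g x)).
  rewrite /avg natrM invfM -mulrA; congr (_ * _).
  rewrite mulr_sumr; apply: eq_bigr => k _.
  rewrite (eq_bigr (fun=> P (k%:R * (tau / N%:R)) g x)); last first.
    by move=> j _; rewrite divnMDl// divn_small// addn0.
  by rewrite mean_cst.
have sF i : sqintble (F i).
  by apply: bounded_sqintble; apply: bounded_measurableB; exact: bounded_term.
have Fm i : nrm (F i) <= m.
  have -> : F i = (fun x => P ((i %/ M)%N%:R * (tau / N%:R) + (i %% M)%N%:R * (tau / (N * M)%:R)) g x -
      P ((i %/ M)%N%:R * (tau / N%:R)) g x).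
    apply/funext => x; congr (P _ g x - _).
    rewrite {1}(divn_eq i M) natrD natrM mulrDl; congr (_ + _).
    by rewrite natrM; field; rewrite !gt_eqF.
  apply: shifted_dist => //; apply: H => //.
  have im : (i %% M)%N%:R <= M%:R :> R by rewrite ler_nat ltnW// ltn_pmod.
  have -> : tau / N%:R = M%:R * (tau / (N * M)%:R).
    by rewrite natrM; field; rewrite !gt_eqF.
  by rewrite ler_wpM2r// divr_ge0// ltW.
have [sS nS] := nrm_sum_le (fun k _ => sF k) (fun k _ => Fm k) (N := (N * M)%N).
rewrite nrmZ// gtr0_norm ?invr_gt0// mulrC ler_pdivrMr// mulrC//.
Qed.

Lemma time_average_dist N (m : R) : (0 < N)%N ->
  (forall s, 0 <= s -> s <= tau -> nrm (fun x => P s g x - g x) <= m) ->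
  nrm (fun x => avg N x - g x) <= m.
Proof.
move=> N0 H; have N0' : (0 : R) < N%:R by rewrite ltr0n.
pose F (k : nat) x := P (k%:R * (tau / N%:R)) g x - g x.
have -> : (fun x => avg N x - g x) = (fun x => N%:R^-1 * \sum_(k < N) F k x).
  apply/funext => x; rewrite /F sumrB mulrBr; congr (_ - _).
  by rewrite mean_cst.
have sF i : (i < N)%N -> sqintble (F i).
  by move=> _; apply: bounded_sqintble; apply: bounded_measurableB.
have [|sS nS] := nrm_sum_le sF (c := m).
  by move=> k kN; apply: H => //; apply: step_le => //; exact: ltnW.
by rewrite nrmZ// gtr0_norm ?invr_gt0// mulrC ler_pdivrMr// mulrC.
Qed.

(** Only the pairings with the individual terms of the mean enter. *)
Lemma time_average_ip N h (c : R) : (0 < N)%N -> sqintble h ->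
  (forall s, 0 <= s -> s <= tau -> ip h (P s g) <= c) -> ip h (avg N) <= c.
Proof.
move=> N0 sh H; have N0' : (0 : R) < N%:R by rewrite ltr0n.
have E M : ip h (fun x => \sum_(k < M) P (k%:R * (tau / N%:R)) g x) =
    \sum_(k < M) ip h (P (k%:R * (tau / N%:R)) g).
  elim: M => [|M IH].
    have -> : (fun x => \sum_(k < 0) P (k%:R * (tau / N%:R)) g x) = cst 0.
      by apply/funext => x; rewrite big_ord0.
    by rewrite ipC ip0l big_ord0.
  have -> : (fun x => \sum_(k < M.+1) P (k%:R * (tau / N%:R)) g x) =
      (fun x => \sum_(k < M) P (k%:R * (tau / N%:R)) g x + P (M%:R * (tau / N%:R)) g x).
    by apply/funext => x; rewrite big_ord_recr.
  rewrite (ipDr (bounded_sqintble mu (bounded_partial N M))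
    (bounded_sqintble mu (bounded_term N M)) sh).
  by rewrite IH big_ord_recr.
rewrite ipZr//; last exact: bounded_sqintble.
rewrite E mulrC ler_pdivrMr//.
apply: (@le_trans _ _ (\sum_(k < N) c)); last by rewrite sumr_const card_ord mulr_natr.
apply: ler_sum => k _; apply: H => //.
by apply: step_le => //; exact: ltnW.
Qed.

Lemma time_average_shift N j x : (0 < N)%N ->
  P (j%:R * (tau / N%:R)) (avg N) x - avg N x =
  tau / N%:R * \sum_(k < j) P (k%:R * (tau / N%:R)) (fun y => (P tau g y - g y) / tau) x.
Proof.
move=> N0; have N0' : (0 : R) < N%:R by rewrite ltr0n.
rewrite /avg sg_Z//.
rewrite (@sg_sum _ N (fun k => P (k%:R * (tau / N%:R)) g))// -mulrBr -sumrB.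
under eq_bigr do rewrite -(sg_add sg)// -mulrDl -natrD addnC.
rewrite (sum_shift (fun k => P (k%:R * (tau / N%:R)) g x)).
transitivity (N%:R^-1 * (tau * \sum_(k < j) P (k%:R * (tau / N%:R))
    (fun y => (P tau g y - g y) / tau) x)); last first.
  by rewrite mulrA; congr (_ * _); exact: mulrC.
congr (_ * _); rewrite mulr_sumr; apply: eq_bigr => k _.
have bPg : bounded_measurable (P tau g) by apply: sg_bounded => //; exact: ltW.
have -> : (fun y => (P tau g y - g y) / tau) = (fun y => tau^-1 * (P tau g y - g y)).
  by apply/funext => y; rewrite mulrC.
rewrite sg_Z//; last exact: bounded_measurableB.
rewrite sg_B// mulVKf ?gt_eqF// -(sg_add sg) ?(ltW tau0)//.
by congr (P _ g x - _); rewrite natrD mulrDl; congr (_ + _); rewrite mulrC divfK// gt_eqF.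
Qed.

Let w x := (P tau g x - g x) / tau.

Let bounded_w : bounded_measurable w.
Proof.
apply: bounded_measurableM; last exact: bounded_measurable_cst.
by apply: bounded_measurableB => //; apply: sg_bounded => //; exact: ltW.
Qed.

(** At a time u between two multiples of the step, the remainder is shorter than
   the step and costs at most q; the multiples telescope. *)
Lemma time_average_increment N u (q m : R) : (0 < N)%N -> 0 < u ->
  (forall r, 0 <= r -> r <= tau / N%:R -> nrm (fun x => P r g x - g x) <= q) ->
  (forall r, 0 <= r -> r <= u -> nrm (fun x => P r w x - w x) <= m) ->
  nrm (fun x => P u (avg N) x - avg N x - u * w x) <= q + u * m + tau / N%:R * nrm w.
Proof.
move=> N0 u0 Hq Hm; have N0' : (0 : R) < N%:R by rewrite ltr0n.
pose dl := tau / N%:R; have dl0 : 0 < dl by rewrite divr_gt0.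
pose j := Num.truncn (u / dl).
have /andP[j1 j2] : j%:R <= u / dl < j.+1%:R by apply: truncn_itv; rewrite divr_ge0// ltW.
have ju : j%:R * dl <= u by rewrite -ler_pdivlMr.
have uj : u - j%:R * dl <= dl.
  by rewrite lerBlDr -{1}[dl]mul1r -mulrDl addrC natr1 -ler_pdivrMr// ltW.
pose s := j%:R * dl; have s0 : 0 <= s by exact: step_ge0.
pose v := u - s; have v0 : 0 <= v by rewrite subr_ge0.
have m0 : 0 <= m by apply: le_trans (Hm u (ltW u0) (lexx u)); exact: nrm_ge0.
have bA := time_average_bounded N; have sw := bounded_sqintble mu bounded_w.
have E x : P u (avg N) x - avg N x - u * w x =
    (P (s + v) (avg N) x - P s (avg N) x) +
    (dl * \sum_(k < j) (P (k%:R * dl) w x - w x) + - v * w x).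
  have -> : u = s + v by rewrite /v addrC subrK.
  rewrite sumrB sumr_const card_ord mulrBr -time_average_shift//.
  rewrite -[w x *+ j]mulr_natl /v /s; ring.
have s1 : sqintble (fun x => P (s + v) (avg N) x - P s (avg N) x).
  apply: bounded_sqintble; apply: bounded_measurableB; apply: sg_bounded => //.
  by rewrite addr_ge0.
have n1 : nrm (fun x => P (s + v) (avg N) x - P s (avg N) x) <= q.
  apply: shifted_dist => //.
  pose F (k : nat) x := P (k%:R * (tau / N%:R) + v) g x - P (k%:R * (tau / N%:R)) g x.
  have -> : (fun x => P v (avg N) x - avg N x) = (fun x => N%:R^-1 * \sum_(k < N) F k x).
    apply/funext => x; rewrite /F sumrB mulrBr; congr (_ - _).
    rewrite /avg sg_Z// (@sg_sum _ N (fun k => P (k%:R * (tau / N%:R)) g))//.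
    by congr (_ * _); apply: eq_bigr => k _; rewrite -(sg_add sg)// addrC.
  have [||sS nS] := @nrm_sum_le N F q.
  - move=> k _; apply: bounded_sqintble; apply: bounded_measurableB => //.
    by apply: sg_bounded => //; rewrite addr_ge0.
  - by move=> k _; apply: shifted_dist => //; exact: Hq.
  by rewrite nrmZ// gtr0_norm ?invr_gt0// mulrC ler_pdivrMr// mulrC.
have [||sS nS] := @nrm_sum_le j (fun k x => P (k%:R * dl) w x - w x) m.
- move=> k _; apply: bounded_sqintble; apply: bounded_measurableB => //.
  by apply: sg_bounded => //; exact: step_ge0.
- move=> k kj; apply: Hm; first exact: step_ge0.
  rewrite (le_trans _ ju)// ler_wpM2r ?(ltW dl0)//.
  by rewrite ler_nat ltnW.
under eq_fun do rewrite E.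
have sZ := sqintbleZ dl sS; have sv := sqintbleZ (- v) sw.
rewrite (le_trans (nrmD s1 (sqintbleD sZ sv)))// -addrA lerD//.
rewrite (le_trans (nrmD sZ sv))// lerD// nrmZ//.
  rewrite gtr0_norm// (le_trans (ler_wpM2l (ltW dl0) nS))// mulrA ler_wpM2r//.
  by rewrite mulrC.
by rewrite normrN ger0_norm// ler_wpM2r// nrm_ge0.
Qed.

(** A bounded version of the time average of the semigroup over [0, tau] lies in
    the domain of the generator, as in Hille-Yosida theory. *)
Lemma time_average_limit : exists2 v, bounded_measurable v &
  (forall e : R, 0 < e -> exists N0, forall N, (N0 <= N)%N ->
     nrm (fun x => avg N x - v x) <= e) /\ is_generator mu P v w.
Proof.
have cont (e : R) : 0 < e -> exists2 N0, (0 < N0)%N & forall N, (N0 <= N)%N ->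
    forall r, 0 <= r -> r <= tau / N%:R -> nrm (fun x => P r g x - g x) <= e.
  move=> e0; have [r r0 rP] := sg_continuous bg e0.
  exists (Num.truncn (tau / r)).+1 => // N NN s s0 sN; apply: rP => //.
  rewrite (le_trans sN)//.
  have N0' : (0 : R) < N%:R by rewrite ltr0n (leq_trans _ NN).
  rewrite ler_pdivrMr// mulrC -ler_pdivrMr//.
  by rewrite (le_trans (ltW (truncnS_gt _)))// ler_nat.
have sA N := bounded_sqintble mu (time_average_bounded N).
have [|v0 sv0 v0P] := complete_L2 sA.
  move=> e e0; have e20 : 0 < e / 2 by rewrite divr_gt0.
  have [N0 N00 H] := cont _ e20; exists N0 => N M NN NM.
  have N1 : (0 < N)%N := leq_trans N00 NN; have M1 : (0 < M)%N := leq_trans N00 NM.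
  rewrite (le_trans (nrm_triangle (sA N) (sA (N * M)%N) (sA M)))// (splitr e) lerD//.
    by rewrite nrmB; apply: time_average_refine => //; exact: H.
  by rewrite mulnC; apply: time_average_refine => //; exact: H.
have [M gM] : exists M : R, forall y, `|g y| <= M by have [] := bg.
pose M' : R := `|M|; have gM' y : `|g y| <= M' by rewrite (le_trans (gM y))// ler_norm.
have M'0 : 0 <= M' by exact: normr_ge0.
pose v x := Num.max (- M') (Num.min (v0 x) M').
have mv0 := sv0.1.
have bv : bounded_measurable v.
  split; first by apply: measurable_maxr => //; apply: measurable_minr.
  exists M' => x; rewrite ler_norml le_max lexx /= ge_max ge_min lexx orbT andbT.
  by rewrite lerNl (le_trans _ M'0)// oppr_le0.
have sv := bounded_sqintble mu bv.
have vP (e : R) : 0 < e -> exists N0, forall N, (N0 <= N)%N ->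
    nrm (fun x => avg N x - v x) <= e.
  move=> /v0P[N0 H]; exists N0 => N /H; apply: le_trans; apply: le_nrm.
  - exact: sqintbleB.
  - by have [] := sqintbleB (sA N) sv.
  by move=> x; apply: clamp_dist; exact: time_average_bound.
exists v => //; split => //.
split; [exact/sqintbleP|exact/sqintbleP/bounded_sqintble|].
rewrite lp_cvg2_rightP; [|move=> u u0|exact: bounded_sqintble]; last first.
  apply: bounded_sqintble; apply: bounded_measurableM; last exact: bounded_measurable_cst.
  by apply: bounded_measurableB => //; apply: sg_bounded => //; exact: ltW.
move=> e e0; have e20 : 0 < e / 2 by rewrite divr_gt0.
have [r r0 rP] := sg_continuous bounded_w e20.
exists r => // u u0 ur.
have bPv : bounded_measurable (P u v) by apply: sg_bounded => //; exact: ltW.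
pose q : R := u * (e / 8); have q0 : 0 < q by rewrite mulr_gt0// divr_gt0.
have [N1 N10 H1] := cont _ q0; have [N2 H2] := vP _ q0.
pose N3 := (Num.truncn (tau * nrm w / q)).+1.
pose N := maxn N1 (maxn N2 N3).
have n1 : (N1 <= N)%N by rewrite leq_maxl.
have n2 : (N2 <= N)%N by rewrite !leq_max leqnn ?orbT.
have n3 : (N3 <= N)%N by rewrite !leq_max leqnn ?orbT.
have N0 : (0 < N)%N := leq_trans N10 n1.
have N0' : (0 : R) < N%:R by rewrite ltr0n.
have h3 : tau / N%:R * nrm w <= q.
  rewrite mulrAC ler_pdivrMr// [q * _]mulrC -ler_pdivrMr//.
  by rewrite (le_trans (ltW (truncnS_gt _)))// ler_nat.
have h2 := H2 N n2.
have bA := time_average_bounded N.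
have h1 := @time_average_increment N u q (e / 2) N0 u0 (H1 N n1)
   (fun y y0 yu => rP y y0 (le_trans yu ur)).
have bd : bounded_measurable (fun x => avg N x - v x) by exact: bounded_measurableB.
have h4 : nrm (P u (fun x => avg N x - v x)) <= q.
  by apply: le_trans h2; apply: sg_contraction => //; exact: ltW.
have E : (fun x => (P u v x - v x) / u - w x) =
   (fun x => u^-1 * ((P u (avg N) x - avg N x - u * w x) +
                     (-1 * P u (fun x => avg N x - v x) x + (avg N x - v x)))).
  apply/funext => x; rewrite sg_B ?ltW//; field; exact: lt0r_neq0.
rewrite E; have sPd := bounded_sqintble mu (sg_bounded (ltW u0) bd).
have sd := bounded_sqintble mu bd.
have s1 : sqintble (fun x => P u (avg N) x - avg N x - u * w x).
  apply: bounded_sqintble; apply: bounded_measurableB; last exact: bounded_measurableZ.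
  by apply: bounded_measurableB => //; apply: sg_bounded => //; exact: ltW.
have s2 := sqintbleZ (-1) sPd; have s3 := sqintbleD s2 sd.
rewrite nrmZ; last exact: sqintbleD.
rewrite gtr0_norm ?invr_gt0// mulrC ler_pdivrMr//.
rewrite (le_trans (nrmD s1 s3))//.
have := nrmD s2 sd; rewrite nrmZ// normrN normr1 mul1r.
move: h1 h2 h3 h4; rewrite -/(w).
have -> : e * u = q + u * (e / 2) + q + (q + q) by rewrite /q; field.
move: (nrm (fun x => P u (avg N) x - avg N x - u * w x)) (nrm (fun x => avg N x - v x)).
move: (nrm (P u _)) (nrm (fun x => -1 * _ + _)) (tau / N%:R * nrm w) (u * (e / 2)).
move=> y1 y2 y3 y4 y5 y6; lra.
Qed.

(** The time average v is in the domain of the generator, so the core approximates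
    it together with its generator, and the energy is -2 times a pairing of the
    two. *)
Lemma algebra_time_average (m c : R) :
  (forall s, 0 <= s -> s <= tau -> nrm (fun x => P s g x - g x) <= m) ->
  (forall s, 0 <= s -> s <= tau -> ip (fun x => g x - P tau g x) (P s g) <= c) ->
  forall e : R, 0 < e -> exists2 u, A u &
    nrm (fun x => u x - g x) <= m + e /\ en u <= 2 / tau * c + e.
Proof.
move=> Hm Hc e e0; have [v bv [vP vw]] := time_average_limit.
have [_ /(_ v (ex_intro _ w vw))[u [Au uv Luv]]] := carre_core car.
have sv := bounded_sqintble mu bv.
have sw := bounded_sqintble mu bounded_w.
have su n := algebra_sqintble (Au n); have sLu n := L_sqintble (Au n).
have sLv : sqintble (L v) by apply: generator_sqintble; exists w.
have Lvw : {ae mu, forall x, L v x = w x}.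
  by apply: (generator_unique bv) => //; apply: generatorP; exists w.
move: uv Luv; rewrite !lp_cvg2_natP// => uv Luv.
have vg : nrm (fun x => v x - g x) <= m.
  apply/ler_addgt0Pl => q q0; have [N NP] := vP _ q0.
  have h1 := NP (maxn N 1) (leq_maxl _ _).
  have h2 := @time_average_dist (maxn N 1) m (leq_maxr _ _) Hm.
  have sA := bounded_sqintble mu (time_average_bounded (maxn N 1)).
  rewrite (le_trans (nrm_triangle sv sA (bounded_sqintble mu bg)))// lerD//.
  by rewrite nrmB.
have bh : bounded_measurable (fun x => g x - P tau g x).
  by apply: bounded_measurableB => //; apply: sg_bounded => //; exact: ltW.
have sh := bounded_sqintble mu bh.
have vc : ip (fun x => g x - P tau g x) v <= c.
  apply/ler_addgt0Pl => q q0.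
  have K0 : 0 < nrm (fun x => g x - P tau g x) + 1 by rewrite ltr_wpDl// nrm_ge0.
  have [N NP] := vP _ (divr_gt0 q0 K0).
  have h1 := NP (maxn N 1) (leq_maxl _ _).
  have h2 := @time_average_ip (maxn N 1) _ c (leq_maxr _ _) sh Hc.
  have sA := bounded_sqintble mu (time_average_bounded (maxn N 1)).
  have := le_ip sh (sqintbleB sv sA); rewrite ipBr// (nrmB mu v) => h3.
  have h4 : nrm (fun x => g x - P tau g x) * nrm (fun x => avg (maxn N 1) x - v x) <= q.
    rewrite (le_trans (ler_wpM2l (nrm_ge0 _ _) h1))// mulrA ler_pdivrMr// mulrC.
    by rewrite ler_wpM2l ?(ltW q0)// lerDl.
  move: h2 h3 h4; move: (ip _ v) (ip _ _) (nrm _ * nrm _) => y1 y2 y3; lra.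
have wh : -2 * ip v w = 2 / tau * ip (fun x => g x - P tau g x) v.
  have -> : ip v w = - tau^-1 * ip (fun x => g x - P tau g x) v.
    rewrite ipC -ipZl//; congr (ip _ v); apply/funext => x; rewrite /w; ring.
  by move: (ip _ _) => y; ring.
have K0 : 0 < 2 * (nrm v + nrm w + 1).
  by rewrite mulr_gt0// ltr_wpDl// addr_ge0// nrm_ge0.
pose q := Num.min e (Num.min 1 (e / (2 * (nrm v + nrm w + 1)))).
have q0 : 0 < q by rewrite !lt_min e0 ltr01 divr_gt0.
have q1 : q <= 1 by rewrite !ge_min lexx ?orbT.
have qe : q <= e by rewrite !ge_min lexx ?orbT.
have q2 : q * (2 * (nrm v + nrm w + 1)) <= e.
  by rewrite -ler_pdivlMr// !ge_min lexx ?orbT.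
have [N1 H1] := uv _ q0; have [N2 H2] := Luv _ q0.
pose n := maxn N1 N2; have {}H1 := H1 n (leq_maxl _ _); have {}H2 := H2 n (leq_maxr _ _).
exists (u n) => //; split.
  rewrite (le_trans (nrm_triangle (su n) sv (bounded_sqintble mu bg)))// addrC lerD//.
  exact: le_trans H1 qe.
rewrite enE//.
have Lw : nrm (fun x => L (u n) x - w x) <= q.
  apply: le_trans H2; rewrite le_eqVlt; apply/orP; left; apply/eqP; apply: eq_ae_nrm.
  - by have [] := sqintbleB (sLu n) sw.
  - by have [] := sqintbleB (sLu n) sLv.
  - by apply: filterS Lvw => x ->.
have sB1 := sqintbleB (su n) sv; have sB2 := sqintbleB (sLu n) sw.
have : ip v w - ip (u n) (L (u n)) <= q * (nrm v + nrm w + 1).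
  have -> : ip v w - ip (u n) (L (u n)) =
    - (ip (fun x => u n x - v x) w + ip (u n) (fun x => L (u n) x - w x)).
    rewrite ipBl// ipBr//.
    by move: (ip v w) (ip (u n) (L (u n))) (ip (u n) w) => y1 y2 y3; ring.
  have : ip (u n) (fun x => L (u n) x - w x) =
      ip (fun x => u n x - v x) (fun x => L (u n) x - w x) + ip v (fun x => L (u n) x - w x).
    rewrite -ipDl//; congr (ip _ _); apply/funext => x; by rewrite subrK.
  move=> ->.
  have /ler_normlP[c1 _] := cauchy_schwarz sB1 sw.
  have /ler_normlP[c2 _] := cauchy_schwarz sB1 sB2.
  have /ler_normlP[c3 _] := cauchy_schwarz sv sB2.
  have p1 := ler_wpM2r (nrm_ge0 mu w) H1.
  have p3 := ler_wpM2l (nrm_ge0 mu v) Lw.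
  have p2 : nrm (fun x => u n x - v x) * nrm (fun x => L (u n) x - w x) <= q * 1.
    apply: ler_pM => //; [exact: nrm_ge0|exact: nrm_ge0|exact: le_trans Lw q1].
  have -> : q * (nrm v + nrm w + 1) = q * nrm w + (q * 1 + nrm v * q).
    by move: (nrm v) (nrm w) => y1 y2; ring.
  rewrite !opprD; apply: lerD; first exact: le_trans c1 p1.
  by apply: lerD; [exact: le_trans c2 p2|exact: le_trans c3 p3].
have tau2 : 0 < 2 / tau by rewrite divr_gt0.
have := ler_wpM2l (ltW tau2) vc; rewrite -wh; move: q2.
move: (ip v w) (ip _ _) (_ * c) (nrm v + nrm w + 1) => y1 y2 y3 y4.
have -> : q * (2 * y4) = 2 * (q * y4) by ring.
by move: (q * y4) => y5; lra.
Qed.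

End averages.

(** Averages of the semigroup over short times are close to g by strong
    continuity, and are limits of elements of the algebra, which is a core. *)
Lemma algebra_dense g : bounded_measurable g -> forall e : R, 0 < e ->
  exists2 u, A u & nrm (fun x => u x - g x) <= e.
Proof.
move=> bg e e0; have e20 : 0 < e / 2 by rewrite divr_gt0.
have [r r0 rP] := sg_continuous bg e20; have sg' := bounded_sqintble mu bg.
pose h x := g x - P r g x.
have bh : bounded_measurable h.
  by apply: bounded_measurableB => //; apply: sg_bounded => //; exact: ltW.
have Hc s : 0 <= s -> s <= r -> ip h (P s g) <= nrm h * nrm g.
  move=> s0 _; rewrite (le_trans (le_ip (bounded_sqintble mu bh) _))//.
    exact/bounded_sqintble/sg_bounded.
  by rewrite ler_wpM2l ?nrm_ge0// sg_contraction.
have [u Au [ug _]] := algebra_time_average bg r0 rP Hc e20.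
by exists u => //; rewrite (splitr e).
Qed.

(** Expand the squared distances between P_tau g, P_s g and g; by contraction the
    first of them is at most the distance between P_(tau - s) g and g. *)
Lemma ip_increment_le g tau s : bounded_measurable g -> 0 <= s -> s <= tau ->
  ip (fun x => g x - P tau g x) (P s g) <=
  ip g (fun x => g x - P tau g x) + ip g (fun x => g x - P (tau - s) g x).
Proof.
move=> bg s0 st; have ts0 : 0 <= tau - s by rewrite subr_ge0.
have tau0 : 0 <= tau := le_trans s0 st.
have sg' := bounded_sqintble mu bg.
have bP t : 0 <= t -> bounded_measurable (P t g) by move=> t0; exact: sg_bounded.
have sP t : 0 <= t -> sqintble (P t g) by move=> t0; exact/bounded_sqintble/bP.
have sq t : 0 <= t -> nrm (P t g) ^+ 2 <= nrm g ^+ 2.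
  by move=> t0; rewrite lerXn2r ?nnegrE ?nrm_ge0// sg_contraction.
have dist t h : 0 <= t -> bounded_measurable h ->
    nrm (fun x => h x - P t g x) ^+ 2 = nrm h ^+ 2 - 2 * ip h (P t g) + nrm (P t g) ^+ 2.
  move=> t0 bh; have sh := bounded_sqintble mu bh; have sPt := sP t t0.
  rewrite !nrm2 ipBl//; last exact: sqintbleB.
  rewrite !ipBr// (ipC mu (P t g) h).
  by move: (ip h h) (ip h _) (ip (P t g) _) => y1 y2 y3; ring.
have h1 : nrm (fun x => P tau g x - P s g x) ^+ 2 <=
    nrm (fun x => g x - P (tau - s) g x) ^+ 2.
  rewrite lerXn2r ?nnegrE ?nrm_ge0//.
  have -> : (fun x => P tau g x - P s g x) = (fun x => P (s + (tau - s)) g x - P s g x).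
    by rewrite addrC subrK.
  by apply: shifted_dist => //; rewrite nrmB.
have h2 := sqr_ge0 (nrm (fun x => g x - P s g x)).
have h3 := sqr_ge0 (nrm (fun x => g x - P tau g x)).
have h4 := sq _ ts0; have h5 := sq _ tau0.
move: h1 h2 h3; rewrite (dist s _ s0 (bP tau tau0)) (dist _ _ ts0 bg).
rewrite (dist s _ s0 bg) (dist tau _ tau0 bg).
rewrite ipBl//; [|exact: sP..].
rewrite ipBr//; last exact: sP.
rewrite ipBr//; last exact: sP.
rewrite -(nrm2 mu g).
move: h4 h5; move: (ip (P tau g) (P s g)) (ip g (P s g)) (ip g (P tau g)) (ip g (P (tau - s) g)).
move: (nrm g ^+ 2) (nrm (P s g) ^+ 2) (nrm (P tau g) ^+ 2) (nrm (P (tau - s) g) ^+ 2).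
move=> y1 y2 y3 y4 y5 y6 y7 y8; lra.
Qed.

(** Time averages of g over a short interval are approximated within the algebra
    with a controlled energy, without spectral calculus for the nonsymmetric
    generator; the price is the factor 4. *)
Lemma relaxed_energy_of_increments g (c : R) : bounded_measurable g ->
  (forall e : R, 0 < e -> exists2 r : R, 0 < r & forall s, 0 < s -> s <= r ->
     ip g (fun x => g x - P s g x) <= s * (c + e)) ->
  relaxed_energy_le g (4 * c).
Proof.
move=> bg H; split; first exact: bounded_sqintble.
move=> e e0; have e80 : 0 < e / 8 by rewrite divr_gt0.
have e20 : 0 < e / 2 by rewrite divr_gt0.
have [r r0 rP] := H _ e80; have [q q0 qP] := sg_continuous bg e20.
pose tau := Num.min r q; have tau0 : 0 < tau by rewrite lt_min r0.
have tr : tau <= r by rewrite ge_min lexx.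
have tq : tau <= q by rewrite ge_min lexx orbT.
have c0 : 0 <= c + e / 8.
  have k0 : 0 <= ip g (fun x => g x - P r g x).
    have sg' := bounded_sqintble mu bg; have bP := sg_bounded (ltW r0) bg.
    rewrite ipBr//; last exact: bounded_sqintble.
    have := le_ip sg' (bounded_sqintble mu bP).
    have := ler_wpM2l (nrm_ge0 mu g) (sg_contraction (ltW r0) bg).
    rewrite subr_ge0 -(nrm2 mu g) expr2 => h1 h2; exact: le_trans h2 h1.
  by have := le_trans k0 (rP r r0 (lexx r)); rewrite pmulr_rge0.
have kP s : 0 <= s -> s <= tau -> ip g (fun x => g x - P s g x) <= tau * (c + e / 8).
  move=> s0 st; apply: (@le_trans _ _ (s * (c + e / 8))); last exact: ler_wpM2r.
  move: s0; rewrite le_eqVlt => /predU1P[<-|s0]; last exact: rP s0 (le_trans st tr).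
  have -> : (fun x => g x - P 0 g x) = cst 0 by apply/funext => x; rewrite (sg_0 sg)// subrr.
  by rewrite ipC ip0l mul0r.
have Hm s : 0 <= s -> s <= tau -> nrm (fun x => P s g x - g x) <= e / 2.
  by move=> s0 st; apply: qP => //; exact: le_trans st tq.
have Hc s : 0 <= s -> s <= tau ->
    ip (fun x => g x - P tau g x) (P s g) <= 2 * (tau * (c + e / 8)).
  move=> s0 st; rewrite (le_trans (ip_increment_le bg s0 st))// mulrDl mul1r.
  apply: lerD; apply: kP => //; [exact: ltW|by rewrite subr_ge0|].
  by rewrite gerBl.
have [u Au [ug ue]] := algebra_time_average bg tau0 Hm Hc e20.
exists u => //; rewrite {1}(splitr e); split => //.
rewrite (le_trans ue)//.
have -> : 2 / tau * (2 * (tau * (c + e / 8))) = 4 * c + e / 2.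
  by field; exact: lt0r_neq0.
by rewrite [in leRHS](splitr e) addrA.
Qed.

(** * The adjoint semigroup on densities *)

Lemma adjointB t f g : 0 <= t -> intble f -> intble g ->
  {ae mu, forall x, Pd t (fun y => f y - g y) x = Pd t f x - Pd t g x}.
Proof.
move=> t0 If Ig; have Pf := adjoint_intble t0 If; have Pg := adjoint_intble t0 Ig.
apply: adjoint_testP => //; [exact: intbleB|exact: intbleB|move=> h bh].
rewrite rint_mulBr// !adjoint_dual// rint_mulBr//.
exact: sg_bounded.
Qed.

Lemma adjoint_0 h : intble h -> {ae mu, forall x, Pd 0 h x = h x}.
Proof.
move=> Ih; apply: adjoint_testP => // f bf; congr (rint _); apply/funext => x.
by rewrite (sg_0 sg).
Qed.

Lemma adjoint_mean t h : 0 <= t -> intble h -> rint (Pd t h) = rint h.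
Proof.
move=> t0 Ih; have b1 := bounded_measurable_cst T (1 : R).
have := adjoint_dual t0 Ih b1.
rewrite (_ : (fun x => _) = Pd t h); last by apply/funext => x; rewrite /= mul1r.
by move=> ->; congr (rint _); apply/funext => x; rewrite (sg_cst sg)// mul1r.
Qed.

Lemma adjoint_ge0 t h : 0 <= t -> intble h -> (forall x, 0 <= h x) ->
  {ae mu, forall x, 0 <= Pd t h x}.
Proof.
move=> t0 Ih h0; apply: ae_ge0_of_rint; first exact: adjoint_intble.
move=> B mB; have bB := bounded_measurable_indic R mB.
rewrite adjoint_dual//; apply: rint_ge0 => x; apply: mulr_ge0 => //.
by apply: (sg_ge0 sg) => // y; rewrite indicE.
Qed.

(** Duality against the sign of the image. *)
Lemma adjoint_L1_contraction t h : 0 <= t -> intble h ->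
  rint (fun x => `|Pd t h x|) <= rint (fun x => `|h x|).
Proof.
move=> t0 Ih; have Ip := adjoint_intble t0 Ih.
pose B := [set x | 0 <= Pd t h x].
have mB : measurable B.
  rewrite (_ : B = [set: T] `&` Pd t h @^-1` `[0, +oo[).
    exact: (intble_measurable Ip).
  by apply/seteqP; split => x /=; rewrite in_itv /= andbT // => -[].
pose u x : R := 2 * \1_B x + cst (-1) x.
have bB := bounded_measurable_indic R mB.
have bu : bounded_measurable u.
  by apply: bounded_measurableD; [exact: bounded_measurableZ|exact: bounded_measurable_cst].
have u1 x : `|u x| <= 1.
  rewrite /u indicE /=; have [_|_] := boolP (x \in B); first by rewrite mulr1 ger0_norm; lra.
  by rewrite mulr0 add0r normrN1.
have -> : (fun x => `|Pd t h x|) = (fun x => u x * Pd t h x).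
  apply/funext => x; rewrite /u indicE /=; have [/set_mem Bx|nB] := boolP (x \in B).
    by rewrite ger0_norm// mulr1; ring.
  have : Pd t h x < 0 by rewrite ltNge; apply: contra nB => h0; exact: mem_set.
  by move=> /ltW h0; rewrite ler0_norm// mulr0 add0r mulN1r.
rewrite adjoint_dual//; have bP := sg_bounded t0 bu.
have IuP := intble_bounded_mul bP Ih.
apply: (le_trans (ler_norm _)); apply: (le_trans (le_norm_rint IuP)).
apply: le_rint; [exact: intble_abs|exact: intble_abs|move=> x].
rewrite normrM -[leRHS]mul1r; apply: ler_wpM2r => //.
exact: sg_bound.
Qed.

(** Duality against a truncation of the image, whose norm it then bounds. *)
Lemma adjoint_L2_contraction t h : 0 <= t -> sqintble h ->
  sqintble (Pd t h) /\ nrm (Pd t h) <= nrm h.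
Proof.
move=> t0 sh; have Ih := sqintble_intble sh; have Ip := adjoint_intble t0 Ih.
have mp := intble_measurable Ip.
pose u (N : nat) x : R := Num.max (- N%:R) (Num.min N%:R (Pd t h x)).
have bu N : bounded_measurable (u N).
  split.
    have := measurable_continuous_comp (@clamp_continuous R (- N%:R) N%:R) mp.
    by rewrite /u /comp /=.
  by exists N%:R => x; apply: clamp_norm.
have uP N x : u N x ^+ 2 <= u N x * Pd t h x.
  exact: clamp_sqr_le.
have nu N : nrm (u N) <= nrm h.
  have su := bounded_sqintble mu (bu N); have bP := sg_bounded t0 (bu N).
  have H : nrm (u N) ^+ 2 <= nrm (u N) * nrm h.
    rewrite nrm2; apply: (@le_trans _ _ (rint (fun x => u N x * Pd t h x))).
      apply: le_rint; [exact: su.2|exact: intble_bounded_mul|].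
      by move=> x; have := uP N x; rewrite expr2.
    rewrite adjoint_dual//; apply: (le_trans (le_ip (bounded_sqintble mu bP) sh)).
    by apply: ler_wpM2r; [exact: nrm_ge0|exact: sg_contraction].
  have := nrm_ge0 mu (u N); rewrite le_eqVlt => /predU1P[<-|u0]; first exact: nrm_ge0.
  by rewrite -(ler_pM2l u0) -expr2.
have [I2 r2] : intble (fun x => Pd t h x ^+ 2) /\ rint (fun x => Pd t h x ^+ 2) <= nrm h ^+ 2.
  apply: (@fatou_rint _ _ _ _ (fun N x => u N x ^+ 2)).
  - by move=> N; have [] := bounded_sqintble mu (bu N).
  - by move=> N x; exact: sqr_ge0.
  - exact: measurable_funX.
  - apply: aeW => x; apply: cvg_near_cst; exists (Num.bound `|Pd t h x|) => // n /= hn.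
    have : `|Pd t h x| <= n%:R.
      apply: (le_trans (ltW (archi_boundP (normr_ge0 _)))); by rewrite ler_nat.
    move=> /ler_normlP[h1 h2]; rewrite /u (min_idPr h2) (max_idPr _)//; lra.
  - move=> N; have := nu N; rewrite (nrm_le _ _ (nrm_ge0 mu h)).
    by congr (_ <= _); congr (rint _); apply/funext => x; rewrite expr2.
  - by apply: aeW => x; exact: sqr_ge0.
split => //; rewrite nrm_le ?nrm_ge0//.
Qed.

(** The inequality between the values of f at two points is integrated first
    in one of them against the transition kernel, then in the other one
    against mu, whose invariance cancels the two terms in Psi. *)
Lemma adjoint_dissipation (k : R) (Psi Theta : R -> R) f s : 0 <= s ->
  bounded_measurable f -> continuous Psi -> continuous Theta ->
  (forall p q, k / 2 * (Theta p - Theta q) ^+ 2 <= Psi p - Psi q - Theta q * (p - q)) ->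
  k * ip (Theta \o f) (fun x => Theta (f x) - P s (Theta \o f) x) <=
    ip (Theta \o f) f - rint (fun x => Theta (f x) * Pd s f x).
Proof.
move=> s0 bf cPsi cTheta H.
pose u := Theta \o f; pose v := Psi \o f.
have bu : bounded_measurable u by exact: bounded_measurable_comp.
have bv : bounded_measurable v by exact: bounded_measurable_comp.
pose w x := u x * f x; have bw : bounded_measurable w by exact: bounded_measurableM.
pose z x := u x * u x; have bz : bounded_measurable z by exact: bounded_measurableM.
(* The inequality at the points f x and f y, integrated in y against the kernel at x. *)
have pw x : 0 <= v x - P s v x - P s u x * f x + P s w x
    - k / 2 * (u x * u x) + k * (u x * P s u x) - k / 2 * P s z x.
  pose g y : R := (k * u x - f x) * u y + (1 * w y + (- (k / 2) * z y
    + (-1 * v y + cst (v x - k / 2 * (u x * u x)) y))).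
  have g0 y : 0 <= g y.
    have : k / 2 * (u x - u y) ^+ 2 <= v x - v y - u y * (f x - f y) by exact: H.
    rewrite -subr_ge0 /g /z /w /= expr2.
    by move: (u x) (u y) (v x) (v y) (f x) (f y) => p1 p2 p3 p4 p5 p6; lra.
  have b1 : bounded_measurable (cst (v x - k / 2 * (u x * u x)) : T -> R).
    exact: bounded_measurable_cst.
  have b2 := bounded_measurableD (bounded_measurableZ (-1) bv) b1.
  have b3 := bounded_measurableD (bounded_measurableZ (- (k / 2)) bz) b2.
  have b4 := bounded_measurableD (bounded_measurableZ 1 bw) b3.
  have bg := bounded_measurableD (bounded_measurableZ (k * u x - f x) bu) b4.
  have := sg_ge0 sg x s0 bg g0; rewrite /g !(sg_linear sg) ?(sg_cst sg)//.
  move: (P s u x) (P s w x) (P s z x) (P s v x) (u x) (v x) (f x).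
  by move=> p1 p2 p3 p4 p5 p6 p7; lra.
have su := bounded_sqintble mu bu; have sf := bounded_sqintble mu bf.
have bPu := sg_bounded s0 bu; have sPu := bounded_sqintble mu bPu.
have Iv := bounded_intble mu bv; have IPv := bounded_intble mu (sg_bounded s0 bv).
have Iw := bounded_intble mu bw; have IPw := bounded_intble mu (sg_bounded s0 bw).
have Iz := bounded_intble mu bz; have IPz := bounded_intble mu (sg_bounded s0 bz).
have IuPu := intble_mul su sPu; have IPuf := intble_mul sPu sf.
have : 0 <= rint (fun x => (v x - P s v x) + (P s w x - P s u x * f x)
    + (k * (u x * P s u x) - k / 2 * (z x + P s z x))).
  apply: rint_ge0 => x; have := pw x; rewrite /z.
  move: (P s u x) (P s w x) (P s (fun x => u x * u x) x) (P s v x) (u x) (v x) (f x).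
  by move=> p1 p2 p3 p4 p5 p6 p7; lra.
have I1 := intbleB Iv IPv; have I2 := intbleB IPw IPuf.
have I3 := intbleZ k IuPu; have I4 := intbleD Iz IPz; have I5 := intbleZ (k / 2) I4.
rewrite (rintD (intbleD I1 I2) (intbleB I3 I5)) (rintD I1 I2) (rintB Iv IPv).
rewrite (rintB IPw IPuf) (rintB I3 I5) (rintZ _ IuPu) (rintZ _ I4) (rintD Iz IPz).
rewrite !(sg_invariant sg)// subrr add0r.
have -> : ip (Theta \o f) (fun x => Theta (f x) - P s (Theta \o f) x) =
    ip u u - ip u (P s u) by exact: (ipBr su sPu su).
have -> : rint (fun x => Theta (f x) * Pd s f x) = rint (fun x => P s u x * f x).
  by rewrite adjoint_dual//; exact: bounded_intble.
rewrite -/u; have -> : rint w = ip u f by [].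
have -> : rint z = ip u u by [].
have -> : rint (fun x => u x * P s u x) = ip u (P s u) by [].
move: (ip u f) (ip u u) (ip u (P s u)) (rint (fun x => P s u x * f x)).
by move=> p1 p2 p3 p4; lra.
Qed.

(** As a function of p the gap vanishes at q, and its derivative, the product of
    Theta p - Theta q and 1 - k dTheta p, has the sign of p - q. *)
Lemma convexity_gap (k : R) (Psi Theta dTheta : R -> R) :
  has_derivative Psi Theta -> has_derivative Theta dTheta -> 0 <= k ->
  (forall z, 0 <= dTheta z) -> (forall z, k * dTheta z <= 1) ->
  forall p q, k / 2 * (Theta p - Theta q) ^+ 2 <= Psi p - Psi q - Theta q * (p - q).
Proof.
move=> dPsi dTh k0 th0 th1 p q.
pose D x := Psi x + (- Theta q * x + (Theta q * q - Psi q))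
  + - (k / 2) * ((Theta x + (- Theta q)) * (Theta x + (- Theta q))).
have DD : has_derivative D (fun z => Theta z + - Theta q
    + - (k / 2) * ((Theta z + - Theta q) * dTheta z + (Theta z + - Theta q) * dTheta z)).
  have H : has_derivative (fun x => Theta x + - Theta q) dTheta.
    move=> z; have d1 := dTh z; rewrite -[dTheta z]addr0.
    by apply: is_deriveD.
  apply: has_derivativeD; last first.
    by apply: has_derivativeZ => z; have Hz := H z; exact: is_deriveM.
  by apply: has_derivativeD => //; exact: has_derivative_affine.
have mono := nondecreasing_primitive dTh th0.
suff Ds z : 0 <= (Theta z + - Theta q
    + - (k / 2) * ((Theta z + - Theta q) * dTheta z + (Theta z + - Theta q) * dTheta z)) * (z - q).
  have := derive_sign_min DD Ds p; rewrite /D !expr2; lra.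
have -> : Theta z + - Theta q
    + - (k / 2) * ((Theta z + - Theta q) * dTheta z + (Theta z + - Theta q) * dTheta z)
    = (Theta z - Theta q) * (1 - k * dTheta z) by lra.
rewrite mulrAC; apply: mulr_ge0; last by rewrite subr_ge0.
have [zq|/ltW qz] := leP z q.
  by apply: mulr_le0; rewrite subr_le0//; exact: mono.
by apply: mulr_ge0; rewrite subr_ge0//; exact: mono.
Qed.

(** * The functional inequality for relaxed energies *)

Section functional_inequality.
Variables (CP : R) (eta : R -> R) (b a rho Ccap : R) (F : R -> R).
Hypotheses (poincareP : poincare mu P A CP) (etaP : H_eta eta b).
Hypotheses (ab : Num.max 2 b < a) (rho1 : 1 < rho).
Hypothesis F_nondecreasing : {in `]0, +oo[ &, {homo F : u v / u <= v}}.
Hypothesis F_gt0 : forall u, a < u -> 0 < F u.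
Hypothesis F_capacity : forall B, measurable B -> (0 < mu B < (2^-1)%:E)%E ->
  (mu B * (F ((fine (mu B))^-1))%:E <= capacity mu P A B)%E.
Hypothesis F_eta : forall u, a < u ->
  eta (rho * u) / (u ^+ 2 * derive1n 2 eta u * F u) <= Ccap.
Local Notation level := (level a rho).
Local Notation cutoff := (cutoff a rho).
Local Notation low_cutoff := (low_cutoff a rho).
Local Notation weight := (weight eta a rho).
Local Notation low_weight := (Defs.psi2 eta a (level 2)).
Local Notation chi := (chi eta a).

Lemma energyE f : dirichlet_dom mu P A f -> energy mu P A f = (rint (carre mu P A f))%:E.
Proof. by move=> /carreP /is_carreP[_ iG _]; rewrite /energy rintE. Qed.

(** CP has no prescribed sign, whence the absolute value. *)
Lemma poincare_relaxed f (c : R) : relaxed_energy_le f c ->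
  rint (fun x => f x ^+ 2) - rint f ^+ 2 <= `|CP| * c.
Proof.
move=> fc; have [df ec] := energy_le fc; have [sf _] := fc.
have := poincareP df; move: ec; rewrite (energyE df) lee_fin => ec.
rewrite (rintE (sf.2)) (rintE (sqintble_intble sf)) -EFin_expe -EFinB -EFinM lee_fin.
move/le_trans; apply; apply: (@le_trans _ _ (`|CP| * rint (carre mu P A f))).
  apply: ler_wpM2r (ler_norm _); rewrite -(rint_cst mu 0).
  have /is_carreP[_ iG _] := carreP df.
  by apply: ae_le_rint (intble_cst _ _) iG _; exact: carre_ge0.
exact: ler_wpM2l.
Qed.

Lemma capacity_le (B O : set T) f (c : R) : relaxed_energy_le f c ->
  measurable O -> B `<=` O -> (mu O <= (2^-1)%:E)%E ->
  (forall x, \1_B x <= f x <= \1_O x) -> (capacity mu P A B <= c%:E)%E.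
Proof.
move=> fc mO BO O2 fBO; have [df ec] := energy_le fc.
apply: (@le_trans _ _ (capacity_in mu P A B O)).
  by apply: ereal_inf_lbound; exists O.
by apply: le_trans ec; apply: ereal_inf_lbound; exists f.
Qed.

(** The last factor comes from the height of a cutoff, which is at least a
    quarter of the gap between the two levels. *)
Definition capacity_constant : R :=
  `|Ccap| * derive1n 2 eta a * (4 * rho / (rho - 1)) ^+ 2.

Lemma capacity_constant_ge0 : 0 <= capacity_constant.
Proof.
rewrite /capacity_constant; apply: mulr_ge0; last first.
  exact: sqr_ge0.
by apply: mulr_ge0 => //; exact/ltW/(eta2_gt0 etaP ab).
Qed.

(** The truncation of f between two consecutive levels, normalised to have
    height 1, is a competitor for the capacity of the upper superlevel set. *)
Lemma level_capacity f k (c : R) : measurable_fun [set: T] f -> intble f ->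
  (forall x, 0 <= f x) -> rint f = 1 -> relaxed_energy_le (cutoff k \o f) c ->
  eta (level k.+2) * rint \1_[set x | level k.+1 <= f x] <=
    capacity_constant * (weight k * c).
Proof.
move=> mf fi f0 f1 fc; have c0 := relaxed_energy_ge0 fc.
have w0 : 0 < weight k by exact: psi2_gt0 etaP ab _.
set B := [set x | _]; have mB : measurable B by exact: measurable_superlevel.
set l := level k; set l1 := level k.+1.
have l0 : 0 < l := level_gt0 ab rho1 k; have ll1 : l < l1 := level_lt ab rho1 k.
have al : a <= l := level_ge_a ab rho1 k; have a2 := a_gt2 ab.
have m0 : 0 <= rint \1_B by apply: rint_ge0 => x; rewrite indicE ler0n.
have mB1 : l1 * rint \1_B <= 1.
  by rewrite -f1; apply: markov_bound.
have [->|mne] := eqVneq (rint \1_B) 0.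
  by rewrite mulr0; apply: mulr_ge0 capacity_constant_ge0 (mulr_ge0 (ltW w0) c0).
have {mne}mp : 0 < rint \1_B by rewrite lt_neqAle eq_sym mne.
set m := rint \1_B in m0 mB1 mp *.
set z := cutoff k l1.
have hz : (l1 - l) / 4 <= z := cutoff_height ab rho1 k.
have z0 : 0 < z by rewrite (lt_le_trans _ hz)// divr_gt0// subr_gt0.
pose O := [set x | l < f x].
have mO : measurable O by exact: measurable_strict_superlevel.
have cap : (capacity mu P A B <= (z^-1 ^+ 2 * c)%:E)%E.
  apply: (capacity_le (relaxed_energyZ z^-1 fc) mO).
  - by move=> x; exact: lt_le_trans.
  - rewrite -rint_indic// lee_fin.
    have : l * rint \1_O <= 1 by rewrite -f1; apply: markov_bound => // x; exact: ltW.
    have : 0 <= rint \1_O by apply: rint_ge0 => x; rewrite indicE ler0n.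
    by move: (rint \1_O) => q q0; nra.
  - move=> x; rewrite /= mulrC !indicE; apply/andP; split.
      have [/set_mem Bx|_] := boolP (x \in B); last first.
        exact: divr_ge0 (cutoff_ge0 ab rho1 _ _) (ltW z0).
      by rewrite (cutoff_high ab rho1) ?divff// lt0r_neq0.
    have [_|nO] := boolP (x \in O); first by rewrite ler_pdivrMr// mul1r (cutoff_le ab rho1).
    rewrite (cutoff_low ab rho1) ?mul0r// leNgt; apply/negP => h.
    by move/negP: nO; apply; exact: mem_set.
have mBE : mu B = m%:E by rewrite -rint_indic.
have mlt : m < 2^-1 by nra.
have := F_capacity mB; rewrite mBE !lte_fin mp mlt /= => /(_ isT) /le_trans /(_ cap).
rewrite -EFinM lee_fin => hF.
(* By Markov's inequality 1 / m is at least the level. *)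
have Fl : F l1 <= F m^-1.
  apply: F_nondecreasing; rewrite ?in_itv /= ?andbT ?invr_gt0//.
    exact: lt_trans ll1.
  by rewrite -[leRHS]mul1r ler_pdivlMr.
have al1 : a < l1 by exact: le_lt_trans ll1.
have := F_eta al1; have Fp := F_gt0 al1.
have e0 : 0 < derive1n 2 eta l1 by exact: eta2_gt0 etaP ab _ (ltW al1).
have ea : 0 < derive1n 2 eta a by exact: eta2_gt0 etaP ab _ (lexx _).
have wE : weight k * derive1n 2 eta a = derive1n 2 eta l1.
  have -> : weight k = Defs.psi2 eta a l1 by [].
  by rewrite (psi2E etaP ab) (max_idPl (ltW al1)) mulfVK// lt0r_neq0.
rewrite -(levelS a rho) -/l1 /capacity_constant.
have l1E : l1 = rho * l := levelS a rho k.
move: (eta (level k.+2)) => e; rewrite -wE.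
move: (derive1n 2 eta a) (weight k) ea w0 => ea w ea0 w0.
have lsq : 0 < l1 ^+ 2 * (w * ea).
  by apply: mulr_gt0 (mulr_gt0 w0 ea0); rewrite exprn_gt0// (lt_trans l0).
have lF := mulr_gt0 lsq Fp.
rewrite ler_pdivrMr// => h.
have {}h : e <= `|Ccap| * (l1 ^+ 2 * (w * ea) * F l1).
  by apply: (le_trans h); apply: ler_wpM2r (ler_norm _); exact: ltW.
apply: (@le_trans _ _ (`|Ccap| * (l1 ^+ 2 * (w * ea)) * (z^-1 ^+ 2 * c))).
  apply: (@le_trans _ _ (`|Ccap| * (l1 ^+ 2 * (w * ea)) * (m * F l1))).
    by apply: (le_trans (ler_wpM2r m0 h)); rewrite -!mulrA [F l1 * m]mulrC.
  apply: ler_wpM2l; first exact: mulr_ge0 (normr_ge0 _) (ltW lsq).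
  by apply: le_trans hF; exact: ler_wpM2l.
have hlz : l1 ^+ 2 * z^-1 ^+ 2 <= (4 * rho / (rho - 1)) ^+ 2.
  rewrite -exprMn; have r0 : 0 < rho - 1 by rewrite subr_gt0.
  apply: lerXn2r; rewrite ?nnegrE.
  - by rewrite divr_ge0// ?(ltW z0)// (le_trans (ltW l0))// ltW.
  - by rewrite divr_ge0 ?(ltW r0)// mulr_ge0// (le_trans ler01)// ltW.
  rewrite ler_pdivrMr// mulrAC ler_pdivlMr// l1E.
  rewrite -[rho * l * _]mulrA [4 * rho]mulrC -[rho * 4 * z]mulrA.
  apply: (ler_wpM2l (le_trans ler01 (ltW rho1))).
  by rewrite mulrBr mulr1 [l * rho]mulrC -l1E [4 * z]mulrC -ler_pdivrMr.
have H := ler_wpM2l (mulr_ge0 (mulr_ge0 (normr_ge0 Ccap) (mulr_ge0 (ltW w0) (ltW ea0))) c0) hlz.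
move: H; move: (`|Ccap|) (l1 ^+ 2) (z^-1 ^+ 2) ((4 * rho / (rho - 1)) ^+ 2) => q1 q2 q3 q4.
have -> : q1 * (w * ea) * c * (q2 * q3) = q1 * (q2 * (w * ea)) * (q3 * c) by ring.
by have -> : q1 * (w * ea) * c * q4 = q1 * ea * q4 * (w * c) by ring.
Qed.

(** The entropy above the first level, plus a multiple of the mass that the low
    cutoff removes. *)
Definition high_part (u : R) : R := if level 1 <= u then chi u + u / 2 else 0.

Lemma high_part_ge0 u : 0 <= high_part u.
Proof.
rewrite /high_part; case: ifP => // u1; apply: addr_ge0; first exact: chi_ge0 etaP ab _.
by rewrite divr_ge0// (le_trans _ u1)// ltW// (level_gt0 ab rho1).
Qed.

Lemma high_part_measurable f : measurable_fun [set: T] f ->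
  measurable_fun [set: T] (high_part \o f).
Proof.
move=> mf; have mB : measurable [set x | level 1 <= f x] by exact: measurable_superlevel.
rewrite (_ : high_part \o f =
  (fun x => \1_[set x | level 1 <= f x] x * (chi (f x) + f x / 2))).
  apply: measurable_funM; first by have [] := bounded_measurable_indic R mB.
  apply: measurable_funD; first exact: (measurable_continuous_comp (chi_continuous etaP ab) mf).
  exact: measurable_funM.
apply/funext => x; rewrite /= /high_part indicE; case: ifP => fx; first by rewrite mem_set// mul1r.
by rewrite memNset ?mul0r//= fx.
Qed.

(** The term of the layer that contains the value of f is large enough alone. *)
Lemma high_part_le_sum (C : R) f N x : 0 < C ->
  (forall u, a <= u -> chi u + u / 2 <= C * eta u) -> f x < level N.+1 ->
  high_part (f x) <=
    \sum_(k < N) C * eta (level k.+2) * \1_[set x | level k.+1 <= f x] x.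
Proof.
move=> C0 CP1; elim: N => [|N IH] fN.
  by rewrite big_ord0 /high_part; case: ifP => // h; move: fN; rewrite ltNge h.
rewrite big_ord_recr /=; set S := \sum_(k < N) _ in IH *.
have t0 k : 0 <= C * eta (level k.+2) * \1_[set x | level k.+1 <= f x] x.
  apply: mulr_ge0; last by rewrite indicE.
  apply: mulr_ge0 (ltW C0) (eta_ge0 etaP _); exact/ltW/(level_gt0 ab rho1).
have [fN1|fN1] := ltP (f x) (level N.+1).
  by apply: (le_trans (IH fN1)); rewrite lerDl.
have S0 : 0 <= S by apply: sumr_ge0 => k _.
have af := le_trans (level_ge_a ab rho1 N.+1) fN1.
rewrite indicE mem_set// mulr1 /high_part ifT; last first.
  by apply: le_trans fN1; exact: (level_le ab rho1).
apply: (le_trans (CP1 _ af)); rewrite -[leLHS]add0r; apply: lerD S0 _.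
by apply: (ler_wpM2l (ltW C0)); exact: (eta_le etaP ab af (ltW fN)).
Qed.

(** Each layer costs a weighted energy by the capacity bound; letting the number
    of layers grow, Fatou's lemma gives the whole superlevel set. *)
Lemma high_part_bound f (c : nat -> R) (K C : R) : measurable_fun [set: T] f ->
  intble f -> (forall x, 0 <= f x) -> rint f = 1 -> 0 < C ->
  (forall u, a <= u -> chi u + u / 2 <= C * eta u) ->
  (forall k, relaxed_energy_le (cutoff k \o f) (c k)) ->
  (forall N, \sum_(k < N) weight k * c k <= K) ->
  intble (high_part \o f) /\ rint (high_part \o f) <= C * capacity_constant * K.
Proof.
move=> mf fi f0 f1 C0 CP1 fc cK.
pose B k := [set x | level k.+1 <= f x].
have mB k : measurable (B k) by exact: measurable_superlevel.
pose D N := [set x | f x < level N.+1].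
have mD N : measurable (D N).
  rewrite (_ : D N = ~` B N); first exact: measurableC.
  apply/seteqP; split => x; rewrite /D /B /= => h; first by apply/negP; rewrite -ltNge.
  by rewrite ltNge; apply/negP.
pose u N x := high_part (f x) * \1_(D N) x.
pose S N x := \sum_(k < N) C * eta (level k.+2) * \1_(B k) x.
have e0 k : 0 <= C * eta (level k.+2).
  apply: mulr_ge0 (ltW C0) (eta_ge0 etaP _); exact/ltW/(level_gt0 ab rho1).
have bS N : bounded_measurable (S N).
  apply: bounded_measurable_sum => k; apply: bounded_measurableZ.
  exact: bounded_measurable_indic.
have u0 N x : 0 <= u N x by rewrite mulr_ge0 ?high_part_ge0// indicE.
have S0 N x : 0 <= S N x by apply: sumr_ge0 => k _; rewrite mulr_ge0// indicE.
have uS N x : u N x <= S N x.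
  rewrite /u indicE; have [/set_mem Dx|_] := boolP (x \in D N); last by rewrite mulr0.
  by rewrite mulr1; exact: high_part_le_sum.
have mu_ N : measurable_fun [set: T] (u N).
  apply: measurable_funM; first exact: high_part_measurable.
  by have [] := bounded_measurable_indic R (mD N).
have iu N : intble (u N).
  apply: le_intble (mu_ N) _ (bounded_intble mu (bS N)) => x.
  by rewrite ger0_norm.
have rS N : rint (S N) <= C * capacity_constant * K.
  apply: (@le_trans _ _ (C * capacity_constant * \sum_(k < N) weight k * c k)); last first.
    by apply: ler_wpM2l => //; exact: mulr_ge0 (ltW C0) capacity_constant_ge0.
  elim: N => [|N IH].
    rewrite big_ord0 mulr0 (_ : S 0%N = cst 0) ?rint_cst//.
    by apply/funext => x; rewrite /S big_ord0.
  have -> : S N.+1 = (fun x => S N x + C * eta (level N.+2) * \1_(B N) x).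
    by apply/funext => x; rewrite /S big_ord_recr.
  have iB : intble \1_(B N) by exact/bounded_intble/bounded_measurable_indic.
  rewrite rintD; [|exact/bounded_intble/bS|exact: intbleZ].
  rewrite big_ord_recr mulrDr /= rintZ//; apply: lerD => //.
  rewrite -[C * eta _ * _]mulrA -[C * _ * (_ * _)]mulrA; apply: (ler_wpM2l (ltW C0)).
  exact: level_capacity mf fi f0 f1 (fc N).
apply: (@fatou_rint _ _ _ _ u) => //.
- exact: high_part_measurable.
- apply: aeW => x; apply: cvg_near_cst; have [N fN] := level_unbounded ab rho1 (f x).
  exists N => // n /= Nn; rewrite /u indicE mem_set ?mulr1//.
  apply: (le_lt_trans fN); apply: (le_lt_trans (level_le ab rho1 Nn)).
  exact: (level_lt ab rho1).
- by move=> N; apply: le_trans (rS N); apply: le_rint (iu N) (bounded_intble mu (bS N)) _.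
- by apply: aeW => x; exact: high_part_ge0.
Qed.

(** The functional inequality with the weighted energy cut into layers. It only
    involves relaxed energies of truncations, and so makes sense for a density
    that is not known to belong to the Dirichlet domain. *)
Definition layered_inequality (C : R) :=
  forall f (c0 : R) (c : nat -> R) (K : R),
    sqintble f -> (forall x, 0 <= f x) -> rint f = 1 ->
    relaxed_energy_le (low_cutoff \o f) c0 ->
    (forall k, relaxed_energy_le (cutoff k \o f) (c k)) ->
    (forall N, low_weight * c0 + \sum_(k < N) weight k * c k <= K) ->
    rint (chi \o f) <= C * K.

(** Below the first level the entropy is quadratic and is controlled by the
    Poincare inequality; above it the capacities take over. *)
Lemma relaxed_functional_inequality : exists2 C : R, 0 <= C & layered_inequality C.
Proof.
have [C C0 CP1] := chi_le_eta etaP ab.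
have w0 : 0 < low_weight by exact: psi2_gt0 etaP ab _.
exists (`|CP| / low_weight / 2 + 2 * (C * capacity_constant)).
  have h1 := capacity_constant_ge0; have h2 := normr_ge0 CP.
  apply: addr_ge0; last exact: mulr_ge0 (mulr_ge0 (ltW C0) h1).
  by apply: divr_ge0 => //; exact: divr_ge0 h2 (ltW w0).
move=> f c0 c K sf f0 f1 fc0 fc cK; have [mf _] := sf; have fi := sqintble_intble sf.
have c00 := relaxed_energy_ge0 fc0.
have c0K : c0 <= K / low_weight.
  by rewrite ler_pdivlMr// mulrC; have := cK 0%N; rewrite big_ord0 addr0.
have cK' N : \sum_(k < N) weight k * c k <= K.
  by apply: le_trans (cK N); rewrite lerDr mulr_ge0// ltW.
have [iW rW] := high_part_bound mf fi f0 f1 C0 CP1 fc cK'.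
pose g := low_cutoff \o f; have [sg_ _] := fc0; have gi := sqintble_intble sg_.
have P1 : rint (fun x => g x ^+ 2) - rint g ^+ 2 <= `|CP| * c0.
  exact: poincare_relaxed fc0.
have g0 x : 0 <= g x by exact: (low_cutoff_ge0 ab rho1).
have gf x : g x <= f x by exact: (low_cutoff_le ab rho1).
have gE x : f x < level 1 -> g x = f x by move=> /ltW; exact: (low_cutoff_low ab rho1).
have chiW x : chi (f x) <= (g x - 1) ^+ 2 / 2 + high_part (f x).
  have [fx|fx] := leP (level 1) (f x).
    rewrite /high_part fx; have := sqr_ge0 (g x - 1); have := f0 x; lra.
  have := high_part_ge0 (f x); rewrite gE//; have := chi_le etaP ab (f x); lra.
have fgW x : f x - g x <= 2 * high_part (f x).
  have [fx|fx] := leP (level 1) (f x).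
    rewrite /high_part fx; have := chi_ge0 etaP ab (f x); have := g0 x; lra.
  by rewrite gE// subrr mulr_ge0// high_part_ge0.
have sg1 : sqintble (fun x => g x - 1).
  exact: sqintbleB sg_ (bounded_sqintble mu (bounded_measurable_cst T (1 : R))).
have ig1 : intble (fun x => (g x - 1) ^+ 2 / 2).
  by rewrite (_ : (fun x => _) = (fun x => 2^-1 * (g x - 1) ^+ 2));
    [exact: intbleZ sg1.2|apply/funext => x; rewrite mulrC].
have ichi : intble (chi \o f).
  apply: le_intble (intbleD ig1 iW) => [|x].
    exact: (measurable_continuous_comp (chi_continuous etaP ab) mf).
  by rewrite ger0_norm ?(chi_ge0 etaP ab)//= chiW.
have h1 : rint (chi \o f) <= rint (fun x => (g x - 1) ^+ 2) / 2 + rint (high_part \o f).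
  rewrite mulrC -(rintZ _ sg1.2) -rintD//; last exact: intbleZ sg1.2.
  apply: le_rint => // [|x]; first by apply: intbleD => //; exact: intbleZ sg1.2.
  by rewrite /= mulrC chiW.
have h2 : 1 - rint g <= 2 * rint (high_part \o f).
  have -> : 1 - rint g = rint (fun x => f x - g x) by rewrite rintB// f1.
  rewrite -rintZ//; apply: le_rint => //; first exact: intbleB.
  exact: (intbleZ 2 iW).
have h3 : 0 <= rint g by exact: rint_ge0.
have h4 : rint g <= 1 by rewrite -f1; exact: le_rint.
have h5 : rint (fun x => (g x - 1) ^+ 2) = rint (fun x => g x ^+ 2) - 2 * rint g + 1.
  have -> : (fun x => (g x - 1) ^+ 2) = (fun x => (g x ^+ 2 - 2 * g x) + cst 1 x).
    by apply/funext => x; rewrite /= !expr2; move: (g x) => y; ring.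
  have i1 := intble_cst mu (1 : R).
  rewrite rintD// ?rintB// ?rintZ// ?rint_cst//; first exact: sg_.2.
    exact: intbleZ.
  by apply: intbleB; [exact: sg_.2|exact: intbleZ].
have h6 : `|CP| * c0 <= `|CP| / low_weight * K.
  by rewrite -mulrA [_^-1 * K]mulrC; exact: ler_wpM2l.
move: P1 h1 h2 h3 h4 h5 h6 rW.
move: (rint (chi \o f)) (rint (fun x => (g x - 1) ^+ 2)) (rint (high_part \o f)).
move: (rint g) (rint (fun x => g x ^+ 2)) (`|CP| * c0) (`|CP| / low_weight) (C * capacity_constant).
move=> m v q4 q5 q6 q1 q2 q3 P1 h1 h2 h3 h4 h5 h6 h7.
(* The low cutoff has mass m between 0 and 1. *)
have : (1 - m) ^+ 2 <= 1 - m by rewrite expr2; nra.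
by move: P1; rewrite !expr2; lra.
Qed.

Lemma chi_intble f : sqintble f -> intble (chi \o f).
Proof.
move=> sf; have b1 := bounded_measurable_cst T (1 : R).
have sf1 := sqintbleB sf (bounded_sqintble mu b1).
apply: le_intble (intbleZ 2^-1 sf1.2) => [|x].
  by apply: measurable_continuous_comp (chi_continuous etaP ab) _; have [] := sf.
by rewrite ger0_norm ?(chi_ge0 etaP ab)//= mulrC; exact: (chi_le etaP ab).
Qed.

Lemma rint_psi f : intble f -> intble (chi \o f) ->
  intble (psi eta a \o f) /\ rint (psi eta a \o f) = rint (chi \o f) + (rint f - 1) / 2.
Proof.
move=> If Ic.
have -> : psi eta a \o f = (fun x => (chi \o f) x + (2^-1 * f x - cst 2^-1 x)).
  by apply/funext => x; exact: psi_chi.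
have I1 := intbleZ 2^-1 If; have I2 := intble_cst mu (2^-1 : R).
have I3 := intbleB I1 I2.
split; first exact: intbleD.
by rewrite (rintD Ic I3) (rintB I1 I2) (rintZ _ If) rint_cst; lra.
Qed.

(** For a density in the Dirichlet domain the energies of the layers are integrals
    of the square of a tent against the carre du champ, and the weighted tents
    add up to at most psi''. *)
Lemma entropy_energy : exists2 C : R, 0 <= C & forall h,
  (forall x, 0 <= h x) -> rint h = 1 -> dirichlet_dom mu P A h ->
  intble (fun x => psi2 eta a (h x) * carre mu P A h x) /\
  0 <= rint (fun x => psi2 eta a (h x) * carre mu P A h x) /\
  rint (chi \o h) <= C * rint (fun x => psi2 eta a (h x) * carre mu P A h x).
Proof.
have [C C0 CFI] := relaxed_functional_inequality; exists (C * 2).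
  by rewrite mulr_ge0.
move=> h h0 h1 dh; have G0 := carre_ge0 dh; have /carreP/is_carreP[sh IG _] := dh.
have [mh _] := sh; set G := carre _ _ _ _ in G0 IG *.
have bc (phi : R -> R) : continuous phi -> (forall u, 0 <= phi u <= 1) ->
    bounded_measurable (phi \o h).
  move=> cphi phi01; split; first exact: measurable_continuous_comp.
  by exists 1 => x; have /andP[p0 p1] := phi01 (h x); rewrite ger0_norm.
have ct k : continuous (tent a rho k).
  exact: lipschitz_continuous (@tent_lipschitz _ _ _ ab _ rho1 k).
have cr : continuous (ramp a rho).
  exact: lipschitz_continuous (@ramp_lipschitz _ _ _ ab _ rho1).
have t01 k u : 0 <= tent a rho k u <= 1.
  by rewrite (tent_ge0 ab rho1) (tent_le1 ab rho1).
have r01 u : 0 <= ramp a rho u <= 1 by rewrite (ramp_ge0 a rho) (ramp_le1 a rho).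
have p01 u : 0 <= psi2 eta a u <= 1 by rewrite (psi2_ge0 etaP ab) (psi2_le1 etaP ab).
have Ip := intble_bounded_mul (bc _ (psi2_continuous etaP ab) p01) IG.
have Isq (phi : R -> R) : continuous phi -> (forall u, 0 <= phi u <= 1) ->
    intble (fun x => phi (h x) ^+ 2 * G x).
  move=> cphi phi01; have bp := bc phi cphi phi01.
  have := intble_bounded_mul (bounded_measurableM bp bp) IG.
  by apply: etrans; congr intble; apply/funext => x; rewrite expr2.
have sq1 (u : R) : 0 <= u <= 1 -> u ^+ 2 <= u.
  by move=> /andP[u0 u1]; rewrite expr2; nra.
have Ir := Isq _ cr r01; have It k := Isq _ (ct k) (t01 k).
split => //; split.
  rewrite -[leLHS](rint_cst mu); apply: (ae_le_rint (intble_cst mu 0) Ip).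
  by apply: filterS G0 => x Gx; apply: mulr_ge0 => //; have /andP[] := p01 (h x).
rewrite -mulrA; apply: (CFI h (rint (fun x => ramp a rho (h x) ^+ 2 * G x))
  (fun k => rint (fun x => tent a rho k (h x) ^+ 2 * G x))) => //.
- exact: relaxed_energy_comp dh (low_cutoffD ab rho1) (poly_approximable_ramp a rho)
    (@ramp_lipschitz _ _ _ ab _ rho1) r01.
- move=> k; exact: relaxed_energy_comp dh (cutoffD ab rho1 k) (poly_approximable_tent a rho k)
    (@tent_lipschitz _ _ _ ab _ rho1 k) (t01 k).
move=> N; have w0 u : 0 <= psi2 eta a u := psi2_ge0 etaP ab u.
have H1 : low_weight * rint (fun x => ramp a rho (h x) ^+ 2 * G x) <=
    rint (fun x => psi2 eta a (h x) * G x).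
  have := ramp_weight_le etaP ab rho1; have := w0 (level 2).
  move: (psi2 eta a (level 2)) => w w0' wr; rewrite -(rintZ _ Ir).
  apply: (ae_le_rint (intbleZ _ Ir) Ip); apply: filterS G0 => x Gx.
  rewrite mulrA; apply: ler_wpM2r => //; apply: le_trans (wr (h x)).
  by apply: ler_wpM2l => //; exact: sq1.
have H2 : \sum_(k < N) weight k * rint (fun x => tent a rho k (h x) ^+ 2 * G x) <=
    rint (fun x => psi2 eta a (h x) * G x).
  have IF k : intble (fun x => weight k * (tent a rho k (h x) ^+ 2 * G x)).
    exact: intbleZ (It k).
  have [I1 E1] := rint_sum N IF.
  rewrite (eq_bigr (fun k : 'I_N => rint (fun x => weight k * (tent a rho k (h x) ^+ 2 * G x)))).
    rewrite -E1; apply: (ae_le_rint I1 Ip); apply: filterS G0 => x Gx.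
    apply: (@le_trans _ _ ((\sum_(k < N) weight k * tent a rho k (h x)) * G x)).
      rewrite mulr_suml; apply: ler_sum => k _; rewrite mulrA; apply: ler_wpM2r => //.
      by apply: ler_wpM2l; [exact: w0|exact: sq1].
    by apply: ler_wpM2r => //; have [] := tent_sum_le etaP ab rho1 N (h x).
  by move=> k _; rewrite (rintZ _ (It k)).
by rewrite mulr_natl mulr2n; exact: lerD.
Qed.

(** ** Decay of the entropy from a density in the algebra *)

(** Elements of the algebra lie in the domain of the adjoint generator. *)
Lemma adjoint_remainder h : A h -> sqintble (Ld h) /\ forall e : R, 0 < e ->
  exists2 r : R, 0 < r & forall s, 0 < s -> s <= r ->
    nrm (fun x => (Pd s h x - h x) / s - Ld h x) <= e.
Proof.
move=> Ah; have bh := algebra_bounded Ah.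
have Hh : is_generator mu Pd h (Ld h).
  by have [h' hh'] := carre_adjoint_dom car Ah; exact: (xgetPex (cst 0) (ex_intro _ h' hh')).
have [_ /sqintbleP sLd cLd] := Hh; split => //; apply/lp_cvg2_rightP => // s s0.
have := sqintbleZ s^-1 (sqintbleB (adjoint_sqintble (ltW s0) bh) (bounded_sqintble mu bh)).
by congr sqintble; apply/funext => x; rewrite mulrC.
Qed.

Section smooth_density.
Variables (h : T -> R) (M : R).
Hypotheses (Ah : A h) (h0 : forall x, 0 <= h x) (hM : forall x, h x <= M).
Hypothesis h1 : rint h = 1.
Local Notation rem s := (nrm (fun x => (Pd s h x - h x) / s - Ld h x)).

Let bh : bounded_measurable h. Proof. exact: algebra_bounded. Qed.
Let Ih : intble h. Proof. exact: bounded_intble. Qed.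
Let sh : sqintble h. Proof. exact: bounded_sqintble. Qed.
Let M0 : 0 <= M. Proof. exact: le_trans (h0 point) (hM point). Qed.
Let sLd : sqintble (Ld h). Proof. by have [] := adjoint_remainder Ah. Qed.

(** A version of the density at time t that satisfies its almost sure bounds
    everywhere, so that the semigroup may be applied to functions of it. *)
Definition evolution t x : R := Num.max 0 (Num.min M (Pd t h x)).

Lemma evolution_ge0 t x : 0 <= evolution t x.
Proof. by rewrite /evolution le_max lexx. Qed.

Lemma evolution_le t x : evolution t x <= M.
Proof. by rewrite /evolution ge_max M0 ge_min lexx. Qed.

Lemma evolution_bounded t : 0 <= t -> bounded_measurable (evolution t).
Proof.
move=> t0; split.
  have mP := intble_measurable (adjoint_intble t0 Ih).
  exact: (measurable_continuous_comp (@clamp_continuous R 0 M) mP).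
by exists M => x; rewrite ger0_norm ?evolution_ge0 ?evolution_le.
Qed.

Lemma evolution_ae t : 0 <= t -> {ae mu, forall x, Pd t h x = evolution t x}.
Proof.
move=> t0; have H1 := adjoint_ge0 t0 Ih h0.
have H2 : {ae mu, forall x, Pd t h x <= M}.
  by apply: adjoint_le => //; [exact: intble_Lfun|exact: aeW].
by apply: filterS2 H1 H2 => x p0 pM; rewrite /evolution (min_idPr pM) (max_idPr p0).
Qed.

Lemma evolution_mean t : 0 <= t -> rint (evolution t) = 1.
Proof.
move=> t0; rewrite -h1 -(adjoint_mean t0 Ih); apply/esym/eq_ae_rint.
- exact: intble_measurable (adjoint_intble t0 Ih).
- by have [] := evolution_bounded t0.
- exact: evolution_ae.
Qed.

Lemma evolution_dual t u : 0 <= t -> bounded_measurable u ->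
  rint (fun x => u x * evolution t x) = rint (fun x => P t u x * h x).
Proof.
move=> t0 bu; rewrite -adjoint_dual//; have [mu_ _] := bu.
apply: eq_ae_rint.
- by apply: measurable_funM => //; have [] := evolution_bounded t0.
- by apply: measurable_funM => //; exact: intble_measurable (adjoint_intble t0 Ih).
- by apply: filterS (evolution_ae t0) => x ->.
Qed.

Lemma evolution_shift_dual t s u : 0 <= t -> 0 <= s -> bounded_measurable u ->
  rint (fun x => u x * Pd s (evolution t) x) = rint (fun x => P t u x * Pd s h x).
Proof.
move=> t0 s0 bu; have bPs := sg_bounded s0 bu; have bPt := sg_bounded t0 bu.
rewrite adjoint_dual//; last exact/bounded_intble/evolution_bounded.
rewrite evolution_dual// adjoint_dual//; congr (rint _); apply/funext => x.
by rewrite -!(sg_add sg)// addrC.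
Qed.

Lemma evolution_add t s u : 0 <= t -> 0 <= s -> bounded_measurable u ->
  rint (fun x => u x * evolution (t + s) x) = rint (fun x => P t u x * Pd s h x).
Proof.
move=> t0 s0 bu; have bPt := sg_bounded t0 bu.
rewrite evolution_dual ?addr_ge0// adjoint_dual//; congr (rint _); apply/funext => x.
by rewrite addrC (sg_add sg).
Qed.

(** Minus the time derivative of the integral of u against the evolution. *)
Definition production t u := - ip (P t u) (Ld h).

Lemma production_linear t (k : R) u v : 0 <= t -> bounded_measurable u ->
  bounded_measurable v ->
  production t (fun x => k * u x + v x) = k * production t u + production t v.
Proof.
move=> t0 bu bv; have sPu := bounded_sqintble mu (sg_bounded t0 bu).
have sPv := bounded_sqintble mu (sg_bounded t0 bv); rewrite /production.
have -> : P t (fun x => k * u x + v x) = (fun x => k * P t u x + P t v x).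
  by apply/funext => x; rewrite (sg_linear sg).
by rewrite (ipDl (sqintbleZ k sPu) sPv sLd) (ipZl k sPu sLd) opprD mulrN.
Qed.

Let quotient_sqintble s : 0 < s -> sqintble (fun x => (Pd s h x - h x) / s).
Proof.
move=> s0; have := sqintbleZ s^-1 (sqintbleB (adjoint_sqintble (ltW s0) bh) sh).
by congr sqintble; apply/funext => x; rewrite mulrC.
Qed.

(** The remainder involves h only, hence is uniform in the time t. *)
Lemma increment_production t s u : 0 <= t -> 0 < s -> bounded_measurable u ->
  `|rint (fun x => u x * evolution t x) - rint (fun x => P t u x * Pd s h x)
     - s * production t u| <= s * (nrm u * rem s).
Proof.
move=> t0 s0 bu; have bP := sg_bounded t0 bu; have sP := bounded_sqintble mu bP.
have sPd := adjoint_sqintble (ltW s0) bh.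
have E : rint (fun x => u x * evolution t x) - rint (fun x => P t u x * Pd s h x)
    = - (s * ip (P t u) (fun x => (Pd s h x - h x) / s)).
  rewrite evolution_dual// -ipZr//; last exact: quotient_sqintble.
  rewrite (_ : (fun x => s * _) = (fun x => Pd s h x - h x)); last first.
    by apply/funext => x; rewrite mulrC mulfVK ?lt0r_neq0.
  by rewrite (ipBr sPd sh sP) opprB.
have sq := quotient_sqintble s0.
rewrite E /production -mulrN -mulrBr opprK [- _ + _]addrC normrM (gtr0_norm s0) distrC.
rewrite -(ipBr sq sLd sP) ler_pM2l//.
apply: (le_trans (cauchy_schwarz sP (sqintbleB sq sLd))).
by apply: ler_wpM2r; [exact: nrm_ge0|exact: sg_contraction].
Qed.

Lemma production_ge0_of_increments t u : 0 <= t -> bounded_measurable u ->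
  (forall s, 0 < s ->
    0 <= rint (fun x => u x * evolution t x) - rint (fun x => P t u x * Pd s h x)) ->
  0 <= production t u.
Proof.
move=> t0 bu H; apply/ler_addgt0Pr => e e0.
have N0 : 0 < nrm u + 1 by rewrite ltr_wpDl// nrm_ge0.
have [_ /(_ _ (divr_gt0 e0 N0))[r r0 rP]] := adjoint_remainder Ah.
have := increment_production t0 r0 bu; have := H r r0; have := rP r r0 (lexx r).
rewrite ler_pdivlMr//; have := nrm_ge0 mu u; have := nrm_ge0 mu (fun x => (Pd r h x - h x) / r - Ld h x).
move: (nrm u) (rem r) (production t u) (rint _ - rint _) => p1 p2 p3 p4 g1 g2 g3 g4.
move=> /ler_normlP[_ g5]; rewrite -(pmulr_rge0 _ r0).
have : r * (p1 * p2) <= r * e by rewrite ler_pM2l//; nra.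
by rewrite mulrDr; lra.
Qed.

(** The case k = 0 of the dissipation inequality. *)
Lemma production_ge0 t (Theta dTheta : R -> R) : 0 <= t ->
  has_derivative Theta dTheta -> (forall z, 0 <= dTheta z) ->
  0 <= production t (Theta \o evolution t).
Proof.
move=> t0 dTh th0; have cTh := has_derivative_continuous dTh.
have bf := evolution_bounded t0; have dPsi := is_derive_oriented_integral 0 cTh.
have th1 z : 0 * dTheta z <= 1 by rewrite mul0r.
have gap := convexity_gap dPsi dTh (lexx 0) th0 th1.
apply: production_ge0_of_increments => // [|s s0]; first exact: bounded_measurable_comp.
have := adjoint_dissipation (ltW s0) bf (has_derivative_continuous dPsi) cTh gap.
by rewrite mul0r -evolution_shift_dual//; [exact: ltW|exact: bounded_measurable_comp].
Qed.

(** The case k = 1 of the dissipation inequality bounds the increments of the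
    truncation by those of the evolution, which the production describes. *)
Lemma production_energy t (Theta dTheta : R -> R) : 0 <= t ->
  has_derivative Theta dTheta -> (forall z, 0 <= dTheta z <= 1) ->
  relaxed_energy_le (Theta \o evolution t) (4 * production t (Theta \o evolution t)).
Proof.
move=> t0 dTh th; have cTh := has_derivative_continuous dTh.
have bf := evolution_bounded t0; have dPsi := is_derive_oriented_integral 0 cTh.
have th0 z : 0 <= dTheta z by have /andP[] := th z.
have th1 z : 1 * dTheta z <= 1 by rewrite mul1r; have /andP[] := th z.
have gap := convexity_gap dPsi dTh ler01 th0 th1.
have bu : bounded_measurable (Theta \o evolution t) by exact: bounded_measurable_comp.
apply: relaxed_energy_of_increments => // e e0.
have N0 : 0 < nrm (Theta \o evolution t) + 1 by rewrite ltr_wpDl// nrm_ge0.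
have [_ /(_ _ (divr_gt0 e0 N0))[r r0 rP]] := adjoint_remainder Ah.
exists r => // s s0 sr; have := rP s s0 sr.
have := adjoint_dissipation (ltW s0) bf (has_derivative_continuous dPsi) cTh gap.
have := increment_production t0 s0 bu.
rewrite -evolution_shift_dual ?(ltW s0)// mul1r.
pose U := Theta \o evolution t; rewrite -/U -/(ip U (evolution t)).
rewrite -/(ip U (Pd s (evolution t))) ler_pdivlMr//.
have := nrm_ge0 mu U; have := nrm_ge0 mu (fun x => (Pd s h x - h x) / s - Ld h x).
move: (nrm U) (rem s) (production t U) => p1 p2 p3 g1 g2.
have -> : ip U (fun x => U x - P s U x) = ip U (fun x => Theta (evolution t x) - P s U x) by [].
move: (ip U (fun x => _ - _)) (ip U (evolution t)) (ip U (Pd s _)) => p4 p5 p6.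
move=> /ler_normlP[_ g3] g4 g5.
have : s * (p1 * p2) <= s * e by rewrite ler_pM2l//; nra.
by rewrite mulrDr; lra.
Qed.

(** The combination of truncations that enters the functional inequality is
    dominated, in the sense of increments, by twice the derivative of psi. *)
Lemma production_sum_le t N : 0 <= t ->
  low_weight * production t (low_cutoff \o evolution t) +
    \sum_(k < N) weight k * production t (cutoff k \o evolution t) <=
  2 * production t (psi1 eta a \o evolution t).
Proof.
move=> t0; have bf := evolution_bounded t0.
pose S n u := \sum_(k < n) weight k * cutoff k u.
pose dS n u := \sum_(k < n) weight k * tent a rho k u.
have SD n : has_derivative (S n) (dS n).
  elim: n => [|n IH].
    have -> : S 0%N = (fun u => 0 * u + 0).
      by apply/funext => u; rewrite /S big_ord0; lra.
    have -> : dS 0%N = cst 0 by apply/funext => u; rewrite /dS big_ord0.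
    exact: has_derivative_affine.
  have -> : S n.+1 = (fun u => S n u + weight n * cutoff n u).
    by apply/funext => u; rewrite /S big_ord_recr.
  have -> : dS n.+1 = (fun u => dS n u + weight n * tent a rho n u).
    by apply/funext => u; rewrite /dS big_ord_recr.
  by apply: has_derivativeD => //; apply: has_derivativeZ; exact: (cutoffD ab rho1).
have bc (phi dphi : R -> R) : has_derivative phi dphi -> bounded_measurable (phi \o evolution t).
  by move=> /has_derivative_continuous cphi; exact: bounded_measurable_comp.
have SP n : production t (S n \o evolution t) =
    \sum_(k < n) weight k * production t (cutoff k \o evolution t).
  elim: n => [|n IH].
    rewrite big_ord0 /production.
    have -> : P t (S 0%N \o evolution t) = cst 0.
      apply/funext => x; rewrite /= -[RHS](sg_cst sg 0 x t0); congr (P t _ x).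
      by apply/funext => y; rewrite /= /S big_ord0.
    by rewrite ip0l oppr0.
  rewrite big_ord_recr /= -IH.
  have -> : S n.+1 \o evolution t =
      (fun x => weight n * (cutoff n \o evolution t) x + (S n \o evolution t) x).
    by apply/funext => x; rewrite /= /S big_ord_recr addrC.
  rewrite production_linear//; first by rewrite addrC.
    exact: bc (cutoffD ab rho1 n).
  exact: bc (SD n).
have lD := low_cutoffD ab rho1; have pD := psi1D etaP ab.
pose Theta u := 2 * psi1 eta a u + (- low_weight * low_cutoff u + -1 * S N u).
have TD : has_derivative Theta (fun u => 2 * psi2 eta a u +
    (- low_weight * ramp a rho u + -1 * dS N u)).
  apply: has_derivativeD; first exact: has_derivativeZ.
  by apply: has_derivativeD; exact: has_derivativeZ.
have T0 u : 0 <= 2 * psi2 eta a u + (- low_weight * ramp a rho u + -1 * dS N u).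
  have [] := tent_sum_le etaP ab rho1 N u; have := ramp_weight_le etaP ab rho1 u.
  rewrite -/(dS N u); move: (dS N u) (ramp a rho u) (psi2 eta a (level 2)) (psi2 eta a u).
  by move=> p1 p2 p3 p4; lra.
have := production_ge0 t0 TD T0.
have -> : Theta \o evolution t = (fun x => 2 * (psi1 eta a \o evolution t) x +
    (- low_weight * (low_cutoff \o evolution t) x +
      (-1 * (S N \o evolution t) x + cst 0 x))).
  by apply/funext => x; rewrite /= /Theta addr0.
have b1 := bc _ _ pD; have b2 := bc _ _ lD; have b3 := bc _ _ (SD N).
have b0 := bounded_measurable_cst T (0 : R).
have b4 := bounded_measurableD (bounded_measurableZ (-1) b3) b0.
have b5 := bounded_measurableD (bounded_measurableZ (- low_weight) b2) b4.
rewrite !production_linear// SP.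
have -> : production t (cst 0) = 0.
  rewrite /production (_ : P t (cst 0) = cst 0) ?ip0l ?oppr0//.
  by apply/funext => x; rewrite (sg_cst sg).
by move: (\sum_(k < N) _) (production t _) (production t _) => p1 p2 p3; lra.
Qed.

(** The productions play the role of the energies of the layers: they are positive
    linear functionals of the derivative of the tested function, and so add up. *)
Lemma entropy_production_le (C : R) t :
  layered_inequality C -> 0 <= t ->
  rint (chi \o evolution t) <= C * (8 * production t (psi1 eta a \o evolution t)).
Proof.
move=> CFI t0.
apply: (CFI _ (4 * production t (low_cutoff \o evolution t))
  (fun k => 4 * production t (cutoff k \o evolution t))).
- exact/bounded_sqintble/evolution_bounded.
- exact: evolution_ge0.
- exact: evolution_mean.
- apply: production_energy t0 (low_cutoffD ab rho1) _ => u.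
  by rewrite (ramp_ge0 a rho) (ramp_le1 a rho).
- move=> k; apply: production_energy t0 (cutoffD ab rho1 k) _ => u.
  by rewrite (tent_ge0 ab rho1) (tent_le1 ab rho1).
move=> N; have := production_sum_le N t0.
have -> : \sum_(k < N) weight k * (4 * production t (cutoff k \o evolution t)) =
    4 * \sum_(k < N) weight k * production t (cutoff k \o evolution t).
  by rewrite mulr_sumr; apply: eq_bigr => k _; rewrite mulrCA.
move: (\sum_(k < N) _) (production t (low_cutoff \o evolution t)).
move: (production t (psi1 eta a \o evolution t)) (psi2 eta a (level 2)) => p1 p2 p3 p4; lra.
Qed.

(** By duality with the increment itself. *)
Lemma evolution_increment t s : 0 <= t -> 0 < s ->
  nrm (fun x => evolution (t + s) x - evolution t x) <= s * (nrm (Ld h) + rem s).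
Proof.
move=> t0 s0; have ts0 : 0 <= t + s by rewrite addr_ge0// ltW.
pose D x := evolution (t + s) x - evolution t x.
have b1 := evolution_bounded ts0; have b2 := evolution_bounded t0.
have bD : bounded_measurable D by exact: bounded_measurableB.
have sD := bounded_sqintble mu bD; have bP := sg_bounded t0 bD.
have sP := bounded_sqintble mu bP; have sPd := adjoint_sqintble (ltW s0) bh.
have sq := quotient_sqintble s0; have sr := sqintbleB sq sLd.
have E : ip D D = s * ip (P t D) (fun x => (Pd s h x - h x) / s).
  rewrite -ipZr// (_ : (fun x => s * _) = (fun x => Pd s h x - h x)); last first.
    by apply/funext => x; rewrite mulrC mulfVK ?lt0r_neq0.
  rewrite (ipBr sPd sh sP) {2}/D (ipBr (bounded_sqintble mu b1) (bounded_sqintble mu b2) sD).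
  by rewrite /ip evolution_add ?(ltW s0)// evolution_dual.
have E2 : ip (P t D) (fun x => (Pd s h x - h x) / s) <= nrm D * (nrm (Ld h) + rem s).
  apply: (le_trans (le_ip sP sq)); apply: ler_pM; rewrite ?nrm_ge0//; first exact: sg_contraction.
  have := nrmD sLd sr; congr (_ <= _); congr (nrm _); apply/funext => x.
  by rewrite addrC subrK.
have H : nrm D ^+ 2 <= nrm D * (s * (nrm (Ld h) + rem s)).
  by rewrite nrm2 E mulrCA ler_pM2l.
have := nrm_ge0 mu D; rewrite le_eqVlt => /predU1P[<-|D0].
  by rewrite mulr_ge0 ?addr_ge0 ?nrm_ge0// ltW.
by rewrite -(ler_pM2l D0) -expr2.
Qed.

Lemma psi1_bound t x : `|psi1 eta a (evolution t x)| <= M + 2.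
Proof.
have := psi1_lipschitz etaP ab (evolution t x) 1; rewrite (psi1_1 etaP ab).
have := evolution_ge0 t x; have := evolution_le t x.
move: (evolution t x) (psi1 eta a (evolution t x)) => f p f1 f0 h2.
have h3 : `|f - 1| <= M + 1 by apply/ler_normlP; split; lra.
have /ler_normlP[h4 h5] := le_trans h2 h3.
by apply/ler_normlP; split; lra.
Qed.

(** The Taylor inequality for chi, whose first order term is the production. *)
Lemma entropy_step t s : 0 <= t -> 0 < s ->
  rint (chi \o evolution (t + s)) <= rint (chi \o evolution t)
    - s * production t (psi1 eta a \o evolution t)
    + s * ((M + 2) * rem s + s / 2 * (nrm (Ld h) + rem s) ^+ 2).
Proof.
move=> t0 s0; have ts0 : 0 <= t + s by rewrite addr_ge0// ltW.
have b1 := evolution_bounded ts0; have b2 := evolution_bounded t0.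
set f1 := evolution (t + s) in b1 *; set f := evolution t in b2 *.
pose u := psi1 eta a \o f.
have bu : bounded_measurable u by apply: bounded_measurable_comp => //; exact: psi1_continuous etaP ab.
have bD : bounded_measurable (fun x => f1 x - f x) by exact: bounded_measurableB.
have sD := bounded_sqintble mu bD.
have I1 := bounded_intble mu (bounded_measurable_comp (chi_continuous etaP ab) b1).
have I2 := bounded_intble mu (bounded_measurable_comp (chi_continuous etaP ab) b2).
have I3 := bounded_intble mu b1; have I4 := bounded_intble mu b2.
have I5 := bounded_intble mu (bounded_measurableM bu b1).
have I6 := bounded_intble mu (bounded_measurableM bu b2).
have I7 := intbleZ 2^-1 sD.2.
have I8 := intbleB I5 I6; have I9 := intbleZ (- 2^-1) (intbleB I3 I4).
have H : rint (chi \o f1) - rint (chi \o f) <=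
    rint (fun x => (u x * f1 x - u x * f x) + - 2^-1 * (f1 x - f x) + 2^-1 * (f1 x - f x) ^+ 2).
  rewrite -rintB//; apply: le_rint; [exact: intbleB|by apply: intbleD => //; exact: intbleD|].
  move=> x; have := chi_taylor etaP ab (f1 x) (f x); rewrite /= -/(u x).
  rewrite (_ : psi1 eta a (f x) = u x)//.
  move: (u x) (chi (f1 x)) (chi (f x)) (f1 x) (f x) => p1 p2 p3 p4 p5; rewrite expr2; lra.
move: H; rewrite (rintD (intbleD I8 I9) I7) (rintD I8 I9) (rintB I5 I6) (rintZ _ (intbleB I3 I4)).
rewrite (rintB I3 I4) (rintZ _ sD.2) /f1 /f !evolution_mean// subrr mulr0 addr0 -/f -/f1.
have Q1 : rint (fun x => (f1 x - f x) ^+ 2) <= (s * (nrm (Ld h) + rem s)) ^+ 2.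
  have := evolution_increment t0 s0; rewrite nrm_le; last first.
    by rewrite mulr_ge0 ?addr_ge0 ?nrm_ge0// ltW.
  by [].
have Q2 := increment_production t0 s0 bu.
have -> : rint (fun x => u x * f1 x) = rint (fun x => P t u x * Pd s h x).
  by rewrite evolution_add// ltW.
have Q3 : nrm u <= M + 2.
  have M2 : 0 <= M + 2 by rewrite addr_ge0.
  have -> : M + 2 = nrm (cst (M + 2)) by rewrite nrm_cst ger0_norm.
  apply: le_nrm; [exact/bounded_sqintble/bounded_measurable_cst|by have [] := bu|].
  by move=> x; rewrite (ger0_norm M2); exact: (psi1_bound t x).
move: Q2; rewrite -/f -/u.
have Q4 : nrm u * rem s <= (M + 2) * rem s by apply: ler_wpM2r => //; exact: nrm_ge0.
move: Q1 Q4; rewrite exprMn.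
move: (rint (fun x => u x * f x)) (rint (fun x => P t u x * _)) (production t u).
move: (rint (chi \o f1)) (rint (chi \o f)) (rint (fun x => (f1 x - f x) ^+ 2)).
move: (nrm u * rem s) ((M + 2) * rem s) ((nrm (Ld h) + rem s) ^+ 2).
move=> p1 p2 p3 p4 p5 p6 p7 p8 p9 q1 q2 /ler_normlP[q3 _] q4.
have q5 : s * p1 <= s * p2 by rewrite ler_pM2l.
by move: q1; rewrite expr2; lra.
Qed.

Lemma entropy_step_uniform (C1 : R) : 0 < C1 ->
  (forall t, 0 <= t ->
    rint (chi \o evolution t) <= C1 * production t (psi1 eta a \o evolution t)) ->
  forall e : R, 0 < e -> exists2 r : R, 0 < r & forall t s, 0 <= t -> 0 < s -> s <= r ->
    rint (chi \o evolution (t + s)) <=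
      (1 - s / C1) * rint (chi \o evolution t) + s * e.
Proof.
move=> C10 HC e e0; set N := nrm (Ld h); have N0 : 0 <= N by exact: nrm_ge0.
have M2 : 0 < M + 2 by rewrite ltr_wpDl.
have N1 : 0 < (N + 1) ^+ 2 by rewrite exprn_gt0// ltr_wpDl.
pose dl := Num.min 1 (e / 2 / (M + 2)).
have dl0 : 0 < dl by rewrite lt_min ltr01/= !divr_gt0.
have [_ /(_ _ dl0)[r r0 rP]] := adjoint_remainder Ah.
exists (Num.min r (e / (N + 1) ^+ 2)); first by rewrite lt_min r0 divr_gt0.
move=> t s t0 s0; rewrite le_min => /andP[sr se].
have := rP s s0 sr; rewrite /dl le_min => /andP[m1 m2].
have := entropy_step t0 s0; rewrite -/N; have := HC t t0.
rewrite ler_pdivlMr// in m2; rewrite ler_pdivlMr// in se.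
have m0 := nrm_ge0 mu (fun x => (Pd s h x - h x) / s - Ld h x).
move: (rint (chi \o evolution t)) (rint (chi \o evolution (t + s))) (production t _) m0 m1 m2.
move=> p1 p2 p3.
move: (rem s) => m m0 m1 m2 h2 h3.
have h4 : (N + m) ^+ 2 <= (N + 1) ^+ 2.
  by rewrite lerXn2r ?nnegrE ?addr_ge0// lerD2l.
have h5 : s * p1 / C1 <= s * p3.
  by rewrite ler_pdivrMr// -mulrA ler_pM2l// mulrC.
have h6 : s * ((M + 2) * m + s / 2 * (N + m) ^+ 2) <= s * e.
  rewrite ler_pM2l//; have : s / 2 * (N + m) ^+ 2 <= s / 2 * (N + 1) ^+ 2.
    by rewrite ler_pM2l// divr_gt0.
  move: m2 se; move: ((N + m) ^+ 2) ((N + 1) ^+ 2) => p5 p6; lra.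
rewrite mulrBl mul1r mulrAC; lra.
Qed.

(** The explicit Euler scheme with n steps of length t / n: the errors add up to
    at most e. *)
Lemma entropy_decay_evolution (C1 t : R) : 0 < C1 ->
  (forall t, 0 <= t ->
    rint (chi \o evolution t) <= C1 * production t (psi1 eta a \o evolution t)) ->
  0 <= t -> rint (chi \o evolution t) <= expR (- t / C1) * rint (chi \o evolution 0).
Proof.
move=> C10 HC; rewrite le_eqVlt => /predU1P[<-|t0].
  by rewrite oppr0 mul0r expR0 mul1r.
apply/ler_addgt0Pr => e e0; have et0 := divr_gt0 e0 t0.
have [r r0 rP] := entropy_step_uniform C10 HC et0.
(* A step shorter than C1 keeps 1 - s / C1 nonnegative. *)
pose q := Num.min r C1; have q0 : 0 < q by rewrite lt_min r0.
pose n := (Num.bound (t / q)).+1; have n0 : 0 < n%:R :> R by rewrite ltr0n.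
pose s := t / n%:R; have s0 : 0 < s by rewrite divr_gt0.
have sq : s <= q.
  rewrite /s ler_pdivrMr// mulrC -ler_pdivrMr//.
  have tq0 : 0 <= t / q by rewrite ltW// divr_gt0.
  by rewrite (le_trans (ltW (archi_boundP tq0)))// ler_nat.
have sr : s <= r by rewrite (le_trans sq)// ge_min lexx.
have sC : s <= C1 by rewrite (le_trans sq)// ge_min lexx orbT.
have ge0 k : 0 <= k%:R * s by rewrite mulr_ge0// ltW.
have w0 : 0 <= 1 - s / C1 by rewrite subr_ge0 ler_pdivrMr// mul1r.
have w1 : 1 - s / C1 <= 1 by rewrite gerBl divr_ge0// ltW.
have H k : rint (chi \o evolution (k%:R * s)) <=
    (1 - s / C1) ^+ k * rint (chi \o evolution 0) + k%:R * (s * (e / t)).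
  elim: k => [|k IH]; first by rewrite !mul0r expr0 mul1r addr0.
  rewrite -natr1 mulrDl mul1r; apply: (le_trans (rP _ _ (ge0 k) s0 sr)).
  have se : 0 <= s * (e / t) by rewrite mulr_ge0// ltW.
  rewrite exprS; move: IH (ge0 k).
  move: (rint (chi \o evolution (k%:R * s))) (rint (chi \o evolution 0)).
  move: ((1 - s / C1) ^+ k) (k%:R : R) (ler0n R k) => p3 p4 p40 p1 p2 IH _.
  have := ler_wpM2l w0 IH; have := mulr_ge0 p40 se.
  move: (s * (e / t)) (1 - s / C1) w0 w1 => p5 p6 w0 w1 g1 g2.
  have : p6 * (p4 * p5) <= p4 * p5 by rewrite ler_piMl.
  by move: g2; rewrite mulrDr mulrA mulrDl mul1r; lra.
have := H n; have -> : n%:R * s = t by rewrite /s mulrC divfK// lt0r_neq0.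
rewrite mulrA; have -> : n%:R * s * (e / t) = e.
  by rewrite /s [n%:R * _]mulrC divfK ?lt0r_neq0// mulrC divfK// lt0r_neq0.
move/le_trans; apply; rewrite lerD2r; apply: ler_wpM2r.
  by apply: rint_ge0 => x; exact: chi_ge0 etaP ab _.
have -> : - t / C1 = n%:R * (- (s / C1)).
  by rewrite mulrN mulrA /s [n%:R * _]mulrC divfK ?lt0r_neq0// mulNr.
rewrite expRM_natl; apply: lerXn2r; rewrite ?nnegrE ?expR_ge0//.
by have := expR_ge1Dx (- (s / C1)).
Qed.

End smooth_density.

Lemma entropy_decay_algebra : exists2 C : R, 0 < C & forall h t, A h ->
  (forall x, 0 <= h x) -> rint h = 1 -> 0 <= t ->
  rint (chi \o Pd t h) <= expR (- t / C) * rint (chi \o h).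
Proof.
have [C C0 CFI] := relaxed_functional_inequality.
have C1 : 0 < C * 8 + 1 by rewrite ltr_wpDl// mulr_ge0.
exists (C * 8 + 1) => // h t Ah h0 h1 t0.
have [M hMn] := Abd Ah; have hM x : h x <= M by rewrite (le_trans (ler_norm _)).
have bh := algebra_bounded Ah; have Ih := bounded_intble mu bh.
have E (s : R) (g : T -> R) : 0 <= s -> measurable_fun [set: T] g ->
    {ae mu, forall x, evolution h M s x = g x} ->
    rint (chi \o evolution h M s) = rint (chi \o g).
  move=> s0 mg eg; apply: eq_ae_rint.
  - apply: measurable_continuous_comp (chi_continuous etaP ab) _.
    by have [] := evolution_bounded Ah h0 hM s0.
  - exact: measurable_continuous_comp (chi_continuous etaP ab) mg.
  - by apply: filterS eg => x /= ->.
have mP := intble_measurable (adjoint_intble t0 Ih).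
have e1 : {ae mu, forall x, evolution h M t x = Pd t h x}.
  by apply: filterS (evolution_ae Ah h0 hM t0) => x ->.
have e2 : {ae mu, forall x, evolution h M 0 x = h x}.
  by apply: filterS2 (evolution_ae Ah h0 hM (lexx 0)) (adjoint_0 Ih) => x <-.
have [mh _] := bh.
rewrite -(E _ _ t0 mP e1) -(E _ _ (lexx 0) mh e2).
apply: (entropy_decay_evolution Ah h0 hM h1 C1 _ t0) => s s0.
apply: (le_trans (entropy_production_le Ah h0 hM h1 CFI s0)).
have := production_ge0 Ah h0 hM s0 (psi1D etaP ab) (psi2_ge0 etaP ab).
by move: (production _ _ _) => p; lra.
Qed.

(** ** Extension to square integrable densities *)

Lemma rint_chi_dist f g : sqintble f -> sqintble g ->
  `|rint (chi \o f) - rint (chi \o g)| <=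
    2 * ((nrm f + nrm g + 2) * nrm (fun x => f x - g x)).
Proof.
move=> sf sg'; have b1 := bounded_measurable_cst T (1 : R).
have s1 := bounded_sqintble mu b1.
have sf1 := sqintbleB sf s1; have sg1 := sqintbleB sg' s1; have sfg := sqintbleB sf sg'.
have af := sqintble_abs sf1; have ag := sqintble_abs sg1; have afg := sqintble_abs sfg.
have If := chi_intble sf; have Ig := chi_intble sg'.
rewrite -rintB//; apply: (le_trans (le_norm_rint (intbleB If Ig))).
have Im := intble_mul (sqintbleD af ag) afg.
apply: (@le_trans _ _ (2 * ip (fun x => `|f x - 1| + `|g x - 1|) (fun x => `|f x - g x|))).
  rewrite -rintZ//; apply: le_rint; [exact/intble_abs/intbleB|exact: intbleZ|].
  by move=> x; exact: (chi_dist etaP ab).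
rewrite ler_pM2l//; apply: (le_trans (le_ip (sqintbleD af ag) afg)).
rewrite nrm_abs; apply: ler_wpM2r; first exact: nrm_ge0.
apply: (le_trans (nrmD af ag)); rewrite !nrm_abs.
have H u : sqintble u -> nrm (fun x => u x - 1) <= nrm u + 1.
  move=> su; have := nrmD su (sqintbleN s1); rewrite nrmN nrm_cst normr1.
  exact.
by have := H f sf; have := H g sg'; lra.
Qed.

Lemma truncation_close h (e : R) : sqintble h -> (forall x, 0 <= h x) -> 0 < e ->
  exists N : nat, nrm (fun x => Num.min N%:R (h x) - h x) <= e.
Proof.
move=> sh h0 e0; have e20 : 0 < e ^+ 2 by rewrite exprn_gt0.
have [N HN] := intble_tail sh.2 e20; exists N; rewrite nrm_le ?(ltW e0)//.
apply: le_trans HN; have [mh _] := sh.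
have In : intble (fun x => Num.max (h x ^+ 2 - N%:R) 0).
  apply: intble_pos; apply: intbleB; first exact: sh.2.
  exact: intble_cst.
have HB x : (Num.min N%:R (h x) - h x) ^+ 2 <= Num.max (h x ^+ 2 - N%:R) 0.
  case: (leP (N%:R : R) (h x)) => hN; last first.
    by rewrite subrr expr0n le_max lexx orbT.
  rewrite le_max; apply/orP; left.
  have nn : (N%:R : R) <= N%:R * N%:R.
    by rewrite -natrM ler_nat; case: N {In hN} => // n; rewrite leq_pmulr.
  rewrite !expr2; move: (N%:R : R) (ler0n R N) (h x) hN nn => n n0 y; nra.
apply: (le_rint _ In) => [|x]; last by have := HB x; rewrite expr2.
apply: le_intble In => [|x].
  by apply: measurable_funM; apply: measurable_funB => //; apply: measurable_minr.
rewrite ger0_norm; last by rewrite -expr2 sqr_ge0.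
by have := HB x; rewrite expr2.
Qed.

Lemma positive_part_poly (M e : R) : 0 < e -> exists p : {poly R},
  forall x, `|x| <= M -> `|Num.max 0 x - p.[x]| <= e.
Proof.
have H : poly_approximable (fun x : R => Num.max 0 x).
  have aff (k c : R) (f : R -> R) : f =1 (fun x : R => k * x + c) -> poly_approximable f.
    by move=> /funext ->; exact: poly_approximable_affine.
  apply: poly_approximable_max; first by apply: (aff 0 0) => x; lra.
  by apply: (aff 1 0) => x; lra.
exact: H.
Qed.

(** Truncation of a density, approximation by an element of the algebra, and
    of the positive part by a polynomial, followed by normalisation. *)
Lemma algebra_density_dense h (e : R) : sqintble h -> (forall x, 0 <= h x) ->
  rint h = 1 -> 0 < e ->
  exists u, [/\ A u, forall x, 0 <= u x, rint u = 1 & nrm (fun x => u x - h x) <= e].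
Proof.
move=> sh h0 h1 e0; have Ih := sqintble_intble sh; have [mh _] := sh.
have nh0 := nrm_ge0 mu h; have K0 : 0 < 2 * nrm h + 3 by lra.
pose eps := Num.min (2^-1) (e / (2 * nrm h + 3)).
have eps0 : 0 < eps by rewrite lt_min invr_gt0 ltr0n/= divr_gt0.
have epsh : eps <= 2^-1 by rewrite ge_min lexx.
have epse : eps * (2 * nrm h + 3) <= e by rewrite -ler_pdivlMr// ge_min lexx orbT.
pose dl := eps / 4; have dl0 : 0 < dl by rewrite divr_gt0.
have [N HN] := truncation_close sh h0 dl0.
pose k x := Num.min N%:R (h x).
have k0 x : 0 <= k x by rewrite /k le_min h0 ler0n.
have bk : bounded_measurable k.
  split; first exact: measurable_minr.
  by exists N%:R => x; rewrite ger0_norm// /k ge_min lexx.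
have sk := bounded_sqintble mu bk.
have [v Av vk] := algebra_dense bk dl0; have bv := algebra_bounded Av.
have sv := bounded_sqintble mu bv; have [mv [M vM]] := bv.
have [p pP] := positive_part_poly M dl0.
pose w x := p.[v x] + dl.
have Aw : A w by apply: algebraD; [exact: algebra_horner|exact: algebra_cst].
have sw := algebra_sqintble Aw.
have w0 x : 0 <= w x.
  have /ler_normlP[_ h2] := pP _ (vM x); have : 0 <= Num.max 0 (v x) by rewrite le_max lexx.
  by rewrite /w; lra.
pose vp x := Num.max 0 (v x).
have svp : sqintble vp.
  apply: bounded_sqintble; split; first exact: measurable_maxr.
  exists M => x; apply: le_trans (vM x); rewrite /vp; case: (leP 0 (v x)) => // _.
  by rewrite normr0.
have d1 : nrm (fun x => w x - vp x) <= 2 * dl.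
  have -> : 2 * dl = nrm (cst (2 * dl)) by rewrite nrm_cst ger0_norm// mulr_ge0// ltW.
  apply: le_nrm; [exact/bounded_sqintble/bounded_measurable_cst| |].
    by apply: measurable_funB; [have [] := sw|have [] := svp].
  move=> x; rewrite /= [in leRHS]ger0_norm; last by rewrite mulr_ge0// ltW.
  have /ler_normlP[h2 h3] := pP _ (vM x); apply/ler_normlP; rewrite /w /vp; split; lra.
have d2 : nrm (fun x => vp x - k x) <= dl.
  apply: le_trans vk; apply: le_nrm; first exact: sqintbleB.
    by apply: measurable_funB; [have [] := svp|have [] := sk].
  move=> x; have := lipschitz_max0 (v x) (k x).
  by rewrite (max_idPr (k0 x)).
have wh : nrm (fun x => w x - h x) <= eps.
  have t1 := nrm_triangle sw svp sh; have t2 := nrm_triangle svp sk sh.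
  have e4 : eps = dl * 4 by rewrite /dl divfK.
  by move: t1 t2 HN d1 d2 vk; rewrite -/k e4; lra.
pose c := rint w; have Iw := sqintble_intble sw.
have swh := sqintbleB sw sh.
have c1 : `|c - 1| <= eps.
  rewrite -h1 /c -rintB//; apply: (le_trans (le_norm_rint (intbleB Iw Ih))).
  by apply: le_trans wh; exact: le_rint_abs_nrm.
have /ler_normlP[c2 c3] := c1.
have c0 : 0 < c by lra.
exists (fun x => c^-1 * w x); split.
- exact: algebraZ.
- by move=> x; rewrite mulr_ge0// invr_ge0 ltW.
- by rewrite rintZ// mulVf// lt0r_neq0.
have nw : nrm w <= nrm h + eps.
  have := nrmD sh swh; have -> : (fun x => h x + (w x - h x)) = w.
    by apply/funext => x; rewrite addrC subrK.
  by move/le_trans; apply; rewrite lerD2l.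
have suw := sqintbleZ c^-1 sw.
apply: (le_trans (nrm_triangle suw sw sh)).
have -> : (fun x => c^-1 * w x - w x) = (fun x => (c^-1 - 1) * w x).
  by apply/funext => x; rewrite mulrBl mul1r.
rewrite nrmZ//.
(* Normalisation multiplies w by a factor within 2 eps of 1. *)
have cc : `|c^-1 - 1| <= 2 * eps.
  have -> : c^-1 - 1 = (1 - c) / c by rewrite mulrBl mul1r divff// lt0r_neq0.
  rewrite normrM distrC [X in _ * X]ger0_norm ?invr_ge0 ?(ltW c0)// ler_pdivrMr//.
  by nra.
have : `|c^-1 - 1| * nrm w <= 2 * eps * (nrm h + 1).
  apply: ler_pM => //; first exact: nrm_ge0.
  by apply: (le_trans nw); rewrite lerD2l; lra.
move: epse wh; move: (nrm h) (nrm (fun x => w x - h x)) (`|_| * nrm w) => q1 q2 q3.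
by move=> g1 g2 g3; lra.
Qed.

(** Both sides are continuous for the quadratic mean, on which the adjoint
    semigroup contracts. *)
Lemma entropy_decay : exists2 C : R, 0 < C & forall h t, sqintble h ->
  (forall x, 0 <= h x) -> rint h = 1 -> 0 <= t ->
  rint (chi \o Pd t h) <= expR (- t / C) * rint (chi \o h).
Proof.
have [C C0 CP1] := entropy_decay_algebra; exists C => // h t sh h0 h1 t0.
have Ih := sqintble_intble sh; have nh0 := nrm_ge0 mu h.
pose K := 2 * (2 * nrm h + 3); have K0 : 0 < K by rewrite /K; lra.
apply/ler_addgt0Pr => e e0.
pose dl := Num.min 1 (e / (2 * K)).
have dl0 : 0 < dl.
  by rewrite lt_min ltr01 /=; apply: divr_gt0 => //; exact: mulr_gt0.
have dl1 : dl <= 1 by rewrite ge_min lexx.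
have dle : 2 * (K * dl) <= e.
  have K2 : 0 < 2 * K by exact: mulr_gt0.
  by rewrite mulrA mulrC -(ler_pdivlMr _ _ K2) ge_min lexx orbT.
have [u [Au u0 u1 uh]] := algebra_density_dense sh h0 h1 dl0.
have su := algebra_sqintble Au; have Iu := sqintble_intble su.
have nu : nrm u <= nrm h + 1.
  have := nrmD sh (sqintbleB su sh); have -> : (fun x => h x + (u x - h x)) = u.
    by apply/funext => x; rewrite addrC subrK.
  by lra.
have [sPh nPh] := adjoint_L2_contraction t0 sh.
have [sPu nPu] := adjoint_L2_contraction t0 su.
have nd : nrm (fun x => Pd t u x - Pd t h x) <= dl.
  have sd := sqintbleB su sh; have [sPd nPd] := adjoint_L2_contraction t0 sd.
  apply: le_trans uh; apply: le_trans nPd; rewrite le_eqVlt; apply/orP; left; apply/eqP.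
  apply: eq_ae_nrm.
  - by have [] := sqintbleB sPu sPh.
  - by have [] := sPd.
  - by apply: filterS (adjointB t0 Iu Ih) => x ->.
have bound p q : nrm p <= nrm h + 1 -> nrm (fun x => p x - q x) <= dl -> nrm q <= nrm h ->
    2 * ((nrm p + nrm q + 2) * nrm (fun x => p x - q x)) <= K * dl.
  move=> p1 p2 q1; have := nrm_ge0 mu (fun x => p x - q x).
  have := nrm_ge0 mu p; have := nrm_ge0 mu q; rewrite /K.
  move: (nrm p) (nrm q) (nrm _) (nrm h) p1 p2 q1 => n1 n2 n3 n4; nra.
have D1 := le_trans (rint_chi_dist su sh) (bound _ _ nu uh (lexx _)).
have D2 := le_trans (rint_chi_dist sPu sPh) (bound _ _ (le_trans nPu nu) nd nPh).
have := CP1 u t Au u0 u1 t0.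
have /ler_normlP[g1 g2] : `|rint (chi \o u) - rint (chi \o h)| <= K * dl by exact: D1.
have /ler_normlP[g3 g4] : `|rint (chi \o Pd t u) - rint (chi \o Pd t h)| <= K * dl.
  exact: D2.
have x0 := expR_ge0 (- t / C); have x1 : expR (- t / C) <= 1.
  by rewrite -expR0 ler_expR mulNr oppr_le0 divr_ge0// ltW.
move: g1 g2 g3 g4 dle x0 x1; move: (rint (chi \o u)) (rint (chi \o h)) (K * dl).
move: (rint (chi \o Pd t u)) (rint (chi \o Pd t h)) (expR _) => q1 q2 q3 q4 q5 q6.
by move=> g1 g2 g3 g4 g5 g6 g7 g8; nra.
Qed.

(** ** Decay in total variation *)

(** A density h is truncated at N and completed to a density g by a constant; the
    adjoint semigroup contracts the distance between h and g. For g the two terms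
    of the weighted bound are balanced by a weight s of the order of the square
    root of the entropy at time t. *)
Lemma tv_decay : exists M C : R, [/\ 0 < M, 0 < C & forall h t, intble h ->
  (forall x, 0 <= h x) -> rint h = 1 -> intble (eta \o h) -> 0 <= t ->
  rint (fun x => `|Pd t h x - 1|) <=
    M * expR (- t / (4 * C)) * (1 + rint (eta \o h))].
Proof.
have [C C0 decay] := entropy_decay; have [Ce Ce0 psi_eta] := psi_le_eta etaP ab.
exists (2 * Ce + 18), (C / 2); split; [lra|exact: divr_gt0|].
move=> h t Ih h0 h1 Ie t0; set E := rint (eta \o h).
have E0 : 0 <= E by apply: rint_ge0 => x /=; exact: (eta_ge0 etaP (h0 x)).
have -> : 4 * (C / 2) = 2 * C by lra.
set q := expR (- t / (2 * C)); have q0 : 0 < q by exact: expR_gt0.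
have q1 : q <= 1 by rewrite -expR0 ler_expR mulNr oppr_le0 divr_ge0// mulr_ge0// ltW.
have qq : expR (- t / C) = q * q.
  rewrite -expRD; congr expR; rewrite -mulrDl invfM; lra.
apply/ler_addgt0Pr => e e0.
have [N HN] := intble_tail Ih (divr_gt0 e0 (ltr0Sn R 1)).
pose k x := Num.min N%:R (h x).
have k0 x : 0 <= k x by rewrite /k le_min h0 ler0n.
have kh x : k x <= h x by rewrite /k ge_min lexx orbT.
have bk : bounded_measurable k.
  split; first by apply: measurable_minr => //; exact: intble_measurable Ih.
  by exists N%:R => x; rewrite ger0_norm// /k ge_min lexx.
have Ik := bounded_intble mu bk.
(* The mass lost by the truncation. *)
pose d0 := 1 - rint k.
have d0E : d0 <= e / 2.
  have -> : d0 = rint (fun x => h x - k x) by rewrite rintB// h1.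
  apply: le_trans HN; apply: le_rint; first exact: intbleB.
    by apply: intble_pos; apply: intbleB => //; exact: intble_cst.
  move=> x; rewrite /k; case: (leP (N%:R : R) (h x)) => hN; rewrite le_max ?lexx//.
  by rewrite subrr lexx orbT.
have d00 : 0 <= d0.
  have -> : d0 = rint (fun x => h x - k x) by rewrite rintB// h1.
  by apply: rint_ge0 => x; rewrite subr_ge0.
have d01 : d0 <= 1 by rewrite /d0 gerBl; exact: rint_ge0.
pose g x := k x + cst d0 x.
have bd0 := bounded_measurable_cst T d0; have Id0 := bounded_intble mu bd0.
have bg : bounded_measurable g by exact: bounded_measurableD.
have g0 x : 0 <= g x by rewrite addr_ge0.
have Ig := bounded_intble mu bg; have sg_ := bounded_sqintble mu bg.
have g1 : rint g = 1 by rewrite rintD// rint_cst /d0 addrC subrK.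
have chig : rint (chi \o g) <= Ce * (1 + E) + 5.
  have I1 := intble_cst mu (1 : R); have I5 := intble_cst mu (4 : R).
  have Ib := intbleZ Ce (intbleD I1 Ie).
  have -> : Ce * (1 + E) + 5 =
      rint (fun x => Ce * (cst 1 x + (eta \o h) x) + (h x + cst 4 x)).
    rewrite (rintD Ib (intbleD Ih I5)) (rintZ _ (intbleD I1 Ie)) (rintD I1 Ie).
    by rewrite (rintD Ih I5) !rint_cst h1 -/E; lra.
  apply: le_rint; [exact: chi_intble|by apply: intbleD => //; exact: intbleD|move=> x].
  apply: (le_trans (chi_shift etaP ab (k0 x) (kh x) d00 d01)).
  have := psi_eta _ (h0 x); rewrite psi_chi /=; have := h0 x.
  by move: (h x) (chi (h x)) (Ce * _) => p1 p2 p3; lra.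
have [sPg _] := adjoint_L2_contraction t0 sg_.
have IPg := sqintble_intble sPg; have IPh := adjoint_intble t0 Ih.
have I1 := intble_cst mu (1 : R).
have cg := chi_intble sPg.
pose s := q / 2; have s0 : 0 < s by exact: divr_gt0.
have s1 : s <= 2^-1 by rewrite /s; lra.
have B1 : rint (fun x => `|Pd t g x - 1|) <= s + s^-1 * rint (chi \o Pd t g).
  have Is := intble_cst mu s; have Ic := intbleZ s^-1 cg.
  rewrite -(rintZ _ cg) -{1}(rint_cst mu s) -rintD//.
  apply: le_rint; [exact/intble_abs/intbleB|exact: intbleD|move=> x].
  by rewrite [_^-1 * _]mulrC; exact: abs_le_chi etaP ab _ _ s0 s1.
have B2 : rint (chi \o Pd t g) <= q * q * (Ce * (1 + E) + 5).
  apply: (le_trans (decay g t sg_ g0 g1 t0)); rewrite qq.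
  by apply: ler_wpM2l => //; rewrite mulr_ge0// ltW.
have B3 : rint (fun x => `|Pd t h x - Pd t g x|) <= e.
  have Ihg := intbleB Ih Ig.
  apply: (@le_trans _ _ (rint (fun x => `|h x - g x|))).
    apply: le_trans (adjoint_L1_contraction t0 Ihg).
    apply: ae_le_rint; [exact/intble_abs/intbleB|exact/intble_abs/adjoint_intble|].
    by apply: filterS (adjointB t0 Ih Ig) => x ->.
  have Ihk := intbleB Ih Ik.
  apply: (@le_trans _ _ (rint (fun x => (h x - k x) + cst d0 x))).
    apply: le_rint; [exact: intble_abs|exact: intbleD|move=> x].
    have -> : h x - g x = (h x - k x) - d0 by rewrite /g opprD addrA.
    apply: (le_trans (ler_normB _ _)).
    by rewrite (ger0_norm d00) ger0_norm// subr_ge0.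
  by rewrite (rintD Ihk Id0) (rintB Ih Ik) rint_cst h1 -/d0; lra.
have B4 : rint (fun x => `|Pd t h x - 1|) <=
    rint (fun x => `|Pd t h x - Pd t g x|) + rint (fun x => `|Pd t g x - 1|).
  have J1 := intble_abs (intbleB IPh IPg); have J2 := intble_abs (intbleB IPg I1).
  have J3 := intble_abs (intbleB IPh I1).
  rewrite -rintD//; apply: le_rint => // [|x]; first exact: intbleD.
  by rewrite -(subrKA (Pd t g x)) ler_normD.
have B5 : s^-1 * rint (chi \o Pd t g) <= 2 * q * (Ce * (1 + E) + 5).
  rewrite mulrC ler_pdivrMr//; apply: (le_trans B2); rewrite /s.
  by move: (Ce * _ + 5) => p; lra.
have B6 : 2 * q * (Ce * (1 + E) + 5) + s <= (2 * Ce + 18) * q * (1 + E).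
  have qE : 0 <= q * E by rewrite mulr_ge0// ltW.
  have key (c z y : R) : 0 <= z -> 0 <= z * y ->
      2 * z * (c * (1 + y) + 5) + z / 2 <= (2 * c + 18) * z * (1 + y) by move=> z0 zy; lra.
  exact: key (ltW q0) qE.
apply: (le_trans B4); rewrite addrC; apply: lerD B3; apply: (le_trans B1).
by rewrite addrC; apply: le_trans B6; rewrite lerD2r.
Qed.

End functional_inequality.

End setup.

(** The function eta is only known on the half line, where h takes its values. *)
Lemma eta_comp_measurable d (T : measurableType d) (R : realType) (eta : R -> R) (b : R)
    (h : T -> R) : H_eta eta b -> measurable_fun [set: T] h -> (forall x, 0 <= h x) ->
  measurable_fun [set: T] (eta \o h).
Proof.
move=> etaP mh h0; have [ceta _ _ _] := eta_C2 etaP.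
have m0 : measurable (`[0, +oo[%classic : set R) by [].
have me : measurable_fun (`[0, +oo[%classic : set R) eta.
  exact: subspace_continuous_measurable_fun.
apply: (measurable_comp m0 _ me mh) => _ [x _ <-].
by rewrite /= in_itv /= h0.
Qed.

Theorem theorem3p2 (R : realType) (E : pseudoPMetricType R)
    (dO : measure_display) (Om : measurableType dO)
    (X : R -> Om -> borel E) (Px : R.-pker (borel E) ~> Om)
    (mu : probability (borel E) R)
    (Pstar : R -> (borel E -> R) -> borel E -> R)
    (A : set (borel E -> R))
    (setting : diffusion_setting X Px mu Pstar A)
    (CP : R) (poincareP : poincare mu (semigroup X Px) A CP)
    (eta : R -> R) (b : R) (etaP : H_eta eta b)
    (a : R) (ab : Num.max 2 b < a)
    (FP : H_F mu (semigroup X Px) A eta a) :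
  (exists Cpsi : R, 0 < Cpsi /\
    forall h : borel E -> R, nice_density mu (semigroup X Px) A h ->
      (\int[mu]_x (psi eta a (h x))%:E
         <= Cpsi%:E *
            \int[mu]_x (psi2 eta a (h x) * carre mu (semigroup X Px) A h x)%:E)%E /\
      forall t : R, 0 <= t ->
        (I_functional mu Pstar (psi eta a) t h
           <= (expR (- t / (2 * Cpsi)))%:E *
              I_functional mu Pstar (psi eta a) 0 h)%E) /\
  (exists Meta Ceta : R, [/\ 0 < Meta, 0 < Ceta &
    forall h : borel E -> R, density mu h ->
      forall t : R, 0 <= t ->
        (tv_dist mu (Pstar t h)
           <= (Meta * expR (- t / (4 * Ceta)))%:E *
              (1 + \int[mu]_x (eta (h x))%:E))%E]).
Proof.
have [inv _ _] := setting_invariant setting.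
have sg := process_markov_semigroup (setting_markov setting) inv.
have Pc := setting_continuous setting; have adj := setting_adjoint setting.
have Abd := setting_bounded setting; have car := setting_carre setting.
have [rho [F [rho1 F_mono F_gt0 F_cap [Ccap F_eta]]]] := FP.
split.
  have [C1 C10 H1] := entropy_energy sg Abd adj car poincareP etaP ab rho1
    F_mono F_gt0 F_cap F_eta.
  have [C2 C20 H2] := entropy_decay sg Pc Abd adj car poincareP etaP ab rho1
    F_mono F_gt0 F_cap F_eta.
  exists (C1 + C2); split; first exact: ltr_wpDl.
  move=> h [dh ddh]; have [mh h0 _] := dh; have [Ih h1] := densityP dh.
  have /(is_carreP sg Abd car)[sh IG _] := carreP ddh.
  have IE f : sqintble mu f -> rint mu f = 1 ->
      (\int[mu]_x (psi eta a (f x))%:E = (rint mu (chi eta a \o f))%:E)%E.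
    move=> sf f1; have If := sqintble_intble sf.
    have [Ip Ep] := rint_psi If (chi_intble etaP ab sf).
    by rewrite (rintE Ip) Ep f1 subrr mul0r addr0.
  split.
    rewrite (IE _ sh h1); have [Ip [p0 hp]] := H1 h h0 h1 ddh.
    rewrite (rintE Ip) -EFinM lee_fin; apply: (le_trans hp).
    by apply: ler_wpM2r => //; rewrite lerDl ltW.
  move=> t t0; rewrite /I_functional.
  have [sPt _] := adjoint_L2_contraction sg adj t0 sh.
  have [sP0 _] := adjoint_L2_contraction sg adj (lexx 0) sh.
  have mP (s : R) : 0 <= s -> rint mu (Pstar s h) = 1.
    by move=> s0; rewrite (adjoint_mean sg adj).
  rewrite (IE _ sPt (mP t t0)) (IE _ sP0 (mP 0 (lexx 0))).
  rewrite -EFinM lee_fin; have [mP0 _] := sP0.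
  have -> : rint mu (chi eta a \o Pstar 0 h) = rint mu (chi eta a \o h).
    apply: eq_ae_rint.
    - exact: intble_measurable (chi_intble etaP ab sP0).
    - exact: intble_measurable (chi_intble etaP ab sh).
    - by apply: filterS (adjoint_0 sg adj Ih) => x /= ->.
  apply: (le_trans (H2 h t sh h0 h1 t0)); apply: ler_wpM2r.
    by apply: rint_ge0 => x; exact: chi_ge0 etaP ab _.
  rewrite ler_expR !mulNr lerN2; apply: ler_wpM2l => //.
  by rewrite lef_pV2 ?posrE ?mulr_gt0 ?ltr_wpDl//; lra.
have [M [C [M0 C0 H]]] := tv_decay sg Pc Abd adj car poincareP etaP ab rho1
  F_mono F_gt0 F_cap F_eta.
exists M, C; split => // h dh t t0.
have [mh h0 _] := dh; have [Ih h1] := densityP dh.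
have eh0 x : 0 <= eta (h x) by apply: (eta_ge0 etaP); exact: h0.
have IPt := adjoint_intble adj t0 Ih.
have I1 := intble_abs (intbleB IPt (intble_cst mu 1)).
rewrite /tv_dist (rintE I1).
have k0 : 0 < M * expR (- t / (4 * C)) by rewrite mulr_gt0// expR_gt0.
have [Ie|Ie] := pselect (intble mu (eta \o h)).
  by rewrite (rintE Ie) -EFinD -EFinM lee_fin; exact: H.
suff -> : (\int[mu]_x (eta (h x))%:E = +oo)%E.
  by rewrite addey// gt0_muley ?leey.
apply: contrapT => ne; apply: Ie; apply/integrableP; split.
  by apply/measurable_EFinP; exact: eta_comp_measurable etaP mh h0.
have -> : (fun x => `|(EFin \o (eta \o h)) x|)%E = (fun x => (eta (h x))%:E).
  by apply/funext => x; rewrite /= ger0_norm.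
by rewrite ltey; apply/eqP.
Qed.
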